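(* Let $\mathcal{R}$ be the root system of type $A_2$, $B_2$ or $G_2$, normalized so that for positive simple roots $\alpha,\beta$: $A_2$: $(\alpha,\alpha)=(\beta,\beta)=2$, $(\alpha,\beta)=-1$; $B_2$: $(\alpha,\alpha)=2$, $(\beta,\beta)=1$, $(\alpha,\beta)=-1$; $G_2$: $(\alpha,\alpha)=6$, $(\beta,\beta)=2$, $(\alpha,\beta)=-3$. Let $\mathcal{R}^+$ be the set of positive roots and $\mathbf{z}_\alpha=(\alpha,\mathbf{z})$ for $\mathbf{z}\in\mathbb{C}^2$. Then $$\sum_{\{\alpha,\beta\}\subset\mathcal{R}^+,\ \alpha\neq\beta}(\alpha,\beta)\,f^{(3,0)}(\mathbf{z}_\alpha,\tau)\,f^{(3,0)}(\mathbf{z}_\beta,\tau)+\sum_{\alpha\in\mathcal{R}^+}k_\alpha f^{(2,1)}(\mathbf{z}_\alpha,\tau)=0,$$ where the first sum is over unordered pairs of distinct positive roots (each pair counted once) and: for $A_2$, $k_\alpha=1$ for all roots; for $B_2$, $k_{short}=2$, $k_{long}=1$; for $G_2$, $k_{short}=10$, $k_{long}=6$.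
   Context: $f^{(m,n)}(z,\tau)=\partial_z^m\partial_\tau^nf(z,\tau)$, $\tau$ in the upper half plane, $q=e^{2\pi i\tau}$, where $$f(z,\tau)=\frac1{(2\pi i)^3}\{\mathcal{L}i_3(e^{2\pi iz},q)-\mathcal{L}i_3(1,q)\},$$ $$\mathcal{L}i_3(\zeta,q)=\sum_{n=0}^\infty Li_3(q^n\zeta)+\sum_{n=1}^\infty Li_3(q^n\zeta^{-1})-\sum_{j=0}^3\frac{B_{j+1}}{(3-j)!(j+1)!}(\log\zeta)^{3-j}(\log q)^j,$$ $Li_3(x)=\sum_{n\ge1}x^n/n^3$, $x/(e^x-1)=\sum B_nx^n/n!$, $\log\zeta=2\pi iz$ and $\log q=2\pi i\tau$ for $\zeta=e^{2\pi iz}$. The series converge for $0<\mathrm{Im}\,z<\mathrm{Im}\,\tau$; $f$ is continued analytically to $z\notin\mathbb{Z}+\tau\mathbb{Z}$, with branches differing by polynomials of degree $\le2$ in $(z,\tau)$, so the third derivatives are single-valued (meromorphic in $z$). The bilinear form is extended complex-bilinearly to $\mathbb{C}^2$, and the identity is understood where all terms are defined. *)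

(* Defs.v *)
From Stdlib Require Import Reals Lra Lia ZArith List.
From Coquelicot Require Import Coquelicot.
Import ListNotations.

Open Scope R_scope.

(** * Bernoulli numbers *)

(* [bern_aux n k] is B_k / k! for k <= n, from the recurrence obtained by
   multiplying x / (e^x - 1) by (e^x - 1) / x;
   see [bernoulli_generating_function]. *)
Fixpoint bern_aux (n : nat) : nat -> R :=
  match n with
  | O => fun _ => 1
  | S m => fun k =>
      if (k <=? m)%nat then bern_aux m k
      else - sum_f_R0 (fun j => bern_aux m j / INR (fact (S (S m - j)))) m
  end.

Definition bernoulli (n : nat) : R := INR (fact n) * bern_aux n n.

Lemma bern_aux_stable (n k : nat) : (k <= n)%nat -> bern_aux n k = bern_aux k k.
Proof.
  induction n as [|n IH]; intros H.
  - now replace k with 0%nat by lia.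
  - destruct (Nat.eq_dec k (S n)) as [->|Hk]; [reflexivity|].
    simpl. destruct (Nat.leb_spec k n); [apply IH; lia | lia].
Qed.

Lemma bern_aux_rec (n : nat) :
  bern_aux (S n) (S n)
  = - sum_f_R0 (fun j => bern_aux j j / INR (fact (S (S n - j)))) n.
Proof.
  cbn [bern_aux]. destruct (Nat.leb_spec (S n) n); [lia|].
  f_equal. apply sum_eq. intros j Hj. now rewrite bern_aux_stable.
Qed.

Lemma inv_fact_le (i : nat) : / INR (fact (S i)) <= (/ 2) ^ i.
Proof.
  induction i as [|i IH]; [simpl; lra|].
  change (fact (S (S i))) with (S (S i) * fact (S i))%nat.
  rewrite mult_INR, Rinv_mult. simpl pow.
  apply Rmult_le_compat.
  - left. apply Rinv_0_lt_compat, lt_0_INR; lia.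
  - left. apply Rinv_0_lt_compat, INR_fact_lt_0.
  - apply Rinv_le_contravar; [lra|].
    rewrite !S_INR. pose proof (pos_INR i); lra.
  - exact IH.
Qed.

Lemma half_sum_le (n : nat) : sum_f_R0 (fun j => (/ 2) ^ (S n - j)) n <= 1.
Proof.
  induction n as [|n IH]; [simpl; lra|].
  rewrite tech5.
  rewrite (sum_eq _ (fun j => (/ 2) ^ (S n - j) * / 2)).
  - rewrite <- scal_sum. replace (S (S n) - S n)%nat with 1%nat by lia.
    rewrite pow_1. lra.
  - intros j Hj. replace (S (S n) - j)%nat with (S (S n - j)) by lia.
    simpl pow. ring.
Qed.

Lemma bern_aux_bound (n : nat) : Rabs (bern_aux n n) <= 1.
Proof.
  induction n as [n IH] using lt_wf_ind.
  destruct n as [|n]; [simpl; rewrite Rabs_R1; lra|].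
  rewrite bern_aux_rec, Rabs_Ropp.
  eapply Rle_trans; [apply Rsum_abs|].
  eapply Rle_trans; [|apply (half_sum_le n)].
  apply sum_Rle. intros j Hj.
  unfold Rdiv. rewrite Rabs_mult, <- (Rmult_1_l ((/ 2) ^ _)).
  apply Rmult_le_compat; try apply Rabs_pos.
  - apply IH; lia.
  - rewrite Rabs_pos_eq.
    + apply inv_fact_le.
    + left. apply Rinv_0_lt_compat, INR_fact_lt_0.
Qed.

Lemma CV_radius_ge_1 (a : nat -> R) (x : R) :
  (forall n, Rabs (a n) <= 1) -> Rabs x < 1 -> Rbar_lt (Rabs x) (CV_radius a).
Proof.
  intros Ha Hx.
  pose proof (Rabs_pos x) as Hx0.
  set (y := (Rabs x + 1) / 2).
  assert (Hy : 0 <= y <= 1 /\ Rabs x < y) by (unfold y; lra).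
  apply Rbar_lt_le_trans with (y := Finite (Rabs y)).
  - simpl. rewrite (Rabs_pos_eq y); lra.
  - apply CV_radius_bounded. exists 1. intros n.
    rewrite Rabs_mult, (Rabs_pos_eq y), <- RPow_abs, (Rabs_pos_eq y)
      by apply Hy.
    rewrite <- (Rmult_1_l 1).
    apply Rmult_le_compat; [apply Rabs_pos | apply pow_le, Hy | apply Ha |].
    rewrite <- (pow1 n). apply pow_incr, Hy.
Qed.

Lemma bernoulli_generating_function (x : R) :
  0 < Rabs x < 1 ->
  is_series (fun n => bernoulli n * x ^ n / INR (fact n)) (x / (exp x - 1)).
Proof.
  intros [Hx0 Hx1].
  assert (Hxn : x <> 0) by (intros ->; rewrite Rabs_R0 in Hx0; lra).
  assert (Hen : exp x - 1 <> 0).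
  { intros H. apply Hxn, exp_inv. rewrite exp_0. lra. }
  set (a := fun n => bern_aux n n).
  set (b := fun n => / INR (fact (S n))).
  assert (Hra : Rbar_lt (Rabs x) (CV_radius a))
    by (apply CV_radius_ge_1; [apply bern_aux_bound | easy]).
  assert (Hrb : Rbar_lt (Rabs x) (CV_radius b)).
  { apply CV_radius_ge_1; [|easy]. intros n. unfold b. rewrite Rabs_pos_eq.
    - eapply Rle_trans; [apply inv_fact_le|].
      rewrite <- (pow1 n). apply pow_incr. lra.
    - left. apply Rinv_0_lt_compat, INR_fact_lt_0. }
  assert (Ea : is_pseries a x (PSeries a x))
    by (apply PSeries_correct, CV_radius_inside, Hra).
  assert (Eb : is_pseries b x ((exp x - 1) / x)).
  { pose proof (is_exp_Reals x) as He.
    apply (is_pseries_decr_1 _ x (/ x)) in He.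
    2:{ change (/ x * x = 1). now field. }
    match type of He with is_pseries _ _ ?v =>
      replace ((exp x - 1) / x) with v end; [exact He|].
    change (/ x * (exp x + - / INR (fact 0)) = (exp x - 1) / x).
    simpl. field. easy. }
  pose proof (is_pseries_mult _ _ _ _ _ Ea Eb Hra Hrb) as Hm.
  assert (H1 : is_pseries (PS_mult a b) x 1).
  { apply is_pseries_ext with (a := fun n => match n with O => 1 | _ => 0 end).
    - intros [|n]; unfold PS_mult.
      + unfold a, b. simpl. field.
      + rewrite tech5. replace (S n - S n)%nat with 0%nat by lia.
        unfold a at 2. rewrite bern_aux_rec. unfold b at 2.
        change (INR (fact 1)) with 1. rewrite Rinv_1, Rmult_1_r.
        symmetry. apply Rplus_opp_r.
    - apply is_pseries_R.
      apply is_series_ext with (fun n => match n with O => 1 | _ => 0 end).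
      + intros [|n]; simpl; ring.
      + apply is_series_Reals. intros e He. exists 0%nat. intros n _.
        assert (E : sum_f_R0 (fun n => match n with O => 1 | _ => 0 end) n = 1).
        { clear. induction n as [|n IH]; [easy|]. rewrite tech5, IH. ring. }
        rewrite E, R_dist_eq. exact He. }
  assert (Ep : PSeries a x * ((exp x - 1) / x) = 1).
  { apply is_pseries_unique in Hm. apply is_pseries_unique in H1. congruence. }
  replace (x / (exp x - 1)) with (PSeries a x).
  2:{ apply Rmult_eq_reg_r with ((exp x - 1) / x).
      - rewrite Ep. now field.
      - intros H. rewrite H, Rmult_0_r in Ep. lra. }
  apply is_pseries_R in Ea. eapply is_series_ext; [|exact Ea].
  intros n. unfold bernoulli, a. simpl. field. apply INR_fact_neq_0.
Qed.

(** * The function f *)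

Open Scope C_scope.

Definition cexp (z : C) : C := (exp (Re z) * cos (Im z), exp (Re z) * sin (Im z))%R.

Definition two_pi_i : C := RtoC (2 * PI) * Ci.

(* Meaningful for convergent series only. *)
Definition CSeries (a : nat -> C) : C :=
  (Series (fun n => Re (a n)), Series (fun n => Im (a n))).

Definition Li3 (x : C) : C :=
  CSeries (fun n => x ^ S n / RtoC (INR (S n)) ^ 3).

(* The function Li_3(zeta, q) with zeta = e^{2 pi i z}, q = e^{2 pi i tau},
   log zeta = 2 pi i z and log q = 2 pi i tau. *)
Definition elliptic_Li3 (z tau : C) : C :=
  let zeta := cexp (two_pi_i * z) in
  let q := cexp (two_pi_i * tau) in
  CSeries (fun n => Li3 (q ^ n * zeta))
  + CSeries (fun n => Li3 (q ^ S n * / zeta))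
  - sum_n (fun j =>
      RtoC (bernoulli (j + 1) / (INR (fact (3 - j)) * INR (fact (j + 1))))
      * (two_pi_i * z) ^ (3 - j) * (two_pi_i * tau) ^ j) 3.

(* The determination given by the convergent series on 0 < Im z < Im tau; the
   subtracted term is Li_3(1, q), with log 1 = 0. *)
Definition f_strip (z tau : C) : C :=
  / two_pi_i ^ 3 * (elliptic_Li3 z tau - elliptic_Li3 0 tau).

(** * Analytic continuation *)

Definition in_strip (z tau : C) : Prop := (0 < Im z < Im tau)%R.

Definition off_lattice (z tau : C) : Prop :=
  (0 < Im tau)%R /\
  forall m n : Z, z <> RtoC (IZR m) + RtoC (IZR n) * tau.

Record polydisc := Polydisc {
  ctr_z : C; ctr_tau : C; rad_z : posreal; rad_tau : posreal }.

Definition in_polydisc (P : polydisc) (z tau : C) : Prop :=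
  (Cmod (z - ctr_z P) < rad_z P)%R /\ (Cmod (tau - ctr_tau P) < rad_tau P)%R.

(* On P, g is the sum of an absolutely convergent double power series
   around the centre of P. *)
Definition analytic_on (P : polydisc) (g : C -> C -> C) : Prop :=
  exists a : nat -> nat -> C,
  forall z tau : C, in_polydisc P z tau ->
    let term j k := a j k * (z - ctr_z P) ^ j * (tau - ctr_tau P) ^ k in
    (exists M : R, forall N : nat,
       (sum_n (fun j => sum_n (fun k => Cmod (term j k)) N) N <= M)%R) /\
    filterlim (fun N : nat => sum_n (fun j => sum_n (fun k => term j k) N) N)
      eventually (locally (g z tau)).

(* [f_branch P g]: g restricted to P is a determination of f, obtained from
   [f_strip] by analytic continuation along a finite chain of polydiscs in
   the complement of the lattice points. *)
Inductive f_branch : polydisc -> (C -> C -> C) -> Prop :=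
| f_branch_strip (P : polydisc) (g : C -> C -> C) :
    (forall z tau, in_polydisc P z tau -> in_strip z tau) ->
    (forall z tau, in_polydisc P z tau -> g z tau = f_strip z tau) ->
    f_branch P g
| f_branch_step (P Q : polydisc) (g h : C -> C -> C) :
    f_branch P g ->
    (forall z tau, in_polydisc Q z tau -> off_lattice z tau) ->
    analytic_on Q h ->
    (exists z tau, in_polydisc P z tau /\ in_polydisc Q z tau) ->
    (forall z tau, in_polydisc P z tau -> in_polydisc Q z tau ->
       g z tau = h z tau) ->
    f_branch Q h.

(* Order m in z and n in tau. [C_derive] agrees with the complex derivative
   wherever the latter exists, which covers every determination of f. *)
Definition partial (m n : nat) (g : C -> C -> C) (z tau : C) : C :=
  Nat.iter m C_derive (fun z' => Nat.iter n C_derive (g z') tau) z.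

(* [is_f_deriv m n z tau w]: w is the value at (z, tau) of f^{(m,n)}, computed
   on some determination of f; for m + n = 3 it does not depend on which. *)
Definition is_f_deriv (m n : nat) (z tau w : C) : Prop :=
  exists (P : polydisc) (g : C -> C -> C),
    f_branch P g /\ in_polydisc P z tau /\ w = partial m n g z tau.

(** * Root systems of rank two *)

Inductive rank2_type := A2 | B2 | G2.

(* Vectors are given by their coordinates in the basis of simple roots
   (alpha, beta); [gram T] is ((alpha,alpha), (beta,beta), (alpha,beta)). *)
Definition gram (T : rank2_type) : Z * Z * Z :=
  match T with
  | A2 => (2, 2, -1)
  | B2 => (2, 1, -1)
  | G2 => (6, 2, -3)
  end%Z.

Definition form (T : rank2_type) (u v : Z * Z) : Z :=
  let '(aa, bb, ab) := gram T in
  (aa * (fst u * fst v) + bb * (snd u * snd v)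
   + ab * (fst u * snd v + snd u * fst v))%Z.

Definition formC (T : rank2_type) (u v : C * C) : C :=
  let '(aa, bb, ab) := gram T in
  RtoC (IZR aa) * (fst u * fst v) + RtoC (IZR bb) * (snd u * snd v)
  + RtoC (IZR ab) * (fst u * snd v + snd u * fst v).

Definition vecC (u : Z * Z) : C * C := (RtoC (IZR (fst u)), RtoC (IZR (snd u))).

(* The division is exact on roots. *)
Definition reflect (T : rank2_type) (u v : Z * Z) : Z * Z :=
  let c := (2 * form T u v / form T u u)%Z in
  (fst v - c * fst u, snd v - c * snd u)%Z.

Inductive root (T : rank2_type) : Z * Z -> Prop :=
| root_alpha : root T (1, 0)%Z
| root_beta : root T (0, 1)%Z
| root_reflect u v : root T u -> root T v -> root T (reflect T u v).

Definition pos_root (T : rank2_type) (u : Z * Z) : Prop :=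
  root T u /\ (0 <= fst u)%Z /\ (0 <= snd u)%Z.

Definition pos_roots (T : rank2_type) : list (Z * Z) :=
  match T with
  | A2 => [(1, 0); (0, 1); (1, 1)]
  | B2 => [(1, 0); (0, 1); (1, 1); (1, 2)]
  | G2 => [(1, 0); (0, 1); (1, 1); (1, 2); (1, 3); (2, 3)]
  end%Z.

Lemma pos_roots_NoDup (T : rank2_type) : NoDup (pos_roots T).
Proof.
  destruct T; simpl;
    repeat (constructor; [simpl; intuition discriminate|]); constructor.
Qed.

Lemma root_closed (T : rank2_type) (u v : Z * Z) :
  let l := pos_roots T ++ map (fun w => (- fst w, - snd w)%Z) (pos_roots T) in
  In u l -> In v l -> In (reflect T u v) l.
Proof.
  destruct T; cbn; intros Hu Hv;
    repeat (destruct Hu as [<-|Hu]; [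
      repeat (destruct Hv as [<-|Hv]; [vm_compute; tauto|]); destruct Hv|]);
    destruct Hu.
Qed.

Lemma pos_rootsP (T : rank2_type) (u : Z * Z) :
  In u (pos_roots T) <-> pos_root T u.
Proof.
  split.
  - pose proof (root_alpha T) as Ha. pose proof (root_beta T) as Hb.
    pose proof (root_reflect T _ _ Ha Hb) as Hab.
    pose proof (root_reflect T _ _ Hb Ha) as Hba.
    pose proof (root_reflect T _ _ Hb Hab) as Hbab.
    pose proof (root_reflect T _ _ Ha Hba) as Haba.
    destruct T; cbv in Ha, Hb, Hab, Hba, Hbab, Haba; simpl; intros Hu;
      repeat (destruct Hu as [<-|Hu];
              [split; [assumption | simpl; lia]|]); destruct Hu.
  - intros [Hr [H1 H2]].
    assert (Hl : In u (pos_roots T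
                 ++ map (fun w => (- fst w, - snd w)%Z) (pos_roots T))).
    { clear H1 H2. induction Hr.
      - destruct T; simpl; tauto.
      - destruct T; simpl; tauto.
      - now apply root_closed. }
    apply in_app_or in Hl. destruct Hl as [Hl|Hl]; [exact Hl|exfalso].
    destruct T; cbn in Hl;
      repeat (destruct Hl as [<-|Hl]; [cbn in H1, H2; lia|]); destruct Hl.
Qed.

(* Short roots have square length 1 in B2 and 2 in G2. *)
Definition k_coef (T : rank2_type) (u : Z * Z) : Z :=
  match T with
  | A2 => 1
  | B2 => if form T u u =? 1 then 2 else 1
  | G2 => if form T u u =? 2 then 10 else 6
  end%Z.

Fixpoint unordered_pairs {A : Type} (l : list A) : list (A * A) :=
  match l with
  | [] => []
  | x :: l' => map (pair x) l' ++ unordered_pairs l'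
  end.

Definition Csum {A : Type} (l : list A) (F : A -> C) : C :=
  fold_right (fun x s => F x + s) 0 l.

(* Main.v *)
Require Import Defs.
From Stdlib Require Import Reals ZArith List Lra Lia.
From Coquelicot Require Import Coquelicot.
Open Scope C_scope.

(* The determinations of f differ by polynomials of degree at most 2, and both
   third derivatives are Lambert series: with L(x) = x / (1 - x), zeta = e^(2 pi i z),
     f^(3,0) = 1/2 + sum_(n>=0) L(q^n zeta) - sum_(n>=1) L(q^n / zeta),
     f^(2,1) = -1/12 + sum_(n>=1) n (L(q^n zeta) + L(q^n / zeta)).
   These formulas come from termwise differentiation in the strip and extend to
   every determination by the identity theorem. From
     L(x) L(y) = L(xy) (1 + L(x) + L(y))
   one gets, by rearranging double series, for F = f^(3,0) and G = f^(2,1),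
     F(a) F(b) - F(a+b) (F(a) + F(b)) = G(a) + G(b) + G(a+b).
   This is the case A2; the identities for B2 and G2 are integral combinations of
   it over the triples of positive roots u, v, u + v. *)

(** * Complex series and double series *)

(** The hypotheses speak of an arbitrary determination reached along a chain of polydiscs, so
    formulas in the strip are only the start. Instead of following [f], whose determinations change,
    the induction along the chain follows its third derivatives and compares them on each polydisc
    with the Lambert series, which are single-valued off the lattice. Holomorphy is handled through
    a quadratic error bound, [quad_diff], which passes through infinite sums by adding constants.
    The identity theorem then needs only a Cauchy estimate with a lossy constant: it is applied to
    [f / (z - p)^N] for every [N], and a factor independent of [N] is harmless. The addition formula
    is proved directly off the lattice rather than continued from the strip. Its difficulty lies in
    the products of a series in [q^m zeta_a] with a series in [q^n / zeta_b]: the quotient of the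
    two arguments contains powers of [q] of both signs, so the double series has to be cut along the
    diagonal before it is rearranged. *)

Definition is_csum (a : nat -> C) (l : C) : Prop :=
  is_series (fun n => Re (a n)) (Re l) /\ is_series (fun n => Im (a n)) (Im l).

Lemma C_eq (x y : C) : Re x = Re y -> Im x = Im y -> x = y.
Proof. destruct x, y; simpl; congruence. Qed.

Lemma im_le_Cmod (c : C) : (Rabs (Im c) <= Cmod c)%R.
Proof.
  eapply Rle_trans; [|apply Rmax_Cmod]. apply Rmax_r.
Qed.

Lemma csum_unique a l : is_csum a l -> CSeries a = l.
Proof.
  intros [H1 H2]. apply C_eq; simpl; now apply is_series_unique.
Qed.

Lemma csum_ext a b l : (forall n, a n = b n) -> is_csum a l -> is_csum b l.
Proof.
  intros E [H1 H2]. split.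
  - eapply is_series_ext; [|exact H1]. intros n; simpl; now rewrite E.
  - eapply is_series_ext; [|exact H2]. intros n; simpl; now rewrite E.
Qed.

Lemma CSeries_ext a b : (forall n, a n = b n) -> CSeries a = CSeries b.
Proof.
  intros E. unfold CSeries. f_equal; apply Series_ext; intros n; simpl; now rewrite E.
Qed.

Lemma csum_plus a b la lb :
  is_csum a la -> is_csum b lb -> is_csum (fun n => a n + b n) (la + lb).
Proof.
  intros [H1 H2] [H3 H4]. split.
  - exact (is_series_plus _ _ _ _ H1 H3).
  - exact (is_series_plus _ _ _ _ H2 H4).
Qed.

Lemma csum_scal c a la : is_csum a la -> is_csum (fun n => c * a n) (c * la).
Proof.
  intros [H1 H2]. split.
  - refine (is_series_minus _ _ _ _ (is_series_scal (Re c) _ _ H1)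
             (is_series_scal (Im c) _ _ H2)).
  - apply (is_series_plus _ _ _ _ (is_series_scal (Re c) _ _ H2)
             (is_series_scal (Im c) _ _ H1)).
Qed.

Lemma csum_minus a b la lb :
  is_csum a la -> is_csum b lb -> is_csum (fun n => a n - b n) (la - lb).
Proof.
  intros H1 H2. replace (la - lb) with (la + RtoC (-1) * lb) by ring.
  eapply csum_ext; [|apply csum_plus; [exact H1|apply (csum_scal (RtoC (-1))), H2]].
  intros n; simpl. ring.
Qed.

Lemma csum_decr_1 a l : is_csum (fun n => a (S n)) l -> is_csum a (a O + l).
Proof.
  intros [H1 H2]. split;
    [apply (is_series_decr_1 (fun n => Re (a n))) | apply (is_series_decr_1 (fun n => Im (a n)))].
  - match goal with |- is_series _ ?v => replace v with (Re l) end;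
      [exact H1 | unfold Re, Im, plus, opp; simpl; ring].
  - match goal with |- is_series _ ?v => replace v with (Im l) end;
      [exact H2 | unfold Re, Im, plus, opp; simpl; ring].
Qed.

Lemma csum_incr_1 a l : is_csum a l -> is_csum (fun n => a (S n)) (l - a O).
Proof.
  intros [H1 H2]. split;
    [apply (is_series_incr_1 (fun n => Re (a n))) | apply (is_series_incr_1 (fun n => Im (a n)))].
  - match goal with |- is_series _ ?v => replace v with (Re l) end;
      [exact H1 | unfold Re, Im, plus, opp; simpl; ring].
  - match goal with |- is_series _ ?v => replace v with (Im l) end;
      [exact H2 | unfold Re, Im, plus, opp; simpl; ring].
Qed.

Lemma csum_zero : is_csum (fun _ => 0) 0.
Proof.
  assert (H : is_series (fun _ : nat => 0%R) 0%R).
  { apply (filterlim_ext (fun _ : nat => 0%R)); [|apply filterlim_const].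
    intros n. rewrite sum_n_const. ring. }
  split; exact H.
Qed.

(** Padding with zeros turns a sum over a triangle into one over the full quadrant, where the order
    of summation can be exchanged. *)
Lemma csum_shift m a l :
  is_csum a l -> is_csum (fun k => if (m <=? k)%nat then a (k - m)%nat else 0) l.
Proof.
  intros H. induction m as [|m IH].
  - eapply csum_ext; [|exact H]. intros n; simpl. now rewrite Nat.sub_0_r.
  - replace l with (0 + l) by ring.
    apply (csum_decr_1 (fun k => if (S m <=? k)%nat then a (k - S m)%nat else 0)).
    exact IH.
Qed.

Lemma csum_finite (a : nat -> C) N :
  (forall n, (N < n)%nat -> a n = 0) -> is_csum a (sum_n a N).
Proof.
  revert a; induction N as [|N IH]; intros a H.
  - rewrite sum_O, <- (Cplus_0_r (a O)).
    apply csum_decr_1. eapply csum_ext; [|apply csum_zero].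
    intros n; simpl; rewrite H; [reflexivity|lia].
  - assert (E : sum_n a (S N) = a O + sum_n (fun n => a (S n)) N).
    { unfold sum_n. rewrite sum_Sn_m by lia. now rewrite sum_n_m_S. }
    rewrite E. apply csum_decr_1, IH. intros n Hn; apply H; lia.
Qed.

Lemma unimodular_phase (l : C) : exists u, Cmod u = 1%R /\ u * l = RtoC (Cmod l).
Proof.
  destruct (Req_dec (Cmod l) 0) as [E|E].
  - exists 1. split; [apply Cmod_1|]. rewrite E. apply Cmod_eq_0 in E. rewrite E. ring.
  - assert (Hn : RtoC (Cmod l) <> 0) by (intros K; apply E; now injection K).
    exists (Cconj l / RtoC (Cmod l)). split.
    + rewrite Cmod_div, Cmod_conj, Cmod_R, Rabs_pos_eq by (auto; apply Cmod_ge_0).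
      field. easy.
    + replace (Cconj l / RtoC (Cmod l) * l) with ((l * Cconj l) / RtoC (Cmod l))
        by (field; easy).
      rewrite <- Cmod2_conj, RtoC_pow. field. easy.
Qed.

(** The modulus is the largest real part among the rotations of [l], so inequalities between real
    series pass to moduli without loss in the constant. *)
Lemma Cmod_dual (l : C) (B : R) :
  (forall u, Cmod u = 1 -> (Re (u * l) <= B)%R) -> (Cmod l <= B)%R.
Proof.
  intros H. destruct (unimodular_phase l) as [u [Hu E]].
  specialize (H u Hu). now rewrite E in H.
Qed.

Lemma re_le (c : C) : (Re c <= Cmod c)%R.
Proof. eapply Rle_trans; [apply Rle_abs|apply re_le_Cmod]. Qed.

Lemma csum_le a l b s :
  is_csum a l -> is_series b s -> (forall n, (Cmod (a n) <= b n)%R) ->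
  (Cmod l <= s)%R.
Proof.
  intros Ha Hb H. apply Cmod_dual. intros u Hu.
  destruct (csum_scal u _ _ Ha) as [H1 _].
  eapply is_lim_seq_le with (l1 := Finite _) (l2 := Finite _); [|exact H1|exact Hb].
  intros n. apply sum_n_m_le. intros k.
  eapply Rle_trans; [apply re_le|]. rewrite Cmod_mult, Hu, Rmult_1_l. apply H.
Qed.

Lemma csum_abs a b :
  (forall n, (Cmod (a n) <= b n)%R) -> ex_series b -> is_csum a (CSeries a).
Proof.
  intros H Hb. split; apply Series_correct.
  - refine (@ex_series_le R_AbsRing R_CompleteNormedModule _ b _ Hb).
    intros n. eapply Rle_trans; [apply re_le_Cmod|apply H].
  - refine (@ex_series_le R_AbsRing R_CompleteNormedModule _ b _ Hb).
    intros n. eapply Rle_trans; [apply im_le_Cmod|apply H].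
Qed.

Lemma is_series_geom_B (B x : R) :
  (0 <= x < 1)%R -> is_series (fun n => B * x ^ n)%R (B * / (1 - x))%R.
Proof.
  intros Hx. apply (@is_series_scal R_AbsRing R_NormedModule B); apply is_series_geom.
  rewrite Rabs_pos_eq; lra.
Qed.

Lemma csum_geom_ex a B x :
  (0 <= x < 1)%R -> (forall n, (Cmod (a n) <= B * x ^ n)%R) -> is_csum a (CSeries a).
Proof.
  intros Hx H. eapply csum_abs; [exact H|]. eexists; now apply is_series_geom_B.
Qed.

Lemma csum_geom_bound a B x :
  (0 <= x < 1)%R -> (forall n, (Cmod (a n) <= B * x ^ n)%R) ->
  (Cmod (CSeries a) <= B * / (1 - x))%R.
Proof.
  intros Hx H. eapply csum_le; [eapply csum_geom_ex; eauto| now apply is_series_geom_B | exact H].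
Qed.

Definition Clim (u : nat -> C) (l : C) : Prop :=
  is_lim_seq (fun n => Cmod (u n - l)) 0.

Lemma Clim_unique u l1 l2 : Clim u l1 -> Clim u l2 -> l1 = l2.
Proof.
  intros H1 H2. unfold Clim in *.
  pose proof (is_lim_seq_plus' _ _ _ _ H1 H2) as H.
  assert (K : (Cmod (l1 - l2) <= 0 + 0)%R).
  { eapply is_lim_seq_le with (l1 := Finite _) (l2 := Finite _);
      [|apply is_lim_seq_const|exact H].
    intros n; simpl. replace (l1 - l2) with ((u n - l2) + - (u n - l1)) by ring.
    eapply Rle_trans; [apply Cmod_triangle|]. rewrite Cmod_opp. lra. }
  assert (E : l1 - l2 = 0) by (apply Cmod_eq_0; pose proof (Cmod_ge_0 (l1 - l2)); lra).
  replace l1 with ((l1 - l2) + l2) by ring. rewrite E. ring.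
Qed.

Lemma Re_sum_n (a : nat -> C) N : Re (sum_n a N) = sum_n (fun n => Re (a n)) N.
Proof.
  induction N as [|N IH]; [now rewrite !sum_O|].
  rewrite !sum_Sn, <- IH. reflexivity.
Qed.

Lemma Im_sum_n (a : nat -> C) N : Im (sum_n a N) = sum_n (fun n => Im (a n)) N.
Proof.
  induction N as [|N IH]; [now rewrite !sum_O|].
  rewrite !sum_Sn, <- IH. reflexivity.
Qed.

Lemma Cmod_le_abs (c : C) : (Cmod c <= Rabs (Re c) + Rabs (Im c))%R.
Proof.
  rewrite <- (Cmod_R (Re c)), <- (Cmod_R (Im c)).
  replace (Cmod (RtoC (Im c))) with (Cmod (Ci * RtoC (Im c)))
    by (rewrite Cmod_mult, Cmod_Ci; ring).
  eapply Rle_trans; [|apply Cmod_triangle]. right. f_equal.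
  apply C_eq; simpl; ring.
Qed.

Lemma csum_Clim (a : nat -> C) l : is_csum a l -> Clim (sum_n a) l.
Proof.
  intros [H1 H2]. unfold Clim.
  assert (K1 : is_lim_seq (fun n => Rabs (Re (sum_n a n) - Re l)) 0).
  { rewrite <- (Rabs_R0). apply (is_lim_seq_abs _ (Finite 0)).
    replace (Finite 0) with (Finite (Re l - Re l)) by (f_equal; ring).
    apply is_lim_seq_minus'; [|apply is_lim_seq_const].
    eapply is_lim_seq_ext; [|exact H1]. intros n; simpl. symmetry; apply Re_sum_n. }
  assert (K2 : is_lim_seq (fun n => Rabs (Im (sum_n a n) - Im l)) 0).
  { rewrite <- (Rabs_R0). apply (is_lim_seq_abs _ (Finite 0)).
    replace (Finite 0) with (Finite (Im l - Im l)) by (f_equal; ring).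
    apply is_lim_seq_minus'; [|apply is_lim_seq_const].
    eapply is_lim_seq_ext; [|exact H2]. intros n; simpl. symmetry; apply Im_sum_n. }
  pose proof (is_lim_seq_plus' _ _ _ _ K1 K2) as K. rewrite Rplus_0_l in K.
  eapply is_lim_seq_le_le; [|apply is_lim_seq_const|exact K].
  intros n; simpl; split; [apply Cmod_ge_0|apply Cmod_le_abs].
Qed.

(** One majorant serves all exchanges of summation: it is symmetric in the two indices and controls
    rows, columns and square partial sums with explicit constants. *)
Definition geom_dom (B x : R) (t : nat -> nat -> C) : Prop :=
  forall m n, (Cmod (t m n) <= B * x ^ m * x ^ n)%R.

Definition Dsum (t : nat -> nat -> C) : C := CSeries (fun m => CSeries (t m)).

Lemma geom_dom_inner B x t m :
  (0 <= x < 1)%R -> geom_dom B x t -> is_csum (t m) (CSeries (t m)).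
Proof. intros Hx H. eapply csum_geom_ex; [exact Hx|]. intros n; apply H. Qed.

Lemma geom_dom_inner_bound B x t m :
  (0 <= x < 1)%R -> geom_dom B x t ->
  (Cmod (CSeries (t m)) <= B * / (1 - x) * x ^ m)%R.
Proof.
  intros Hx H. eapply Rle_trans; [eapply csum_geom_bound; [exact Hx|intros n; apply H]|].
  right; ring.
Qed.

Lemma geom_dom_outer B x t :
  (0 <= x < 1)%R -> geom_dom B x t -> is_csum (fun m => CSeries (t m)) (Dsum t).
Proof.
  intros Hx H. eapply csum_geom_ex; [exact Hx|].
  intros n. eapply geom_dom_inner_bound; eauto.
Qed.

Lemma Cmod_sum_n_le (a : nat -> C) (b : nat -> R) N :
  (forall n, (Cmod (a n) <= b n)%R) -> (Cmod (sum_n a N) <= sum_n b N)%R.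
Proof.
  intros H. induction N as [|N IH]; [now rewrite !sum_O|].
  rewrite !sum_Sn. eapply Rle_trans; [apply Cmod_triangle|].
  apply Rplus_le_compat; auto.
Qed.

Lemma geom_sum_le (B x : R) N :
  (0 <= B)%R -> (0 <= x < 1)%R -> (sum_n (fun n => B * x ^ n) N <= B * / (1 - x))%R.
Proof.
  intros HB Hx.
  eapply is_lim_seq_incr_compare with (u := sum_n (fun n => B * x ^ n)%R).
  - apply (is_series_geom_B B x Hx).
  - intros n. rewrite sum_Sn.
    assert (0 <= B * x ^ S n)%R by (apply Rmult_le_pos; [lra|apply pow_le; lra]).
    unfold plus; simpl in *. lra.
Qed.

(** The induction shifts the sequence instead of lengthening the sum: dropping the first term
    multiplies the majorant by [x]. *)
Lemma csum_tail (a : nat -> C) l B x N :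
  (0 <= x < 1)%R -> is_csum a l -> (forall n, (Cmod (a n) <= B * x ^ n)%R) ->
  (Cmod (sum_n a N - l) <= B * / (1 - x) * x ^ N)%R.
Proof.
  intros Hx. revert a l B. induction N as [|N IH]; intros a l B Ha H.
  - rewrite sum_O. pose proof (csum_incr_1 _ _ Ha) as Hs.
    assert (HB : (0 <= B)%R).
    { specialize (H O). simpl in H. pose proof (Cmod_ge_0 (a O)). lra. }
    replace (a O - l) with (- (l - a O)) by ring. rewrite Cmod_opp.
    eapply Rle_trans; [eapply csum_le; [exact Hs|apply (is_series_geom_B B x Hx)|]|
      right; simpl; ring].
    intros n; simpl. eapply Rle_trans; [apply H|].
    apply Rmult_le_compat_l; [lra|]. simpl.
    pose proof (pow_le x n (proj1 Hx)). nra.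
  - assert (E : sum_n a (S N) = a O + sum_n (fun n => a (S n)) N).
    { unfold sum_n. rewrite sum_Sn_m by lia. now rewrite sum_n_m_S. }
    rewrite E. replace (a O + sum_n (fun n => a (S n)) N - l) with
      (sum_n (fun n => a (S n)) N - (l - a O)) by ring.
    eapply Rle_trans; [apply (IH _ _ (B * x)%R)|].
    + now apply csum_incr_1.
    + intros n. eapply Rle_trans; [apply H|right; simpl; ring].
    + right; simpl; ring.
Qed.

Lemma geom_dom_pos B x t : geom_dom B x t -> (0 <= B)%R.
Proof.
  intros H. specialize (H O O). simpl in H. pose proof (Cmod_ge_0 (t O O)). lra.
Qed.

Lemma Cminus_sum_n (a b : nat -> C) N :
  sum_n a N - sum_n b N = sum_n (fun n => a n - b n) N.
Proof.
  induction N as [|N IH]; [now rewrite !sum_O|].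
  rewrite !sum_Sn, <- IH. unfold plus; simpl. ring.
Qed.

(** Cutting row [m] at [N] costs a multiple of [x ^ N * x ^ m], which is summable over [m] and tends
    to 0 with [N]. Square partial sums treat both indices alike, which yields [Dsum_swap], and they
    are the sums that occur in [analytic_on]. *)
Lemma Dsum_square B x t :
  (0 <= x < 1)%R -> geom_dom B x t ->
  Clim (fun N => sum_n (fun m => sum_n (t m) N) N) (Dsum t).
Proof.
  intros Hx H. pose proof (geom_dom_pos _ _ _ H) as HB.
  pose proof (csum_Clim _ _ (geom_dom_outer _ _ _ Hx H)) as H1.
  assert (H2 : is_lim_seq (fun N => B * / (1 - x) * / (1 - x) * x ^ N)%R 0).
  { replace (Finite 0) with (Rbar_mult (Finite (B * / (1 - x) * / (1 - x))%R) (Finite 0%R)).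
    - apply is_lim_seq_scal_l, is_lim_seq_geom. rewrite Rabs_pos_eq; lra.
    - simpl. f_equal. ring. }
  pose proof (is_lim_seq_plus' _ _ _ _ H1 H2) as H3. rewrite Rplus_0_l in H3.
  eapply is_lim_seq_le_le; [|apply is_lim_seq_const|exact H3].
  intros N; simpl; split; [apply Cmod_ge_0|].
  set (S1 := sum_n (fun m => sum_n (t m) N) N).
  set (S2 := sum_n (fun m => CSeries (t m)) N).
  replace (S1 - Dsum t) with ((S2 - Dsum t) + (S1 - S2)) by ring.
  eapply Rle_trans; [apply Cmod_triangle|]. apply Rplus_le_compat_l.
  unfold S1, S2. rewrite Cminus_sum_n.
  eapply Rle_trans.
  - apply Cmod_sum_n_le with (b := fun m => ((B * / (1 - x) * x ^ N) * x ^ m)%R).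
    intros m. eapply Rle_trans; [apply (csum_tail _ _ (B * x ^ m) x)|].
    + exact Hx.
    + eapply geom_dom_inner; eauto.
    + intros n; apply H.
    + right; ring.
  - eapply Rle_trans; [apply geom_sum_le; [|exact Hx]|right; ring].
    apply Rmult_le_pos; [apply Rmult_le_pos|apply pow_le; lra]; [lra|].
    left; apply Rinv_0_lt_compat; lra.
Qed.

Lemma Dsum_swap B x t :
  (0 <= x < 1)%R -> geom_dom B x t -> Dsum t = Dsum (fun m n => t n m).
Proof.
  intros Hx H.
  apply Clim_unique with (fun N => sum_n (fun m => sum_n (t m) N) N).
  - now apply (Dsum_square B x).
  - eapply is_lim_seq_ext; [|apply (Dsum_square B x (fun m n => t n m) Hx)].
    + intros N; simpl. do 2 f_equal. apply (sum_n_switch (fun m n => t n m)).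
    + intros m n. eapply Rle_trans; [apply H|right; ring].
Qed.

(** * Functions with a quadratic Taylor estimate *)

Lemma exp_quad (x : R) : (Rabs x <= 1 -> 0 <= exp x - 1 - x <= 2 * x ^ 2)%R.
Proof.
  intros Hx. apply Rabs_le_between in Hx.
  pose proof (exp_ineq1_le x). split; [lra|].
  destruct (Rle_dec x 0).
  - pose proof (exp_ineq1_le (- x)) as H1.
    assert (E : (exp x * exp (- x) = 1)%R) by (rewrite <- exp_plus; replace (x + - x)%R with 0%R by ring; apply exp_0).
    pose proof (exp_pos x). nra.
  (* For positive [x] the upper bound on [exp x] comes from the tangent bound at [- x / 2], squared:
     [1 - x / 2] stays positive on the whole range, and its inverse square is at most
     [1 + x + 2 * x ^ 2]. *)
  - pose proof (exp_ineq1_le (- (x / 2))) as H1.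
    set (y := exp (- (x / 2))) in *.
    assert (E : (exp x * (y * y) = 1)%R).
    { unfold y. rewrite <- !exp_plus. replace (x + (- (x / 2) + - (x / 2)))%R with 0%R by field. apply exp_0. }
    pose proof (exp_pos x).
    assert (H2 : ((1 - x / 2) * (1 - x / 2) <= y * y)%R) by nra.
    assert (H3 : (exp x * ((1 - x / 2) * (1 - x / 2)) <= 1)%R) by nra.
    assert (H4 : (1 <= (1 + x + 2 * x ^ 2) * ((1 - x / 2) * (1 - x / 2)))%R).
    { replace ((1 + x + 2 * x ^ 2) * ((1 - x / 2) * (1 - x / 2)))%R
        with (1 + / 2 * (x ^ 2 * ((1 - x) * (5/2 - x))))%R by field.
      assert (0 <= x ^ 2 * ((1 - x) * (5/2 - x)))%R.
      { apply Rmult_le_pos; [apply pow2_ge_0|apply Rmult_le_pos; lra]. }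
      lra. }
    assert (H5 : (0 < (1 - x / 2) * (1 - x / 2))%R) by nra.
    nra.
Qed.

Lemma Rabs_sin_le (y : R) : (Rabs (sin y) <= Rabs y)%R.
Proof.
  destruct (MVT_gen sin 0 y cos) as [c [_ H]].
  - intros; apply is_derive_sin.
  - intros; apply continuity_sin.
  - rewrite sin_0, !Rminus_0_r in H. rewrite H, Rabs_mult.
    pose proof (Rabs_pos y).
    assert (Rabs (cos c) <= 1)%R by (apply Rabs_le; apply COS_bound). nra.
Qed.

Lemma cos_quad (y : R) : (0 <= 1 - cos y <= y ^ 2 / 2)%R.
Proof.
  replace (cos y) with (cos (2 * (y / 2))) by (f_equal; field).
  rewrite cos_2a_sin.
  pose proof (Rabs_sin_le (y / 2)) as H.
  apply Rsqr_le_abs_1 in H. unfold Rsqr in H. nra.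
Qed.

Lemma sin_quad (y : R) : (Rabs y <= 1 -> Rabs (sin y - y) <= y ^ 2)%R.
Proof.
  intros Hy. destruct (MVT_gen sin 0 y cos) as [c [Hc H]].
  - intros; apply is_derive_sin.
  - intros; apply continuity_sin.
  - rewrite sin_0, !Rminus_0_r in H. rewrite H.
    replace (cos c * y - y)%R with (- ((1 - cos c) * y))%R by ring.
    rewrite Rabs_Ropp, Rabs_mult. pose proof (cos_quad c).
    rewrite (Rabs_pos_eq (1 - cos c)) by lra.
    assert (Hc2 : (c ^ 2 <= y ^ 2)%R).
    { unfold Rmin, Rmax in Hc. destruct (Rle_dec 0 y); nra. }
    assert (y ^ 2 = Rabs y * Rabs y)%R by (rewrite <- Rabs_mult, Rabs_pos_eq; nra).
    pose proof (Rabs_pos y). nra.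
Qed.

(** * The complex exponential *)

Lemma cexp_add a b : cexp (a + b) = cexp a * cexp b.
Proof.
  destruct a as [x y], b as [u v].
  unfold cexp, Cplus, Cmult, Re, Im, fst, snd. rewrite exp_plus, cos_plus, sin_plus.
  f_equal; ring.
Qed.

Lemma cexp_0 : cexp 0 = 1.
Proof. unfold cexp. simpl. rewrite exp_0, cos_0, sin_0. apply C_eq; unfold Re, Im; simpl; ring. Qed.

Lemma Cmod_cexp a : Cmod (cexp a) = exp (Re a).
Proof.
  destruct a as [x y]. unfold Cmod, cexp, Re, Im, fst, snd.
  replace ((exp x * cos y) ^ 2 + (exp x * sin y) ^ 2)%R with ((exp x) ^ 2)%R.
  - rewrite sqrt_pow2; [reflexivity|left; apply exp_pos].
  - pose proof (sin2_cos2 y) as H. unfold Rsqr in H.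
    transitivity ((exp x) ^ 2 * (sin y * sin y + cos y * cos y))%R; [rewrite H; ring | ring].
Qed.

Lemma cexp_neq_0 a : cexp a <> 0.
Proof. apply Cmod_gt_0. rewrite Cmod_cexp. apply exp_pos. Qed.

Lemma cexp_opp a : cexp (- a) = / cexp a.
Proof.
  pose proof (cexp_neq_0 a).
  assert (E : cexp (- a) * cexp a = 1) by (rewrite <- cexp_add; replace (- a + a) with (RtoC 0) by ring; apply cexp_0).
  replace (cexp (- a)) with (cexp (- a) * cexp a / cexp a) by (field; easy).
  rewrite E. field. easy.
Qed.

Lemma cexp_INR n a : cexp (RtoC (INR n) * a) = cexp a ^ n.
Proof.
  induction n as [|n IH].
  - simpl. rewrite Cmult_0_l. apply cexp_0.
  - rewrite S_INR, RtoC_plus. replace ((RtoC (INR n) + 1) * a) with (a + RtoC (INR n) * a) by ring.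
    rewrite cexp_add, IH. reflexivity.
Qed.

(** The bound has to hold for every [h], not only for small ones. Multiplied by the modulus of the
    exponential at one end of a segment, the factor [Rmax 1 (exp (Re h))] becomes the larger of the
    moduli at both ends, which is what [cexp_quad_diff] bounds by [E]. *)
Lemma cexp_quad (h : C) :
  (Cmod (cexp h - 1 - h) <= 4 * Rmax 1 (exp (Re h)) * Cmod h ^ 2)%R.
Proof.
  pose proof (Rmax_l 1 (exp (Re h))) as M1. pose proof (Rmax_r 1 (exp (Re h))) as M2.
  set (M := Rmax 1 (exp (Re h))) in *.
  destruct (Rle_dec (Cmod h) 1) as [Hh|Hh].
  - pose proof (re_le_Cmod h) as Hx. pose proof (im_le_Cmod h) as Hy.
    assert (H : (Cmod (cexp h - 1 - h) <= 4 * Cmod h ^ 2)%R).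
    { eapply Rle_trans; [apply Cmod_le_abs|]. rewrite Cmod2_alt.
      destruct h as [x y]; simpl Re in *; simpl Im in *. unfold cexp; simpl.
      pose proof (exp_quad x ltac:(lra)) as E1. pose proof (cos_quad y) as E2.
      pose proof (sin_quad y ltac:(lra)) as E3. pose proof (Rabs_sin_le y) as E4.
      assert (E5 : (exp x <= 4)%R).
      { assert (Hx1 : (Rabs x <= 1)%R) by lra. apply Rabs_le_between in Hx1. nra. }
      assert (E6 : (Rabs (exp x - 1) <= 3 * Rabs x)%R).
      { replace (exp x - 1)%R with ((exp x - 1 - x) + x)%R by ring.
        eapply Rle_trans; [apply Rabs_triang|]. rewrite (Rabs_pos_eq (_ - _)) by lra.
        assert (x ^ 2 = Rabs x * Rabs x)%R by (rewrite <- Rabs_mult, Rabs_pos_eq; nra).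
        pose proof (Rabs_pos x). nra. }
      assert (E7 : (exp x <= 3)%R).
      { eapply Rle_trans; [|apply exp_le_3].
        assert (Hx1 : (x <= 1)%R) by (pose proof (Rle_abs x); lra).
        destruct Hx1 as [Hx1|Hx1]; [left; now apply exp_increasing|right; now rewrite Hx1]. }
      pose proof (exp_pos x).
      assert (A : (Rabs (exp x * cos y + - (1) + - x) <= 2 * x ^ 2 + 3 / 2 * y ^ 2)%R).
      { replace (exp x * cos y + - (1) + - x)%R with ((exp x - 1 - x) + - (exp x * (1 - cos y)))%R by ring.
        eapply Rle_trans; [apply Rabs_triang|]. rewrite Rabs_Ropp, !Rabs_pos_eq; try nra. }
      assert (B : (Rabs (exp x * sin y + - 0 + - y) <= 3 * Rabs x * Rabs y + y ^ 2)%R).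
      { replace (exp x * sin y + - 0 + - y)%R with ((exp x - 1) * sin y + (sin y - y))%R by ring.
        eapply Rle_trans; [apply Rabs_triang|]. rewrite Rabs_mult.
        apply Rplus_le_compat; [|exact E3].
        apply Rmult_le_compat; auto using Rabs_pos. }
      assert (x ^ 2 = Rabs x * Rabs x)%R by (rewrite <- Rabs_mult, Rabs_pos_eq; nra).
      assert (y ^ 2 = Rabs y * Rabs y)%R by (rewrite <- Rabs_mult, Rabs_pos_eq; nra).
      simpl in A, B.
      assert (0 <= (Rabs x - Rabs y) * (Rabs x - Rabs y))%R by apply Rle_0_sqr.
      simpl in *. nra. }
    pose proof (pow2_ge_0 (Cmod h)). nra.
  - assert (H : (Cmod (cexp h - 1 - h) <= exp (Re h) + 1 + Cmod h)%R).
    { eapply Rle_trans; [apply Cmod_triangle|]. rewrite Cmod_opp.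
      apply Rplus_le_compat_r.
      eapply Rle_trans; [apply Cmod_triangle|]. rewrite Cmod_opp, Cmod_1, Cmod_cexp. lra. }
    assert (1 <= Cmod h ^ 2)%R by nra.
    assert (Cmod h <= Cmod h ^ 2)%R by nra.
    nra.
Qed.

(** * Quadratic estimates on a disc and near a point *)

Lemma Cmod_diag z r : (0 < r)%R -> (Cmod (z - z) < r)%R.
Proof. intros. replace (z - z) with (RtoC 0) by ring. now rewrite Cmod_0. Qed.

(* [f] has derivative [f'] on the disc with a quadratic error term; since the
   estimate is symmetric in [w] and [w'] it makes [f'] Lipschitz, and it is
   stable under series without any further uniformity argument. *)
Definition quad_diff (p : C) (r : R) (f f' : C -> C) (K : R) : Prop :=
  forall w w', (Cmod (w - p) < r)%R -> (Cmod (w' - p) < r)%R ->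
  (Cmod (f w' - f w - f' w * (w' - w)) <= K * Cmod (w' - w) ^ 2)%R.

Lemma quad_diff_K_pos p r f f' K :
  (0 < r)%R -> quad_diff p r f f' K -> (0 <= K)%R.
Proof.
  intros Hr H.
  assert (Ha : (Cmod (RtoC (r / 2)) = r / 2)%R) by (rewrite Cmod_R, Rabs_pos_eq; lra).
  specialize (H p (p + RtoC (r / 2))).
  replace (p - p) with (RtoC 0) in H by ring.
  replace (p + RtoC (r / 2) - p) with (RtoC (r / 2)) in H by ring.
  rewrite Cmod_0, Ha in H. specialize (H Hr ltac:(lra)).
  match type of H with (?u <= _)%R => assert (0 <= u)%R by apply Cmod_ge_0 end.
  assert (0 < (r / 2) ^ 2)%R by (apply pow_lt; lra).
  destruct (Rle_dec 0 K); [assumption|nra].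
Qed.

Lemma quad_diff_sub p r f f' K q s :
  quad_diff p r f f' K -> (Cmod (q - p) + s <= r)%R -> quad_diff q s f f' K.
Proof.
  intros H Hs w w' Hw Hw'. apply H.
  - replace (w - p) with ((w - q) + (q - p)) by ring.
    eapply Rle_lt_trans; [apply Cmod_triangle|lra].
  - replace (w' - p) with ((w' - q) + (q - p)) by ring.
    eapply Rle_lt_trans; [apply Cmod_triangle|lra].
Qed.

Lemma quad_diff_ext p r f f' g g' K :
  (forall w, (Cmod (w - p) < r)%R -> f w = g w) ->
  (forall w, (Cmod (w - p) < r)%R -> f' w = g' w) ->
  quad_diff p r f f' K -> quad_diff p r g g' K.
Proof. intros E E' H w w' Hw Hw'. rewrite <- !E, <- E' by assumption. now apply H. Qed.

Lemma quad_diff_plus p r f f' g g' K L :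
  quad_diff p r f f' K -> quad_diff p r g g' L ->
  quad_diff p r (fun w => f w + g w) (fun w => f' w + g' w) (K + L).
Proof.
  intros Hf Hg w w' Hw Hw'.
  replace (f w' + g w' - (f w + g w) - (f' w + g' w) * (w' - w)) with
    ((f w' - f w - f' w * (w' - w)) + (g w' - g w - g' w * (w' - w))) by ring.
  eapply Rle_trans; [apply Cmod_triangle|]. rewrite Rmult_plus_distr_r.
  apply Rplus_le_compat; auto.
Qed.

Lemma quad_diff_scal p r f f' K c :
  quad_diff p r f f' K -> quad_diff p r (fun w => c * f w) (fun w => c * f' w) (Cmod c * K).
Proof.
  intros Hf w w' Hw Hw'.
  replace (c * f w' - c * f w - c * f' w * (w' - w)) with
    (c * (f w' - f w - f' w * (w' - w))) by ring.
  rewrite Cmod_mult, Rmult_assoc. apply Rmult_le_compat_l; [apply Cmod_ge_0|auto].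
Qed.

Lemma quad_diff_affine p r a b : quad_diff p r (fun w => a * w + b) (fun _ => a) 0.
Proof.
  intros w w' _ _. replace (_ - _ - _) with (RtoC 0) by ring. rewrite Cmod_0. lra.
Qed.

Lemma quad_diff_const p r b : quad_diff p r (fun _ => b) (fun _ => 0) 0.
Proof.
  intros w w' _ _. replace (_ - _ - _) with (RtoC 0) by ring. rewrite Cmod_0. lra.
Qed.

Lemma quad_diff_series p r (f f' : nat -> C -> C) S S' K s :
  (forall n, quad_diff p r (f n) (f' n) (K n)) ->
  (forall w, (Cmod (w - p) < r)%R -> is_csum (fun n => f n w) (S w)) ->
  (forall w, (Cmod (w - p) < r)%R -> is_csum (fun n => f' n w) (S' w)) ->
  is_series K s -> quad_diff p r S S' s.
Proof.
  intros H HS HS' HK w w' Hw Hw'.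
  apply csum_le with (a := fun n => f n w' - f n w - f' n w * (w' - w))
    (b := fun n => (K n * Cmod (w' - w) ^ 2)%R).
  - apply csum_minus; [apply csum_minus; auto|].
    rewrite Cmult_comm. eapply csum_ext; [|apply csum_scal, HS'; exact Hw].
    intros n; simpl; ring.
  - rewrite Rmult_comm.
    eapply is_series_ext; [|apply (@is_series_scal R_AbsRing R_NormedModule (Cmod (w' - w) ^ 2)%R), HK].
    intros n; unfold scal; simpl; unfold mult; simpl; ring.
  - intros n. now apply H.
Qed.

(** Adding the estimates at [(w, w')] and [(w', w)] cancels the values of [f] and leaves the
    increment of [f'] times [w' - w]. *)
Lemma quad_diff_lip p r f f' K w w' :
  quad_diff p r f f' K -> (Cmod (w - p) < r)%R -> (Cmod (w' - p) < r)%R ->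
  (Cmod (f' w' - f' w) <= 2 * K * Cmod (w' - w))%R.
Proof.
  intros H Hw Hw'. pose proof (H w w' Hw Hw') as H1. pose proof (H w' w Hw' Hw) as H2.
  assert (E : (Cmod ((f' w' - f' w) * (w' - w)) <= 2 * K * Cmod (w' - w) ^ 2)%R).
  { replace ((f' w' - f' w) * (w' - w)) with
      ((f w' - f w - f' w * (w' - w)) + (f w - f w' - f' w' * (w - w'))) by ring.
    eapply Rle_trans; [apply Cmod_triangle|].
    replace (Cmod (w - w')) with (Cmod (w' - w)) in H2
      by (rewrite <- Cmod_opp; f_equal; ring). lra. }
  rewrite Cmod_mult in E. destruct (Req_dec (Cmod (w' - w)) 0) as [E0|E0].
  - apply Cmod_eq_0 in E0. replace w' with w.
    + replace (f' w - f' w) with (RtoC 0) by ring. replace (w - w) with (RtoC 0) by ring.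
      rewrite Cmod_0. lra.
    + replace w' with ((w' - w) + w) by ring. rewrite E0. ring.
  - apply Rmult_le_reg_r with (Cmod (w' - w)).
    + pose proof (Cmod_ge_0 (w' - w)); lra.
    + eapply Rle_trans; [exact E|right; ring].
Qed.

Lemma quad_diff_bounded p r f f' K :
  (0 < r)%R -> quad_diff p r f f' K ->
  exists B, (0 <= B)%R /\ forall w, (Cmod (w - p) < r)%R ->
    (Cmod (f w) <= B)%R /\ (Cmod (f' w) <= B)%R.
Proof.
  intros Hr H. pose proof (quad_diff_K_pos _ _ _ _ _ Hr H) as HK.
  pose proof (Cmod_ge_0 (f p)). pose proof (Cmod_ge_0 (f' p)).
  assert (Hp : (Cmod (p - p) < r)%R) by (apply Cmod_diag; lra).
  exists (Cmod (f p) + Cmod (f' p) * r + K * r ^ 2 + Cmod (f' p) + 2 * K * r)%R.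
  assert (0 <= Cmod (f' p) * r)%R by (apply Rmult_le_pos; lra).
  assert (0 <= K * r ^ 2)%R by (apply Rmult_le_pos; [lra|apply pow2_ge_0]).
  assert (0 <= K * r)%R by (apply Rmult_le_pos; lra).
  split; [lra|]. intros w Hw. pose proof (Cmod_ge_0 (w - p)). split.
  - replace (f w) with ((f w - f p - f' p * (w - p)) + (f p + f' p * (w - p))) by ring.
    eapply Rle_trans; [apply Cmod_triangle|].
    pose proof (H p w Hp Hw) as Q3.
    pose proof (Cmod_triangle (f p) (f' p * (w - p))) as Q2. rewrite Cmod_mult in Q2.
    assert (Cmod (w - p) ^ 2 <= r ^ 2)%R by (apply pow_incr; lra).
    assert (K * Cmod (w - p) ^ 2 <= K * r ^ 2)%R by (apply Rmult_le_compat_l; lra).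
    assert (Cmod (f' p) * Cmod (w - p) <= Cmod (f' p) * r)%R by (apply Rmult_le_compat_l; lra).
    lra.
  - pose proof (quad_diff_lip _ _ _ _ _ _ _ H Hp Hw) as Q1.
    assert (2 * K * Cmod (w - p) <= 2 * K * r)%R by (apply Rmult_le_compat_l; lra).
    replace (f' w) with ((f' w - f' p) + f' p) by ring.
    eapply Rle_trans; [apply Cmod_triangle|]. lra.
Qed.

Lemma quad_little_o (K eps : R) : (0 < eps)%R ->
  exists d, (0 < d)%R /\ forall h, (0 <= h < d)%R -> (K * h ^ 2 <= eps * h)%R.
Proof.
  intros He. pose proof (Rabs_pos K). pose proof (Rle_abs K).
  exists (eps / (Rabs K + 1))%R. split; [apply Rdiv_lt_0_compat; lra|].
  intros h [Ph Hh]. apply Rlt_div_r in Hh; [|lra].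
  replace (K * h ^ 2)%R with (K * h * h)%R by ring. apply Rmult_le_compat_r; [exact Ph|]. nra.
Qed.

Lemma quad_diff_is_derive p r f f' K w :
  quad_diff p r f f' K -> (Cmod (w - p) < r)%R -> is_derive f w (f' w).
Proof.
  intros H Hw. split.
  - apply (is_linear_scal_l (K := C_AbsRing) (V := C_NormedModule) (f' w)).
  - intros x Hx. apply (is_filter_lim_locally_unique (V := AbsRing_NormedModule C_AbsRing)) in Hx. subst x.
    intros eps. destruct (quad_little_o K eps (cond_pos eps)) as [d [Pd Hd]].
    assert (Hr : (0 < Rmin (r - Cmod (w - p)) d)%R) by (apply Rmin_pos; lra).
    exists (mkposreal _ Hr). intros y Hy.
    change (Cmod (y - w) < Rmin (r - Cmod (w - p)) d)%R in Hy.
    pose proof (Rmin_l (r - Cmod (w - p)) d). pose proof (Rmin_r (r - Cmod (w - p)) d).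
    change (Cmod (f y - f w - (y - w) * f' w) <= eps * Cmod (y - w))%R.
    rewrite (Cmult_comm (y - w)). eapply Rle_trans; [apply H; [exact Hw|]|].
    + replace (y - p) with ((y - w) + (w - p)) by ring.
      eapply Rle_lt_trans; [apply Cmod_triangle|lra].
    + apply Hd. split; [apply Cmod_ge_0|lra].
Qed.
Lemma quad_diff_shrink p r s f f' K :
  quad_diff p r f f' K -> (s <= r)%R -> quad_diff p s f f' K.
Proof.
  intros H Hs w w' Hw Hw'. apply H; lra.
Qed.

Definition loc_quad (f f' : C -> C) (p : C) : Prop :=
  exists r K, (0 < r)%R /\ quad_diff p r f f' K.

Lemma loc_quad_plus f f' g g' p : loc_quad f f' p -> loc_quad g g' p ->
  loc_quad (fun w => f w + g w) (fun w => f' w + g' w) p.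
Proof.
  intros [r [K [Hr H]]] [s [L [Hs H']]].
  exists (Rmin r s), (K + L)%R. split; [now apply Rmin_pos|].
  apply quad_diff_plus; eapply quad_diff_shrink; eauto; [apply Rmin_l|apply Rmin_r].
Qed.

Lemma loc_quad_scal c f f' p : loc_quad f f' p ->
  loc_quad (fun w => c * f w) (fun w => c * f' w) p.
Proof.
  intros [r [K [Hr H]]]. exists r, (Cmod c * K)%R. split; [exact Hr|].
  apply quad_diff_scal, H.
Qed.

Lemma loc_quad_ext f f' g g' p : (forall w, f w = g w) -> (forall w, f' w = g' w) ->
  loc_quad f f' p -> loc_quad g g' p.
Proof.
  intros E E' [r [K [Hr H]]]. exists r, K. split; [exact Hr|].
  eapply quad_diff_ext; [| |exact H]; auto.
Qed.

Lemma loc_quad_const b p : loc_quad (fun _ => b) (fun _ => 0) p.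
Proof. exists 1%R, 0%R. split; [lra|apply quad_diff_const]. Qed.

Lemma loc_quad_reflect t f f' p : loc_quad f f' (t - p) ->
  loc_quad (fun w => f (t - w)) (fun w => - f' (t - w)) p.
Proof.
  intros [r [K [Hr H]]]. exists r, K. split; [exact Hr|]. intros w w' Hw Hw'.
  assert (F : forall v, t - v - (t - p) = - (v - p)) by (intros; ring).
  specialize (H (t - w) (t - w')). rewrite !F, !Cmod_opp in H. specialize (H Hw Hw').
  replace (t - w' - (t - w)) with (- (w' - w)) in H by ring. rewrite Cmod_opp in H.
  eapply Rle_trans; [|exact H]. right. f_equal. ring.
Qed.

(** Holomorphy near [p], in the quantitative form that the series arguments provide. *)
Definition loc_diff (f : C -> C) (p : C) : Prop := exists f', loc_quad f f' p.

Lemma loc_diff_plus f g p : loc_diff f p -> loc_diff g p -> loc_diff (fun w => f w + g w) p.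
Proof. intros [f' H] [g' H']. eexists. apply (loc_quad_plus _ _ _ _ _ H H'). Qed.

Lemma loc_diff_scal c f p : loc_diff f p -> loc_diff (fun w => c * f w) p.
Proof. intros [f' H]. eexists. apply (loc_quad_scal _ _ _ _ H). Qed.

Lemma loc_diff_const c p : loc_diff (fun _ => c) p.
Proof. eexists. apply loc_quad_const. Qed.

Lemma loc_diff_ext f g p : (forall w, f w = g w) -> loc_diff f p -> loc_diff g p.
Proof. intros E [f' H]. exists f'. now apply (loc_quad_ext f f'). Qed.

Lemma loc_diff_reflect t f p : loc_diff f (t - p) -> loc_diff (fun w => f (t - w)) p.
Proof. intros [f' H]. eexists. apply loc_quad_reflect, H. Qed.

(** * The identity theorem *)

Definition eith (t : R) : C := cexp (Ci * RtoC t).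

Lemma Cmod_eith t : Cmod (eith t) = 1%R.
Proof.
  unfold eith. rewrite Cmod_cexp. replace (Re (Ci * RtoC t)) with 0%R by (unfold Re, Im; simpl; ring).
  apply exp_0.
Qed.

Lemma eith_add s t : eith (s + t) = eith s * eith t.
Proof. unfold eith. rewrite <- cexp_add. f_equal. rewrite RtoC_plus. ring. Qed.

Lemma eith_2PI : eith (2 * PI) = eith 0.
Proof.
  unfold eith, cexp, Cmult, Ci, RtoC, Re, Im, fst, snd.
  replace (0 * 0 + 1 * (2 * PI))%R with (2 * PI)%R by ring.
  replace (0 * 0 + 1 * 0)%R with 0%R by ring.
  replace (0 * (2 * PI) - 1 * 0)%R with 0%R by ring.
  replace (0 * 0 - 1 * 0)%R with 0%R by ring.
  now rewrite cos_2PI, sin_2PI, cos_0, sin_0.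
Qed.

Lemma eith_lip s t : (Cmod (eith t - eith s) <= Rabs (t - s))%R.
Proof.
  replace t with (s + (t - s))%R at 1 by ring. set (h := (t - s)%R).
  rewrite eith_add. replace (eith s * eith h - eith s) with (eith s * (eith h - 1)) by ring.
  rewrite Cmod_mult, Cmod_eith, Rmult_1_l.
  apply Rsqr_incr_0_var; [|apply Rabs_pos]. rewrite <- Rsqr_abs.
  unfold Rsqr. replace (Cmod (eith h - 1) * Cmod (eith h - 1))%R with (Cmod (eith h - 1) ^ 2)%R by ring.
  rewrite Cmod2_alt. unfold eith, cexp, Cmult, Cminus, Cplus, Copp, Ci, RtoC, Re, Im, fst, snd.
  replace (0 * h - 1 * 0)%R with 0%R by ring.
  replace (0 * 0 + 1 * h)%R with h by ring. rewrite exp_0.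
  pose proof (sin2_cos2 h) as H1. pose proof (cos_quad h). unfold Rsqr in H1. nra.
Qed.

Lemma eith_quad s t :
  (Cmod (eith t - eith s - Ci * eith s * RtoC (t - s)) <= 4 * Rabs (t - s) ^ 2)%R.
Proof.
  replace t with (s + (t - s))%R at 1 by ring. set (h := (t - s)%R).
  rewrite eith_add.
  replace (eith s * eith h - eith s - Ci * eith s * RtoC h) with
    (eith s * (cexp (Ci * RtoC h) - 1 - Ci * RtoC h)) by (unfold eith; ring).
  rewrite Cmod_mult, Cmod_eith, Rmult_1_l.
  eapply Rle_trans; [apply cexp_quad|].
  replace (Re (Ci * RtoC h)) with 0%R by (unfold Re, Im; simpl; ring).
  rewrite exp_0, Rmax_left, Cmod_mult, Cmod_Ci, Cmod_R by lra. right; ring.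
Qed.

(** A class of integrands that is closed under sums, products and inverses bounded away from 0 with
    explicit constants; the Lipschitz bound gives the continuity that integrability requires. *)
Definition tame (g : R -> C) : Prop :=
  exists B, (forall x, (Cmod (g x) <= B)%R) /\
    forall x y, (Cmod (g y - g x) <= B * Rabs (y - x))%R.

Lemma tame_const c : tame (fun _ => c).
Proof.
  exists (Cmod c). split; [intros; lra|]. intros x y.
  replace (c - c) with (RtoC 0) by ring. rewrite Cmod_0.
  apply Rmult_le_pos; [apply Cmod_ge_0|apply Rabs_pos].
Qed.

Lemma tame_eith : tame eith.
Proof.
  exists 1%R. split; [intros; rewrite Cmod_eith; lra|].
  intros x y. rewrite Rmult_1_l. apply eith_lip.
Qed.

Lemma tame_mult f g : tame f -> tame g -> tame (fun x => f x * g x).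
Proof.
  intros [A [HA1 HA2]] [B [HB1 HB2]].
  assert (PA : (0 <= A)%R) by (eapply Rle_trans; [apply Cmod_ge_0|apply (HA1 0%R)]).
  assert (PB : (0 <= B)%R) by (eapply Rle_trans; [apply Cmod_ge_0|apply (HB1 0%R)]).
  exists (A * B + A * B)%R. split; intros x; [|intros y].
  - rewrite Cmod_mult.
    assert (Cmod (f x) * Cmod (g x) <= A * B)%R by (apply Rmult_le_compat; auto using Cmod_ge_0).
    assert (0 <= A * B)%R by (now apply Rmult_le_pos). lra.
  - replace (f y * g y - f x * g x) with (f y * (g y - g x) + (f y - f x) * g x) by ring.
    eapply Rle_trans; [apply Cmod_triangle|]. rewrite !Cmod_mult, Rmult_plus_distr_r.
    apply Rplus_le_compat.
    + rewrite Rmult_assoc. apply Rmult_le_compat; auto using Cmod_ge_0.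
    + replace (A * B * Rabs (y - x))%R with ((A * Rabs (y - x)) * B)%R by ring.
      apply Rmult_le_compat; auto using Cmod_ge_0.
Qed.

Lemma tame_plus f g : tame f -> tame g -> tame (fun x => f x + g x).
Proof.
  intros [A [HA1 HA2]] [B [HB1 HB2]].
  exists (A + B)%R. split; intros x; [|intros y].
  - eapply Rle_trans; [apply Cmod_triangle|]. apply Rplus_le_compat; auto.
  - replace (f y + g y - (f x + g x)) with ((f y - f x) + (g y - g x)) by ring.
    eapply Rle_trans; [apply Cmod_triangle|]. rewrite Rmult_plus_distr_r.
    apply Rplus_le_compat; auto.
Qed.

Lemma tame_inv f d :
  (0 < d)%R -> (forall x, (d <= Cmod (f x))%R) -> tame f -> tame (fun x => / f x).
Proof.
  intros Hd Hf [A [HA1 HA2]].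
  assert (PA : (0 <= A)%R) by (eapply Rle_trans; [apply Cmod_ge_0|apply (HA1 0%R)]).
  assert (N : forall x, f x <> 0).
  { intros x E. specialize (Hf x). rewrite E, Cmod_0 in Hf. lra. }
  assert (I : forall x, (Cmod (/ f x) <= / d)%R).
  { intros x. rewrite Cmod_inv by auto. apply Rinv_le_contravar; auto. }
  assert (Pd : (0 < / d)%R) by (now apply Rinv_0_lt_compat).
  exists (/ d + A * / d * / d)%R.
  assert (0 <= A * / d * / d)%R by (apply Rmult_le_pos; [apply Rmult_le_pos|]; lra).
  split; intros x; [|intros y].
  - specialize (I x). lra.
  - replace (/ f y - / f x) with ((f y - f x) * (/ f x) * - (/ f y)) by (field; auto).
    rewrite !Cmod_mult, Cmod_opp.
    apply Rle_trans with (A * Rabs (y - x) * / d * / d)%R.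
    + apply Rmult_le_compat; auto using Cmod_ge_0.
      * apply Rmult_le_pos; auto using Cmod_ge_0.
      * apply Rmult_le_compat; auto using Cmod_ge_0.
    + pose proof (Rabs_pos (y - x)). nra.
Qed.

Lemma lip_continuous (g : R -> R) B x :
  (forall y, (Rabs (g y - g x) <= B * Rabs (y - x))%R) -> continuous g x.
Proof.
  intros H. apply continuity_pt_filterlim. intros eps He.
  assert (HB : (0 < Rabs B + 1)%R) by (pose proof (Rabs_pos B); lra).
  exists (eps / (Rabs B + 1))%R. split; [now apply Rdiv_lt_0_compat|].
  intros y [_ Hy]. simpl in *. unfold R_dist in *.
  eapply Rle_lt_trans; [apply H|].
  pose proof (Rle_abs B). pose proof (Rabs_pos (y - x)).
  apply Rle_lt_trans with ((Rabs B + 1) * Rabs (y - x))%R; [nra|].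
  apply Rmult_lt_reg_r with (/ (Rabs B + 1))%R; [now apply Rinv_0_lt_compat|].
  replace ((Rabs B + 1) * Rabs (y - x) * / (Rabs B + 1))%R with (Rabs (y - x)) by (field; lra).
  exact Hy.
Qed.

Lemma tame_continuous g x : tame g -> continuous (fun t => Re (g t)) x.
Proof.
  intros [B [_ H]]. apply lip_continuous with B. intros y.
  eapply Rle_trans; [|apply H]. eapply Rle_trans; [|apply re_le_Cmod].
  right. reflexivity.
Qed.

Lemma tame_RInt g a b : tame g -> is_RInt (fun t => Re (g t)) a b (RInt (fun t => Re (g t)) a b).
Proof.
  intros H. apply (RInt_correct (V := R_CompleteNormedModule)).
  apply (ex_RInt_continuous (V := R_CompleteNormedModule)). intros z _.
  now apply tame_continuous.
Qed.

Lemma is_derive_quad (g : R -> R) x l K :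
  (forall y, (Rabs (g y - g x - l * (y - x)) <= K * Rabs (y - x) ^ 2)%R) -> is_derive g x l.
Proof.
  intros H. split; [apply (is_linear_scal_l (K := R_AbsRing) (V := R_NormedModule) l)|].
  intros x' Hx. apply (is_filter_lim_locally_unique (V := AbsRing_NormedModule R_AbsRing)) in Hx. subst x'.
  intros eps. destruct (quad_little_o K eps (cond_pos eps)) as [d [Pd Hd]].
  exists (mkposreal d Pd). intros y Hy. change (Rabs (y - x) < d)%R in Hy.
  change (Rabs (g y - g x - (y - x) * l) <= eps * Rabs (y - x))%R.
  rewrite (Rmult_comm (y - x) l). eapply Rle_trans; [apply H|].
  apply Hd. split; [apply Rabs_pos|exact Hy].
Qed.

(** Cutting [[0, 1]] into [N] steps, the increments add up to at most [A / N]. The base point [s]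
    has to be positive because the application divides by it; the telescoping therefore goes from
    [(k + 1) / N] back to [k / N], and 0 is reached only as an end point. *)
Lemma quad_const (g : R -> R) A :
  (0 <= A)%R ->
  (forall s s', (0 < s <= 1)%R -> (0 <= s' <= 1)%R -> (Rabs (g s' - g s) <= A * Rabs (s' - s) ^ 2)%R) ->
  g 1%R = g 0%R.
Proof.
  intros PA H.
  assert (St : forall N k : nat, (0 < N)%nat -> (k <= N)%nat ->
    (Rabs (g (INR k / INR N) - g 0%R) <= INR k * (A * / INR N ^ 2))%R).
  { intros N k HN. assert (PN : (0 < INR N)%R) by (now apply lt_0_INR).
    induction k as [|k IH]; intros Hk.
    - simpl INR. replace (0 / INR N)%R with 0%R by (field; lra).
      rewrite Rminus_diag, Rabs_R0, Rmult_0_l. lra.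
    - assert (Hk' : (INR (S k) <= INR N)%R) by (now apply le_INR).
      rewrite S_INR in *. pose proof (pos_INR k).
      assert (B1 : (0 < (INR k + 1) / INR N <= 1)%R).
      { split; [apply Rdiv_lt_0_compat; lra|]. apply Rle_div_l; lra. }
      assert (B0 : (0 <= INR k / INR N <= 1)%R).
      { split; [apply Rle_div_r; lra|]. apply Rle_div_l; lra. }
      pose proof (H _ _ B1 B0) as H1. specialize (IH ltac:(lia)).
      replace (INR k / INR N - (INR k + 1) / INR N)%R with (- / INR N)%R in H1 by (field; lra).
      rewrite Rabs_Ropp, (Rabs_pos_eq (/ INR N)) in H1 by (left; now apply Rinv_0_lt_compat).
      rewrite Rabs_minus_sym, pow_inv in H1.
      replace (g ((INR k + 1) / INR N)%R - g 0%R)%R with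
        ((g ((INR k + 1) / INR N)%R - g (INR k / INR N)%R) + (g (INR k / INR N)%R - g 0%R))%R by ring.
      eapply Rle_trans; [apply Rabs_triang|]. lra. }
  assert (L : (Rabs (g 1%R - g 0%R) <= 0)%R).
  { eapply is_lim_seq_le with (u := fun _ => Rabs (g 1%R - g 0%R)) (v := fun n => (A * / INR (S n))%R)
      (l1 := Finite _) (l2 := Finite _).
    - intros n. specialize (St (S n) (S n) ltac:(lia) ltac:(lia)).
      assert (PN : (0 < INR (S n))%R) by (apply lt_0_INR; lia).
      replace (INR (S n) / INR (S n))%R with 1%R in St by (field; lra).
      eapply Rle_trans; [exact St|]. right; field; lra.
    - apply is_lim_seq_const.
    - replace (Finite 0) with (Rbar_mult (Finite A) (Finite 0%R)) by (simpl; f_equal; ring).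
      apply is_lim_seq_scal_l.
      apply (is_lim_seq_incr_1 (fun n => / INR n)%R).
      replace (Finite 0) with (Rbar_inv p_infty) by reflexivity.
      apply is_lim_seq_inv; [apply is_lim_seq_INR|discriminate]. }
  pose proof (Rabs_pos (g 1%R - g 0%R)) as L0.
  destruct (Req_dec (g 1%R - g 0%R) 0) as [E|E]; [lra|].
  apply Rabs_pos_lt in E. lra.
Qed.

(** The map [1 / (1 - v)] sends the unit disc onto the half plane [Re > 1/2]. This lower bound for
    the Cauchy kernel replaces the evaluation of its integral and accounts for the factor 2 in
    [cauchy_bound]. *)
Lemma Re_inv_ge_half (v : C) : (Cmod v < 1)%R -> (/ 2 <= Re (/ (1 - v)))%R.
Proof.
  intros Hv. assert (H2 : (Cmod v ^ 2 <= 1)%R) by (pose proof (Cmod_ge_0 v); nra).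
  assert (Hx : (Re v < 1)%R) by (pose proof (re_le v); lra).
  rewrite Cmod2_alt in H2. destruct v as [x y]. simpl in *.
  set (d := ((1 + - x) * ((1 + - x) * 1) + (0 + - y) * ((0 + - y) * 1))%R).
  assert (Hd : (0 < d)%R) by (unfold d; nra).
  apply Rmult_le_reg_r with d; [exact Hd|].
  replace ((1 + - x) / d * d)%R with (1 + - x)%R by (field; lra). unfold d. nra.
Qed.

(* The curve [w + s (c + r e^(it) - w)] shrinks the circle to [w]; the Cauchy
   integral along it does not depend on [s]. *)
Lemma cauchy_bound c w r Rd K f f' M :
  quad_diff c Rd f f' K -> (Cmod (w - c) < r)%R -> (r < Rd)%R ->
  (forall x, Cmod (x - c) = r -> (Cmod (f x) <= M)%R) ->
  (Cmod (f w) <= 2 * M * (r / (r - Cmod (w - c))))%R.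
Proof.
  intros Hf Hw Hr HM. pose proof (Cmod_ge_0 (w - c)) as Pw.
  assert (PR : (0 < Rd)%R) by lra.
  pose proof (quad_diff_K_pos _ _ _ _ _ PR Hf) as PK.
  destruct (quad_diff_bounded _ _ _ _ _ PR Hf) as [B [PB HB]].
  set (D := fun t => (c - w) + RtoC r * eith t).
  set (P := fun s t => w + RtoC s * D t).
  assert (Cr : forall t, Cmod (RtoC r * eith t) = r).
  { intros t. rewrite Cmod_mult, Cmod_eith, Cmod_R, Rabs_pos_eq; lra. }
  assert (Wc : Cmod (c - w) = Cmod (w - c)) by (rewrite <- Cmod_opp; f_equal; ring).
  set (d := (r - Cmod (w - c))%R). assert (Pd : (0 < d)%R) by (unfold d; lra).
  assert (Dlow : forall t, (d <= Cmod (D t))%R).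
  { intros t. unfold D, d. pose proof (Cmod_triangle (c - w + RtoC r * eith t) (- (c - w))) as H.
    replace (c - w + RtoC r * eith t + - (c - w)) with (RtoC r * eith t) in H by ring.
    rewrite Cr, Cmod_opp, Wc in H. lra. }
  assert (Dup : forall t, (Cmod (D t) <= 2 * r)%R).
  { intros t. unfold D. eapply Rle_trans; [apply Cmod_triangle|]. rewrite Cr, Wc. lra. }
  assert (D0 : forall t, D t <> 0).
  { intros t E. specialize (Dlow t). rewrite E, Cmod_0 in Dlow. lra. }
  assert (Pin : forall s t, (0 <= s <= 1)%R -> (Cmod (P s t - c) < Rd)%R).
  { intros s t Hs. unfold P, D.
    replace (w + RtoC s * (c - w + RtoC r * eith t) - c) with
      ((1 - RtoC s) * (w - c) + RtoC s * (RtoC r * eith t)) by ring.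
    eapply Rle_lt_trans; [apply Cmod_triangle|].
    rewrite Cmod_mult, (Cmod_mult (RtoC s)), Cr, <- RtoC_minus, !Cmod_R, !Rabs_pos_eq by lra.
    nra. }
  assert (TD : tame D).
  { apply tame_plus; [apply tame_const|]. apply tame_mult; [apply tame_const|apply tame_eith]. }
  (* The Cauchy kernel along the curve, up to the factor [i]: both [P s t - w] and the velocity of
     [P s] are proportional to [s], so their quotient is the same for all [s]. *)
  set (k := fun t => RtoC r * eith t * / D t).
  assert (Tk : tame k).
  { apply tame_mult; [apply tame_mult; [apply tame_const|apply tame_eith]|].
    apply tame_inv with d; auto. }
  assert (Plip : forall s t t', (0 <= s <= 1)%R -> (Cmod (P s t' - P s t) <= r * Rabs (t' - t))%R).
  { intros s t t' Hs. unfold P, D.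
    replace (w + RtoC s * (c - w + RtoC r * eith t') - (w + RtoC s * (c - w + RtoC r * eith t)))
      with (RtoC s * RtoC r * (eith t' - eith t)) by ring.
    rewrite !Cmod_mult, !Cmod_R, !Rabs_pos_eq by lra.
    pose proof (eith_lip t t'). pose proof (Cmod_ge_0 (eith t' - eith t)).
    assert (s * r <= r)%R by nra. assert (0 <= s * r)%R by nra. nra. }
  assert (Tf' : forall s, (0 <= s <= 1)%R -> tame (fun t => f' (P s t))).
  { intros s Hs. exists (B + 2 * K * r)%R.
    assert (0 <= 2 * K * r)%R by (apply Rmult_le_pos; lra).
    split; intros t; [|intros t'].
    - destruct (HB _ (Pin s t Hs)). lra.
    - eapply Rle_trans; [apply (quad_diff_lip _ _ _ _ _ _ _ Hf); auto|].
      pose proof (Plip s t t' Hs). pose proof (Rabs_pos (t' - t)).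
      apply Rle_trans with (2 * K * (r * Rabs (t' - t)))%R; [apply Rmult_le_compat_l; lra|]. nra. }
  assert (Tf : forall s, (0 <= s <= 1)%R -> tame (fun t => f (P s t))).
  { intros s Hs. exists (B + (B * r + K * (2 * Rd) * r))%R.
    assert (0 <= B * r)%R by (apply Rmult_le_pos; lra).
    assert (0 <= K * (2 * Rd) * r)%R by (apply Rmult_le_pos; [apply Rmult_le_pos|]; lra).
    split; intros t; [|intros t'].
    - destruct (HB _ (Pin s t Hs)). lra.
    - pose proof (Hf _ _ (Pin s t Hs) (Pin s t' Hs)) as H1.
      pose proof (Plip s t t' Hs) as H2. pose proof (Rabs_pos (t' - t)) as H3.
      set (h := P s t' - P s t) in *. pose proof (Cmod_ge_0 h) as H4.
      destruct (HB _ (Pin s t Hs)) as [_ H5].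
      assert (H6 : (Cmod h <= 2 * Rd)%R).
      { unfold h. replace (P s t' - P s t) with ((P s t' - c) + - (P s t - c)) by ring.
        eapply Rle_trans; [apply Cmod_triangle|]. rewrite Cmod_opp.
        pose proof (Pin s t Hs). pose proof (Pin s t' Hs). lra. }
      replace (f (P s t') - f (P s t)) with ((f (P s t') - f (P s t) - f' (P s t) * h) + f' (P s t) * h) by ring.
      eapply Rle_trans; [apply Cmod_triangle|]. rewrite Cmod_mult.
      assert (A1 : (Cmod (f' (P s t)) * Cmod h <= B * (r * Rabs (t' - t)))%R)
        by (apply Rmult_le_compat; auto using Cmod_ge_0).
      assert (A2 : (Cmod h ^ 2 <= 2 * Rd * (r * Rabs (t' - t)))%R).
      { simpl. rewrite Rmult_1_r. apply Rmult_le_compat; auto. }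
      assert (A3 : (K * Cmod h ^ 2 <= K * (2 * Rd * (r * Rabs (t' - t))))%R)
        by (apply Rmult_le_compat_l; auto).
      nra. }
  assert (TG : forall u s, (0 <= s <= 1)%R -> tame (fun t => u * f (P s t) * k t)).
  { intros u s Hs. apply tame_mult; [|exact Tk]. apply tame_mult; [apply tame_const|auto]. }
  assert (Hu : forall u, Cmod u = 1%R ->
    RInt (fun t => Re (u * f (P 1%R t) * k t)) 0 (2 * PI) =
    RInt (fun t => Re (u * f (P 0%R t) * k t)) 0 (2 * PI)).
  { intros u Eu.
    set (G := fun s => RInt (fun t => Re (u * f (P s t) * k t)) 0 (2 * PI)).
    change (G 1%R = G 0%R). apply quad_const with (2 * PI * (K * (2 * r) * r))%R.
    { pose proof PI_RGT_0. apply Rmult_le_pos; [lra|].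
      apply Rmult_le_pos; [apply Rmult_le_pos|]; lra. }
    intros s s' Hs Hs'.
    assert (Hs0 : (0 <= s <= 1)%R) by lra.
    assert (TJ : tame (fun t => u * f' (P s t) * (RtoC r * eith t))).
    { apply tame_mult; [apply tame_mult; [apply tame_const|auto]|].
      apply tame_mult; [apply tame_const|apply tame_eith]. }
    assert (Rs : RtoC s <> 0) by (intros E; injection E; lra).
    (* This integral is the formal derivative of [G] at [s]. It vanishes because its integrand has
       the primitive [- i u f (P s t) / s] on a closed curve; here [s] must be nonzero. *)
    assert (J : is_RInt (fun t => Re (u * f' (P s t) * (RtoC r * eith t))) 0 (2 * PI) 0%R).
    { set (g := fun t => Re (- Ci * u * f (P s t) / RtoC s)).
      assert (Eg : minus (g (2 * PI)%R) (g 0%R) = 0%R).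
      { unfold g, P, D. rewrite eith_2PI. apply Rplus_opp_r. }
      assert (Dg : forall t, is_derive g t (Re (u * f' (P s t) * (RtoC r * eith t)))).
      2:{ rewrite <- Eg at 2. apply (is_RInt_derive (V := R_CompleteNormedModule) g); intros x _; [apply Dg|].
          now apply tame_continuous. }
      intros t. apply is_derive_quad with (/ s * (K * r ^ 2 + B * s * r * 4))%R.
      intros t'. unfold g.
      set (q := f (P s t') - f (P s t) - f' (P s t) * (P s t' - P s t)).
      set (v := eith t' - eith t - Ci * eith t * RtoC (t' - t)).
      replace (Re (- Ci * u * f (P s t') / RtoC s) - Re (- Ci * u * f (P s t) / RtoC s) -
        Re (u * f' (P s t) * (RtoC r * eith t)) * (t' - t))%R with
        (Re (- Ci * u / RtoC s * (q + f' (P s t) * (RtoC s * RtoC r) * v))).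
      2:{ assert (E : forall a b c : C, (Re a - Re b - Re c * (t' - t))%R = Re (a - b - c * RtoC (t' - t))).
          { intros; unfold Re, Im; simpl; ring. }
          rewrite E. f_equal.
          transitivity (- Ci * u / RtoC s * (f (P s t') - f (P s t) - f' (P s t) * RtoC s * RtoC r * (Ci * eith t * RtoC (t' - t)))).
          { unfold q, v, P, D. field. exact Rs. }
          replace (u * f' (P s t) * (RtoC r * eith t) * RtoC (t' - t)) with
              (- (Ci * Ci) * (u * f' (P s t) * (RtoC r * eith t) * RtoC (t' - t))) by (replace (Ci * Ci) with (- RtoC 1) by (apply C_eq; unfold Re, Im; simpl; ring); ring).
          field. exact Rs. }
      eapply Rle_trans; [apply re_le_Cmod|].
      rewrite Cmod_mult, Cmod_div, Cmod_mult, Cmod_opp, Cmod_Ci, Eu, Cmod_R, (Rabs_pos_eq s) by (assumption || lra).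
      replace (1 * 1 / s)%R with (/ s)%R by (field; lra). rewrite Rmult_assoc.
      apply Rmult_le_compat_l; [left; apply Rinv_0_lt_compat; lra|].
      eapply Rle_trans; [apply Cmod_triangle|]. rewrite Rmult_plus_distr_r.
      apply Rplus_le_compat.
      - eapply Rle_trans; [apply (Hf _ _ (Pin s t Hs0) (Pin s t' Hs0))|].
        rewrite Rmult_assoc. apply Rmult_le_compat_l; [exact PK|].
        rewrite <- Rpow_mult_distr. apply pow_incr. split; [apply Cmod_ge_0|now apply Plip].
      - rewrite !Cmod_mult, !Cmod_R, !Rabs_pos_eq by lra.
        replace (B * s * r * 4 * Rabs (t' - t) ^ 2)%R with (B * (s * r) * (4 * Rabs (t' - t) ^ 2))%R by ring.
        apply Rmult_le_compat; [|apply Cmod_ge_0| |apply eith_quad].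
        + apply Rmult_le_pos; [apply Cmod_ge_0|nra].
        + apply Rmult_le_compat_r; [nra|]. apply (HB _ (Pin s t Hs0)). }
    (* Subtracting [s' - s] times the vanishing integral turns the increment of the integrand into
       the Taylor error of [f], which is quadratic in [s' - s]. *)
    pose proof (is_RInt_minus _ _ _ _ _ _
      (is_RInt_minus _ _ _ _ _ _ (tame_RInt _ 0 (2 * PI) (TG u s' Hs')) (tame_RInt _ 0 (2 * PI) (TG u s Hs0)))
      (is_RInt_scal _ _ _ (s' - s)%R _ J)) as HI.
    replace (G s' - G s)%R with (minus (minus (G s') (G s)) (scal (s' - s)%R 0%R)).
    2:{ unfold minus, plus, opp, scal; simpl; unfold mult; simpl. ring. }
    replace (2 * PI * (K * (2 * r) * r) * Rabs (s' - s) ^ 2)%R with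
      ((2 * PI - 0) * (K * (2 * r) * r * Rabs (s' - s) ^ 2))%R by ring.
    eapply (norm_RInt_le_const (V := R_NormedModule)); [pose proof PI_RGT_0; lra| |exact HI].
    intros t _.
    change (Rabs ((Re (u * f (P s' t) * k t) - Re (u * f (P s t) * k t)) -
      (s' - s) * Re (u * f' (P s t) * (RtoC r * eith t))) <= K * (2 * r) * r * Rabs (s' - s) ^ 2)%R.
    set (q := f (P s' t) - f (P s t) - f' (P s t) * (P s' t - P s t)).
    assert (Pd' : P s' t - P s t = RtoC (s' - s) * D t) by (unfold P; rewrite RtoC_minus; ring).
    replace (Re (u * f (P s' t) * k t) - Re (u * f (P s t) * k t) -
      (s' - s) * Re (u * f' (P s t) * (RtoC r * eith t)))%R with (Re (u * q * k t)).
    2:{ assert (E : forall a b c : C, (Re a - Re b - (s' - s) * Re c)%R = Re (a - b - RtoC (s' - s) * c)).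
        { intros; unfold Re, Im; simpl; ring. }
        rewrite E. f_equal. unfold q. rewrite Pd'. unfold k. field. apply D0. }
    eapply Rle_trans; [apply re_le_Cmod|]. rewrite !Cmod_mult, Eu, Rmult_1_l.
    assert (H1 : (Cmod q <= K * (Rabs (s' - s) * Cmod (D t)) ^ 2)%R).
    { eapply Rle_trans; [apply (Hf _ _ (Pin s t Hs0) (Pin s' t Hs'))|].
      rewrite Pd', Cmod_mult, Cmod_R. lra. }
    assert (H2 : (Cmod (D t) * Cmod (k t) = r)%R).
    { rewrite <- Cmod_mult. replace (D t * k t) with (RtoC r * eith t); [apply Cr|].
      unfold k. field. apply D0. }
    apply Rle_trans with (K * (Rabs (s' - s) * Cmod (D t)) ^ 2 * Cmod (k t))%R;
      [apply Rmult_le_compat_r; [apply Cmod_ge_0|exact H1]|].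
    replace (K * (Rabs (s' - s) * Cmod (D t)) ^ 2 * Cmod (k t))%R with
      (K * Rabs (s' - s) ^ 2 * Cmod (D t) * (Cmod (D t) * Cmod (k t)))%R by ring.
    rewrite H2. specialize (Dup t).
    assert (0 <= K * Rabs (s' - s) ^ 2)%R by (apply Rmult_le_pos; [exact PK|apply pow_le, Rabs_pos]).
    assert (K * Rabs (s' - s) ^ 2 * Cmod (D t) <= K * Rabs (s' - s) ^ 2 * (2 * r))%R by (apply Rmult_le_compat_l; auto).
    nra. }
  assert (Kb : forall t, (Cmod (k t) <= r / d)%R).
  { intros t. unfold k. rewrite Cmod_mult, Cr, Cmod_inv by auto.
    apply Rmult_le_compat_l; [lra|]. apply Rinv_le_contravar; auto. }
  assert (Kh : forall t, (/ 2 <= Re (k t))%R).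
  { intros t. assert (Ne : eith t <> 0) by apply cexp_neq_0.
    assert (Nr : RtoC r <> 0) by (intros E; injection E; lra).
    replace (k t) with (/ (1 - (w - c) / (RtoC r * eith t))).
    - apply Re_inv_ge_half. rewrite Cmod_div, Cr.
      + apply Rlt_div_l; lra.
      + intros E. pose proof (Cr t) as E1. rewrite E, Cmod_0 in E1. lra.
    - unfold k, D. field. repeat split; auto.
      specialize (D0 t). unfold D in D0. intros E. apply D0. rewrite <- E. ring. }
  (* With this rotation the integrand at [s = 0] is [|f w|] times [k], so its integral is at least
     [|f w| * PI]; at [s = 1] the curve is the circle, where [M] bounds [f]. *)
  destruct (unimodular_phase (f w)) as [u [Eu Ew]]. specialize (Hu u Eu).
  assert (I0 : (Cmod (f w) * / 2 * (2 * PI) <= RInt (fun t => Re (u * f (P 0%R t) * k t)) 0 (2 * PI))%R).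
  { pose proof (tame_RInt _ 0 (2 * PI) (TG u 0%R ltac:(lra))) as H1.
    pose proof (is_RInt_const (V := R_NormedModule) 0 (2 * PI) (Cmod (f w) * / 2)%R) as H2.
    replace (Cmod (f w) * / 2 * (2 * PI))%R with (scal (2 * PI - 0)%R (Cmod (f w) * / 2)%R)
      by (unfold scal; simpl; unfold mult; simpl; ring).
    refine (is_RInt_le _ _ _ _ _ _ _ H2 H1 _); [pose proof PI_RGT_0; lra|].
    intros t _. replace (P 0%R t) with w by (unfold P; ring). rewrite Ew.
    replace (Re (RtoC (Cmod (f w)) * k t)) with (Cmod (f w) * Re (k t))%R by (unfold Re, Im; simpl; ring).
    apply Rmult_le_compat_l; [apply Cmod_ge_0|apply Kh]. }
  assert (I1 : (RInt (fun t => Re (u * f (P 1%R t) * k t)) 0 (2 * PI) <= M * (r / d) * (2 * PI))%R).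
  { pose proof (tame_RInt _ 0 (2 * PI) (TG u 1%R ltac:(lra))) as H1.
    pose proof (is_RInt_const (V := R_NormedModule) 0 (2 * PI) (M * (r / d))%R) as H2.
    replace (M * (r / d) * (2 * PI))%R with (scal (2 * PI - 0)%R (M * (r / d))%R)
      by (unfold scal; simpl; unfold mult; simpl; ring).
    refine (is_RInt_le _ _ _ _ _ _ _ H1 H2 _); [pose proof PI_RGT_0; lra|].
    intros t _. eapply Rle_trans; [apply re_le|].
    rewrite !Cmod_mult, Eu, Rmult_1_l. apply Rmult_le_compat; auto using Cmod_ge_0.
    apply HM. replace (P 1%R t - c) with (RtoC r * eith t) by (unfold P, D; ring). apply Cr. }
  pose proof PI_RGT_0.
  apply Rmult_le_reg_r with PI; [assumption|]. fold d. lra.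
Qed.

(** Since [f] vanishes on a whole disc about [p], so does the quotient, and there is no singularity
    to remove: each point lies either where [f] and [f'] are 0 or at distance at least [e] from
    [p]. *)
Lemma quad_diff_div p r e f f' K :
  (0 < e <= r)%R -> quad_diff p r f f' K ->
  (forall w, (Cmod (w - p) < e)%R -> f w = 0) ->
  exists g' L, quad_diff p r (fun w => f w / (w - p)) g' L.
Proof.
  intros He Hf Z. assert (Hr : (0 < r)%R) by lra.
  pose proof (quad_diff_K_pos _ _ _ _ _ Hr Hf) as PK.
  destruct (quad_diff_bounded _ _ _ _ _ Hr Hf) as [B [PB HB]].
  assert (Z' : forall w, (Cmod (w - p) < e)%R -> f' w = 0).
  { intros w Hw.
    rewrite <- (is_C_derive_unique f w (f' w)) by (eapply quad_diff_is_derive; [exact Hf|lra]).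
    apply is_C_derive_unique.
    assert (H0 : quad_diff p e f (fun _ => 0) 0).
    { eapply quad_diff_ext; [| |apply (quad_diff_const p e 0)]; simpl; auto.
      intros; symmetry; auto. }
    apply (quad_diff_is_derive _ _ _ _ _ _ H0 Hw). }
  exists (fun w => f' w / (w - p) - f w / (w - p) ^ 2).
  (* The first three terms cover pairs with one point in the small disc; the first and the last two
     cover pairs with both points outside. *)
  exists (K / e + 2 * K / e + K * (2 * r) / e ^ 2 + B / e ^ 3 + B / e ^ 2)%R.
  assert (Ie : (0 < / e)%R) by (apply Rinv_0_lt_compat; lra).
  intros w w' Hw Hw'. set (h := w' - w). set (u := w - p). set (u' := w' - p).
  assert (Eh : h = u' - u) by (unfold h, u, u'; ring).
  assert (Hh : (Cmod h <= 2 * r)%R).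
  { rewrite Eh. eapply Rle_trans; [apply Cmod_triangle|]. rewrite Cmod_opp. unfold u, u'; lra. }
  pose proof (Hf w w' Hw Hw') as Q1. pose proof (Hf w' w Hw' Hw) as Q2. fold h in Q1.
  replace (w - w') with (- h) in Q2 by (unfold h; ring). rewrite Cmod_opp in Q2.
  pose proof (Cmod_ge_0 h) as Ph. pose proof (pow2_ge_0 (Cmod h)) as Ph2.
  assert (T1 : (0 <= K / e)%R) by (apply Rmult_le_pos; lra).
  assert (T2 : (0 <= K * (2 * r) / e ^ 2)%R).
  { apply Rmult_le_pos; [apply Rmult_le_pos; lra|]. rewrite <- pow_inv. apply pow_le; lra. }
  assert (T3 : (0 <= B / e ^ 3)%R).
  { apply Rmult_le_pos; [lra|]. rewrite <- pow_inv. apply pow_le; lra. }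
  assert (T4 : (0 <= B / e ^ 2)%R).
  { apply Rmult_le_pos; [lra|]. rewrite <- pow_inv. apply pow_le; lra. }
  assert (Inv : forall v, (e <= Cmod v)%R -> v <> 0 /\ (Cmod (/ v) <= / e)%R).
  { intros v Hv. assert (v <> 0) by (apply Cmod_gt_0; lra). split; [assumption|].
    rewrite Cmod_inv by assumption. apply Rinv_le_contravar; lra. }
  destruct (Rlt_dec (Cmod u) e) as [Hu|Hu]; destruct (Rlt_dec (Cmod u') e) as [Hu'|Hu'].
  - rewrite (Z w Hu), (Z w' Hu'), (Z' w Hu). unfold Cdiv.
    replace (0 * / u' - 0 * / u - (0 * / u - 0 * / u ^ 2) * h) with (RtoC 0) by ring.
    rewrite Cmod_0. apply Rmult_le_pos; [|assumption]. lra.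
  - destruct (Inv u' ltac:(lra)) as [N' I'].
    rewrite (Z w Hu), (Z' w Hu) in *. unfold Cdiv.
    replace (f w' * / u' - 0 * / u - (0 * / u - 0 * / u ^ 2) * h) with (f w' * / u') by ring.
    replace (f w' - 0 - 0 * h) with (f w') in Q1 by ring.
    rewrite Cmod_mult. apply Rle_trans with (K * Cmod h ^ 2 * / e)%R.
    + apply Rmult_le_compat; auto using Cmod_ge_0.
    + unfold Rdiv in *. nra.
  - destruct (Inv u ltac:(lra)) as [N I].
    pose proof (quad_diff_lip _ _ _ _ _ _ _ Hf Hw' Hw) as Q3.
    rewrite (Z w' Hu'), (Z' w' Hu') in *.
    replace (w - w') with (- h) in Q3 by (unfold h; ring). rewrite Cmod_opp in Q3.
    replace (f w - 0 - 0 * - h) with (f w) in Q2 by ring.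
    replace (f' w - 0) with (f' w) in Q3 by ring.
    replace (0 / u') with (RtoC 0) by (unfold Cdiv; ring).
    replace (0 - f w / u - (f' w / u - f w / u ^ 2) * h) with
      (- (f w * / u) + (- (f' w * h * / u) + f w * h * (/ u * / u))) by (unfold Cdiv; field; auto).
    eapply Rle_trans; [apply Cmod_triangle|].
    eapply Rle_trans; [apply Rplus_le_compat_l, Cmod_triangle|].
    rewrite !Cmod_opp, !Cmod_mult.
    set (a := Cmod (/ u)) in *. assert (Pa : (0 <= a)%R) by apply Cmod_ge_0.
    assert (A1 : (Cmod (f w) * a <= K * Cmod h ^ 2 * / e)%R) by (apply Rmult_le_compat; auto using Cmod_ge_0).
    assert (A2 : (Cmod (f' w) * Cmod h * a <= 2 * K * Cmod h * Cmod h * / e)%R).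
    { apply Rmult_le_compat; auto; [apply Rmult_le_pos; apply Cmod_ge_0|].
      apply Rmult_le_compat_r; auto. }
    assert (A3 : (Cmod (f w) * Cmod h * (a * a) <= K * Cmod h ^ 2 * (2 * r) * (/ e * / e))%R).
    { apply Rmult_le_compat; [apply Rmult_le_pos; apply Cmod_ge_0|now apply Rmult_le_pos| |].
      - apply Rmult_le_compat; auto using Cmod_ge_0.
      - apply Rmult_le_compat; auto. }
    replace (K * Cmod h ^ 2 * (2 * r) * (/ e * / e))%R with (K * (2 * r) / e ^ 2 * Cmod h ^ 2)%R in A3
      by (field; lra).
    unfold Rdiv in *. nra.
  - destruct (Inv u ltac:(lra)) as [N I]. destruct (Inv u' ltac:(lra)) as [N' I'].
    replace (f w' / u' - f w / u - (f' w / u - f w / u ^ 2) * h) with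
      ((f w' - f w - f' w * h) * / u' + (f w * (h * h) * (/ u * / u * / u') - f' w * (h * h) * (/ u * / u')))
      by (rewrite Eh; unfold Cdiv; clear -N N'; clearbody u u'; field; repeat split; assumption).
    eapply Rle_trans; [apply Cmod_triangle|].
    eapply Rle_trans; [apply Rplus_le_compat_l, Cmod_triangle|].
    rewrite Cmod_opp, !Cmod_mult.
    destruct (HB w Hw) as [B1 B2].
    set (a := Cmod (/ u)) in *. assert (Pa : (0 <= a)%R) by apply Cmod_ge_0.
    set (a' := Cmod (/ u')) in *. assert (Pa' : (0 <= a')%R) by apply Cmod_ge_0.
    assert (A1 : (Cmod (f w' - f w - f' w * h) * a' <= K * Cmod h ^ 2 * / e)%R)
      by (apply Rmult_le_compat; auto using Cmod_ge_0).
    assert (Phh : (0 <= Cmod h * Cmod h)%R) by (now apply Rmult_le_pos).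
    assert (A2 : (Cmod (f w) * (Cmod h * Cmod h) * (a * a * a') <= B * (Cmod h * Cmod h) * (/ e * / e * / e))%R).
    { assert (0 <= a * a)%R by (now apply Rmult_le_pos).
      apply Rmult_le_compat; [apply Rmult_le_pos; auto using Cmod_ge_0|now apply Rmult_le_pos| |].
      - apply Rmult_le_compat_r; auto.
      - apply Rmult_le_compat; auto. apply Rmult_le_compat; auto. }
    assert (A3 : (Cmod (f' w) * (Cmod h * Cmod h) * (a * a') <= B * (Cmod h * Cmod h) * (/ e * / e))%R).
    { apply Rmult_le_compat; [apply Rmult_le_pos; auto using Cmod_ge_0|now apply Rmult_le_pos| |].
      - apply Rmult_le_compat_r; auto.
      - apply Rmult_le_compat; auto. }
    replace (B * (Cmod h * Cmod h) * (/ e * / e * / e))%R with (B / e ^ 3 * Cmod h ^ 2)%R in A2 by (field; lra).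
    replace (B * (Cmod h * Cmod h) * (/ e * / e))%R with (B / e ^ 2 * Cmod h ^ 2)%R in A3 by (field; lra).
    unfold Rdiv in *. nra.
Qed.

(** Dividing by [w - p] can be repeated [N] times. With [a = |w - p|] and a circle of radius [s]
    between [a] and [r], [cauchy_bound] for [f / (w - p)^N] gives [|f w| <= A (a / s)^N] with [A]
    independent of [N], and the right side tends to 0. *)
Lemma quad_diff_zero_disc p r e f f' K :
  (0 < e)%R -> quad_diff p r f f' K ->
  (forall w, (Cmod (w - p) < e)%R -> f w = 0) ->
  forall w, (Cmod (w - p) < r)%R -> f w = 0.
Proof.
  intros He Hf Z w Hw.
  destruct (Rlt_dec (Cmod (w - p)) e) as [Hwe|Hwe]; [now apply Z|].
  assert (Hr : (0 < r)%R) by (pose proof (Cmod_ge_0 (w - p)); lra).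
  destruct (quad_diff_bounded _ _ _ _ _ Hr Hf) as [B [PB HB]].
  assert (G : forall N : nat, exists g g' L, quad_diff p r g g' L /\
    (forall x, (Cmod (x - p) < e)%R -> g x = 0) /\
    (forall x, x - p <> 0 -> (Cmod (g x) = Cmod (f x) / Cmod (x - p) ^ N)%R)).
  { induction N as [|N [g [g' [L [H1 [H2 H3]]]]]].
    - exists f, f', K. split; [exact Hf|]. split; [exact Z|]. intros; simpl; field.
    - destruct (quad_diff_div p r e g g' L ltac:(lra) H1 H2) as [k [M H4]].
      exists (fun x => g x / (x - p)), k, M. split; [exact H4|]. split.
      + intros x Hx. rewrite H2 by assumption. unfold Cdiv. ring.
      + intros x Hx. rewrite Cmod_div, H3 by assumption. simpl. field.
        apply Cmod_gt_0 in Hx. split; [apply pow_nonzero|]; lra. }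
  set (a := Cmod (w - p)) in *. set (s := ((a + r) / 2)%R).
  assert (Ha : (0 < a)%R) by lra. assert (Hs : (a < s < r)%R) by (unfold s; lra).
  set (A := (2 * B * (s / (s - a)))%R).
  assert (Bd : forall N : nat, (Cmod (f w) <= A * (a / s) ^ N)%R).
  { intros N. destruct (G N) as [g [g' [L [H1 [H2 H3]]]]].
    assert (E := cauchy_bound p w s r L g g' (B / s ^ N) H1 ltac:(unfold a in Hs; lra) ltac:(lra)).
    assert (Hx : forall x, Cmod (x - p) = s -> (Cmod (g x) <= B / s ^ N)%R).
    { intros x Hx. assert (x - p <> 0) by (apply Cmod_gt_0; lra).
      rewrite H3, Hx by assumption. apply Rmult_le_compat_r.
      - left. apply Rinv_0_lt_compat, pow_lt; lra.
      - apply HB. lra. }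
    specialize (E Hx). rewrite H3 in E by (apply Cmod_gt_0; exact Ha). fold a in E.
    assert (Pa : (0 < a ^ N)%R) by (apply pow_lt; lra).
    assert (Ps : (0 < s ^ N)%R) by (apply pow_lt; lra).
    apply Rmult_le_reg_r with (/ a ^ N)%R; [now apply Rinv_0_lt_compat|].
    eapply Rle_trans; [exact E|]. right. unfold A, Rdiv. rewrite Rpow_mult_distr, pow_inv.
    field. repeat split; lra. }
  assert (L0 : (Cmod (f w) <= 0)%R).
  { eapply is_lim_seq_le with (l1 := Finite _) (l2 := Finite _); [exact Bd|apply is_lim_seq_const|].
    replace (Finite 0) with (Rbar_mult (Finite A) (Finite 0%R)) by (simpl; f_equal; ring).
    apply is_lim_seq_scal_l, is_lim_seq_geom.
    rewrite Rabs_pos_eq; [apply Rlt_div_l; lra|]. apply Rmult_le_pos; [lra|left; apply Rinv_0_lt_compat; lra]. }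
  apply Cmod_eq_0. pose proof (Cmod_ge_0 (f w)). lra.
Qed.

(** Continuity method: the parameters near which [f] vanishes identically have a supremum, and
    [quad_diff_zero_disc] pushes them past it unless it is 1. *)
Lemma quad_diff_zero_segment (f : C -> C) (a b : C) :
  (forall t, (0 <= t <= 1)%R -> loc_diff f (a + RtoC t * (b - a))) ->
  (exists e, (0 < e)%R /\ forall w, (Cmod (w - a) < e)%R -> f w = 0) ->
  f b = 0.
Proof.
  intros H [e [He Z]].
  set (g := fun t : R => a + RtoC t * (b - a)).
  set (E := fun t => (0 <= t <= 1)%R /\ exists e, (0 < e)%R /\ forall w, (Cmod (w - g t) < e)%R -> f w = 0).
  assert (E0 : E 0%R).
  { split; [lra|]. exists e. split; [exact He|]. intros w. unfold g.
    replace (a + RtoC 0 * (b - a)) with a by ring. apply Z. }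
  destruct (completeness E) as [T [T1 T2]].
  { exists 1%R. intros t [Ht _]. lra. }
  { now exists 0%R. }
  assert (HT : (0 <= T <= 1)%R).
  { split; [now apply T1|]. apply T2. intros t [Ht _]. lra. }
  destruct (H T HT) as [f' [r [K [Hr HQ]]]]. fold (g T) in HQ.
  set (l := Cmod (b - a)). assert (Pl : (0 <= l)%R) by apply Cmod_ge_0.
  (* Chosen so that, for [t] within [eta] below [T], the disc of radius [r / 2] about [g t] lies in
     the disc of radius [r] about [g T] and still contains [g s] for [s] the smaller of 1 and
     [T + eta]. The [+ 1] covers the case [a = b]. *)
  set (eta := (r / (4 * (l + 1)))%R).
  assert (Peta : (0 < eta)%R) by (apply Rdiv_lt_0_compat; lra).
  assert (Eeta : (eta * l <= r / 4)%R).
  { apply Rle_trans with (eta * (l + 1))%R; [apply Rmult_le_compat_l; lra|].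
    right. unfold eta. field. lra. }
  assert (Dg : forall s t, Cmod (g s - g t) = (Rabs (s - t) * l)%R).
  { intros s t. unfold g. replace (a + RtoC s * (b - a) - (a + RtoC t * (b - a))) with (RtoC (s - t) * (b - a))
      by (rewrite RtoC_minus; ring). now rewrite Cmod_mult, Cmod_R. }
  assert (Ht : exists t, E t /\ (T - eta < t <= T)%R).
  { apply Classical_Prop.NNPP. intros N. assert (T <= T - eta)%R; [|lra].
    apply T2. intros t Et. apply Rnot_lt_le. intros Hlt. apply N. exists t.
    split; [exact Et|]. split; [exact Hlt|now apply T1]. }
  destruct Ht as [t [[Ht [e' [He' Z']]] Htt]].
  assert (Q2 : quad_diff (g t) (r / 2) f f' K).
  { eapply quad_diff_sub; [exact HQ|]. rewrite Dg, Rabs_left1 by lra.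
    assert (- (t - T) * l <= eta * l)%R by (apply Rmult_le_compat_r; lra). lra. }
  pose proof (quad_diff_zero_disc _ _ _ _ _ _ He' Q2 Z') as Z2.
  set (s := Rmin 1 (T + eta)).
  assert (Hs1 : (s <= 1)%R) by apply Rmin_l. assert (Hs2 : (s <= T + eta)%R) by apply Rmin_r.
  assert (HsT : (T <= s)%R) by (apply Rmin_glb; lra).
  assert (Dst : (Cmod (g s - g t) < r / 2)%R).
  { rewrite Dg, Rabs_pos_eq by lra. destruct Pl as [Pl|Pl].
    - apply Rlt_le_trans with (2 * eta * l)%R; [apply Rmult_lt_compat_r; lra|lra].
    - rewrite <- Pl. lra. }
  assert (Es : E s).
  { split; [lra|]. exists (r / 2 - Cmod (g s - g t))%R. split; [lra|].
    intros w Hw. apply Z2. replace (w - g t) with ((w - g s) + (g s - g t)) by ring.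
    eapply Rle_lt_trans; [apply Cmod_triangle|]. lra. }
  pose proof (T1 s Es) as HsT'.
  assert (s = 1%R).
  { unfold s, Rmin in *. destruct (Rle_dec 1 (T + eta)); lra. }
  replace b with (g 1%R) by (unfold g; ring). rewrite <- H0. apply Z2. exact Dst.
Qed.

(** * Lambert series off the lattice *)

Lemma cexp_quad_diff l m p r E :
  (forall w, (Cmod (w - p) < r)%R -> (Cmod (cexp (l * w + m)) <= E)%R) ->
  quad_diff p r (fun w => cexp (l * w + m)) (fun w => l * cexp (l * w + m)) (4 * Cmod l ^ 2 * E).
Proof.
  intros HE w w' Hw Hw'. set (h := l * (w' - w)).
  assert (E1 : cexp (l * w' + m) = cexp (l * w + m) * cexp h).
  { rewrite <- cexp_add. f_equal. unfold h. ring. }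
  rewrite E1. replace (_ - _ - _) with (cexp (l * w + m) * (cexp h - 1 - h)) by (unfold h; ring).
  rewrite Cmod_mult. pose proof (cexp_quad h) as H.
  pose proof (HE w Hw) as A1. pose proof (HE w' Hw') as A2.
  rewrite E1, Cmod_mult, (Cmod_cexp h) in A2.
  set (x := Cmod (cexp (l * w + m))) in *. assert (Px : (0 <= x)%R) by apply Cmod_ge_0.
  assert (A3 : (x * Rmax 1 (exp (Re h)) <= E)%R).
  { unfold Rmax. destruct (Rle_dec 1 (exp (Re h))); lra. }
  assert (A4 : Cmod h = (Cmod l * Cmod (w' - w))%R) by apply Cmod_mult.
  apply Rle_trans with (x * (4 * Rmax 1 (exp (Re h)) * Cmod h ^ 2))%R; [now apply Rmult_le_compat_l|].
  replace (x * (4 * Rmax 1 (exp (Re h)) * Cmod h ^ 2))%R with ((x * Rmax 1 (exp (Re h))) * (4 * Cmod h ^ 2))%R by ring.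
  rewrite A4.
  replace (4 * Cmod l ^ 2 * E * Cmod (w' - w) ^ 2)%R with (E * (4 * (Cmod l * Cmod (w' - w)) ^ 2))%R by ring.
  apply Rmult_le_compat_r; [|exact A3]. pose proof (pow2_ge_0 (Cmod l * Cmod (w' - w))). lra.
Qed.

Definition Lx (x : C) : C := x / (1 - x).

(** By [L(y) - L(x) = (y - x) / ((1 - x) (1 - y))] the error splits into a term quadratic in the
    increment of [x] and the error of [x] itself. As [2 * r] bounds the distance of two points of
    the disc, [X + K * (2 * r)] is a Lipschitz constant of [x]. *)
Lemma quad_diff_Lx p r x x' K X d :
  (0 < d)%R ->
  (forall w, (Cmod (w - p) < r)%R -> (Cmod (x' w) <= X)%R) ->
  (forall w, (Cmod (w - p) < r)%R -> (d <= Cmod (1 - x w))%R) ->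
  quad_diff p r x x' K -> (0 <= K)%R -> (0 <= X)%R ->
  quad_diff p r (fun w => Lx (x w)) (fun w => x' w / (1 - x w) ^ 2)
    ((X + K * (2 * r)) ^ 2 / d ^ 3 + K / d ^ 2).
Proof.
  intros Hd HX Hx H PK PX w w' Hw Hw'.
  pose proof (H w w' Hw Hw') as Q. pose proof (HX w Hw) as B1.
  pose proof (Hx w Hw) as D1. pose proof (Hx w' Hw') as D2.
  assert (N1 : 1 - x w <> 0) by (apply Cmod_gt_0; lra).
  assert (N2 : 1 - x w' <> 0) by (apply Cmod_gt_0; lra).
  set (h := w' - w) in *.
  assert (Ph : (0 <= Cmod h)%R) by apply Cmod_ge_0.
  assert (Hh : (Cmod h <= 2 * r)%R).
  { replace h with ((w' - p) + - (w - p)) by (unfold h; ring).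
    eapply Rle_trans; [apply Cmod_triangle|]. rewrite Cmod_opp. lra. }
  set (dx := x w' - x w).
  assert (Ldx : (Cmod dx <= (X + K * (2 * r)) * Cmod h)%R).
  { replace dx with ((x w' - x w - x' w * h) + x' w * h) by (unfold dx; ring).
    eapply Rle_trans; [apply Cmod_triangle|]. rewrite Cmod_mult.
    assert (Cmod (x' w) * Cmod h <= X * Cmod h)%R by (apply Rmult_le_compat_r; auto).
    assert (K * Cmod h ^ 2 <= K * (2 * r) * Cmod h)%R.
    { simpl. rewrite Rmult_1_r, <- Rmult_assoc. apply Rmult_le_compat_r; [auto|].
      apply Rmult_le_compat_l; auto. }
    lra. }
  replace (Lx (x w') - Lx (x w) - x' w / (1 - x w) ^ 2 * h) with
    (dx * dx * (/ (1 - x w) * / (1 - x w) * / (1 - x w')) +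
     (x w' - x w - x' w * h) * (/ (1 - x w) * / (1 - x w))).
  2:{ unfold Lx, dx, Cdiv. field. auto. }
  eapply Rle_trans; [apply Cmod_triangle|]. rewrite !Cmod_mult, !Cmod_inv by assumption.
  assert (Id : (0 < / d)%R) by (now apply Rinv_0_lt_compat).
  assert (I1 : (0 <= / Cmod (1 - x w) <= / d)%R).
  { split; [left; apply Rinv_0_lt_compat; lra|apply Rinv_le_contravar; lra]. }
  assert (I2 : (0 <= / Cmod (1 - x w') <= / d)%R).
  { split; [left; apply Rinv_0_lt_compat; lra|apply Rinv_le_contravar; lra]. }
  set (a := (/ Cmod (1 - x w))%R) in *. set (b := (/ Cmod (1 - x w'))%R) in *.
  assert (Paa : (0 <= a * a <= / d * / d)%R).
  { split; [apply Rmult_le_pos; lra|apply Rmult_le_compat; lra]. }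
  rewrite Rmult_plus_distr_r. apply Rplus_le_compat.
  - replace ((X + K * (2 * r)) ^ 2 / d ^ 3 * Cmod h ^ 2)%R with
      (((X + K * (2 * r)) * Cmod h * ((X + K * (2 * r)) * Cmod h)) * (/ d * / d * / d))%R by (field; lra).
    apply Rmult_le_compat.
    + apply Rmult_le_pos; apply Cmod_ge_0.
    + apply Rmult_le_pos; lra.
    + apply Rmult_le_compat; auto using Cmod_ge_0.
    + apply Rmult_le_compat; lra.
  - replace (K / d ^ 2 * Cmod h ^ 2)%R with (K * Cmod h ^ 2 * (/ d * / d))%R by (field; lra).
    apply Rmult_le_compat; auto using Cmod_ge_0; lra.
Qed.

(** A slightly larger ratio absorbs one linear factor per induction step. *)
Lemma poly_geom (m : nat) (x : R) : (0 <= x < 1)%R ->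
  exists B y, (0 <= B)%R /\ (x <= y < 1)%R /\ forall n, (INR (S n) ^ m * x ^ n <= B * y ^ n)%R.
Proof.
  intros Hx. induction m as [|m [B [y [PB [Hy H]]]]].
  - exists 1%R, x. split; [lra|]. split; [lra|]. intros n; simpl; lra.
  - set (z := ((y + 1) / 2)%R). assert (Hz : (y < z < 1)%R) by (unfold z; lra).
    assert (Pz : (0 < z)%R) by lra.
    set (A := (z / (z - y))%R).
    assert (PA : (1 <= A)%R) by (unfold A; apply Rle_div_r; lra).
    assert (S0 : forall n, (INR (S n) * y ^ n <= A * z ^ n)%R).
    (* The right side is [z - y] times a sum of [n + 1] monomials of degree [n], each at least
       [y ^ n]. *)
    { assert (E : forall n, (INR (S n) * y ^ n * (z - y) <= z * z ^ n - y * y ^ n)%R).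
      { induction n as [|n IH]; [simpl; lra|].
        rewrite S_INR. replace (y ^ S n)%R with (y * y ^ n)%R by reflexivity.
        replace (z ^ S n)%R with (z * z ^ n)%R by reflexivity.
        assert (P1 : (0 <= y ^ n)%R) by (apply pow_le; lra).
        assert (P2 : (y ^ n <= z ^ n)%R) by (apply pow_incr; lra).
        assert (y * (INR (S n) * y ^ n * (z - y)) <= y * (z * z ^ n - y * y ^ n))%R by (apply Rmult_le_compat_l; lra).
        assert (z * y * y ^ n <= z * z * z ^ n)%R.
        { rewrite !Rmult_assoc. apply Rmult_le_compat_l; [lra|]. apply Rmult_le_compat; lra. }
        assert ((z - y) * (y * y ^ n) <= (z - y) * (z * z ^ n))%R.
        { apply Rmult_le_compat_l; [lra|]. apply Rmult_le_compat; lra. }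
        nra. }
      intros n. specialize (E n). apply Rmult_le_reg_r with (z - y)%R; [lra|].
      eapply Rle_trans; [exact E|].
      assert (0 <= y * y ^ n)%R by (apply Rmult_le_pos; [lra|apply pow_le; lra]).
      replace (A * z ^ n * (z - y))%R with (z * z ^ n)%R by (unfold A; field; lra). lra. }
    exists (B * A)%R, z. split; [apply Rmult_le_pos; lra|]. split; [lra|].
    intros n. specialize (H n). specialize (S0 n).
    replace (INR (S n) ^ S m * x ^ n)%R with (INR (S n) * (INR (S n) ^ m * x ^ n))%R by (rewrite <- (tech_pow_Rmult _ m); ring).
    apply Rle_trans with (INR (S n) * (B * y ^ n))%R.
    + apply Rmult_le_compat_l; [apply pos_INR|exact H].
    + replace (INR (S n) * (B * y ^ n))%R with (B * (INR (S n) * y ^ n))%R by ring.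
      rewrite Rmult_assoc. apply Rmult_le_compat_l; assumption.
Qed.

Lemma geom_eventually (B Q e : R) : (0 <= Q < 1)%R -> (0 < e)%R ->
  exists N, forall n, (N <= n)%nat -> (B * Q ^ n <= e)%R.
Proof.
  intros HQ He.
  assert (H : is_lim_seq (fun n => B * Q ^ n)%R 0).
  { replace (Finite 0) with (Rbar_mult (Finite B) (Finite 0%R)) by (simpl; f_equal; ring).
    apply is_lim_seq_scal_l, is_lim_seq_geom. rewrite Rabs_pos_eq; lra. }
  apply is_lim_seq_spec in H. destruct (H (mkposreal e He)) as [N HN].
  exists N. intros n Hn. specialize (HN n Hn). simpl in HN. rewrite Rminus_0_r in HN.
  pose proof (Rle_abs (B * Q ^ n)). lra.
Qed.

(** * Lambert series whose exponents are affine in the variable *)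

Section Lambert.
Variables (l m : nat -> C) (p : C) (r0 B Q : R).
Hypothesis Hr0 : (0 < r0)%R.
Hypothesis HQ : (0 <= Q < 1)%R.
Hypothesis Hbound : forall n w, (Cmod (w - p) < r0)%R -> (Cmod (cexp (l n * w + m n)) <= B * Q ^ n)%R.
Hypothesis Hne : forall n, cexp (l n * p + m n) <> 1.

Lemma lambert_gap_one n :
  exists d r, (0 < d)%R /\ (0 < r <= r0)%R /\
    forall w, (Cmod (w - p) < r)%R -> (d <= Cmod (1 - cexp (l n * w + m n)))%R.
Proof.
  set (E := (B * Q ^ n)%R).
  pose proof (cexp_quad_diff (l n) (m n) p r0 E (Hbound n)) as H.
  set (K := (4 * Cmod (l n) ^ 2 * E)%R) in *.
  pose proof (quad_diff_K_pos _ _ _ _ _ Hr0 H) as PK.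
  set (x := fun w => cexp (l n * w + m n)) in *.
  set (d := Cmod (1 - x p)).
  assert (Pd : (0 < d)%R).
  { apply Cmod_gt_0. intros E1. apply (Hne n). change (x p = 1).
    replace (x p) with (1 - (1 - x p)) by ring. rewrite E1. ring. }
  set (A := (Cmod (l n * x p) + K * r0 + 1)%R).
  assert (PA : (1 <= A)%R).
  { unfold A. pose proof (Cmod_ge_0 (l n * x p)). assert (0 <= K * r0)%R by (apply Rmult_le_pos; lra). lra. }
  exists (d / 2)%R, (Rmin r0 (d / (2 * A)))%R. split; [lra|]. split.
  { split; [apply Rmin_pos; [lra|apply Rdiv_lt_0_compat; lra]|apply Rmin_l]. }
  intros w Hw.
  assert (Hw1 : (Cmod (w - p) < r0)%R) by (eapply Rlt_le_trans; [exact Hw|apply Rmin_l]).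
  assert (Hw2 : (Cmod (w - p) < d / (2 * A))%R) by (eapply Rlt_le_trans; [exact Hw|apply Rmin_r]).
  assert (Hp : (Cmod (p - p) < r0)%R) by (apply Cmod_diag; lra).
  pose proof (H p w Hp Hw1) as Q1. fold (x w).
  change (Cmod (x w - x p - l n * x p * (w - p)) <= K * Cmod (w - p) ^ 2)%R in Q1.
  pose proof (Cmod_ge_0 (w - p)) as Ph.
  assert (L : (Cmod (x w - x p) <= d / 2)%R).
  { replace (x w - x p) with ((x w - x p - l n * x p * (w - p)) + l n * x p * (w - p)) by ring.
    eapply Rle_trans; [apply Cmod_triangle|]. rewrite (Cmod_mult _ (w - p)).
    assert (K * Cmod (w - p) ^ 2 <= K * r0 * Cmod (w - p))%R.
    { simpl. rewrite Rmult_1_r, <- Rmult_assoc. apply Rmult_le_compat_r; [auto|].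
      apply Rmult_le_compat_l; lra. }
    apply Rle_trans with (A * Cmod (w - p))%R; [unfold A; lra|].
    apply Rle_trans with (A * (d / (2 * A)))%R; [apply Rmult_le_compat_l; lra|]. right; field; lra. }
  pose proof (Cmod_triangle (1 - x w) (x w - x p)) as T.
  replace (1 - x w + (x w - x p)) with (1 - x p) in T by ring. fold d in T. lra.
Qed.

(** From some index on, the exponentials have modulus at most 1/2 on the whole disc; the finitely
    many others differ from 1 at [p], hence near [p]. *)
Lemma lambert_gap :
  exists d r, (0 < d)%R /\ (0 < r <= r0)%R /\
    forall n w, (Cmod (w - p) < r)%R -> (d <= Cmod (1 - cexp (l n * w + m n)))%R.
Proof.
  destruct (geom_eventually B Q (1/2) HQ ltac:(lra)) as [N HN].
  assert (Hd : exists d r, (0 < d)%R /\ (0 < r <= r0)%R /\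
    forall n w, (n < N)%nat -> (Cmod (w - p) < r)%R -> (d <= Cmod (1 - cexp (l n * w + m n)))%R).
  { clear HN. induction N as [|N [d [r [Pd [Pr H]]]]].
    - exists 1%R, r0. split; [lra|]. split; [lra|]. intros; lia.
    - destruct (lambert_gap_one N) as [d' [r' [Pd' [Pr' H']]]].
      exists (Rmin d d'), (Rmin r r'). split; [now apply Rmin_pos|].
      pose proof (Rmin_l r r'). pose proof (Rmin_r r r').
      split; [split; [apply Rmin_pos|]; lra|].
      intros n w Hn Hw. destruct (Nat.eq_dec n N) as [->|].
      + eapply Rle_trans; [apply Rmin_r|]. apply H'. lra.
      + eapply Rle_trans; [apply Rmin_l|]. apply H; [lia|lra]. }
  destruct Hd as [d [r [Pd [Pr H]]]].
  exists (Rmin d (1/2)), r. split; [apply Rmin_pos; lra|]. split; [exact Pr|].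
  intros n w Hw. destruct (Nat.lt_ge_cases n N) as [Hn|Hn].
  - eapply Rle_trans; [apply Rmin_l|]. now apply H.
  - eapply Rle_trans; [apply Rmin_r|].
    assert (Hb := Hbound n w ltac:(lra)). specialize (HN n Hn).
    set (x := cexp (l n * w + m n)) in *.
    pose proof (Cmod_triangle (1 - x) x) as T. replace (1 - x + x) with (RtoC 1) in T by ring.
    rewrite Cmod_1 in T. lra.
Qed.

Variables (c : nat -> C) (A : R).
Hypothesis Hl : forall n, (Cmod (l n) <= A * INR (S n))%R.
Hypothesis Hc : forall n, (Cmod (c n) <= A * INR (S n))%R.

(** Slopes of linear growth cover both variables at once: in [z] the slope is constant, in [tau] it
    is proportional to [n], or to [n + 1] for the reflected series. *)
Lemma lambert_loc_diff :
  loc_diff (fun w => CSeries (fun n => c n * Lx (cexp (l n * w + m n)))) p.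
Proof.
  destruct lambert_gap as [d [r1 [Pd [Pr1 Hgap]]]].
  set (r := Rmin r1 1).
  assert (Hr1 : (r <= r1)%R) by apply Rmin_l. assert (Hr2 : (r <= 1)%R) by apply Rmin_r.
  assert (Pr : (0 < r)%R) by (apply Rmin_pos; lra).
  assert (PB : (0 <= B)%R).
  { assert (Hp : (Cmod (p - p) < r0)%R) by (apply Cmod_diag; lra).
    pose proof (Hbound O p Hp) as H. simpl in H.
    pose proof (Cmod_ge_0 (cexp (l O * p + m O))). lra. }
  assert (PA : (0 <= A)%R).
  { pose proof (Hc O) as H. pose proof (Cmod_ge_0 (c O)). simpl in H. lra. }
  assert (PN : forall n, (1 <= INR (S n))%R).
  { intros n. rewrite S_INR. pose proof (pos_INR n). lra. }
  assert (PQ : forall n, (0 <= Q ^ n <= 1)%R).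
  { intros n. split; [apply pow_le; lra|]. rewrite <- (pow1 n). apply pow_incr; lra. }
  set (x := fun n w => cexp (l n * w + m n)).
  set (x' := fun n w => l n * cexp (l n * w + m n)).
  set (E := fun n => (B * Q ^ n)%R).
  assert (PE : forall n, (0 <= E n)%R) by (intros n; apply Rmult_le_pos; [|apply PQ]; lra).
  set (Kx := fun n => (4 * Cmod (l n) ^ 2 * E n)%R).
  assert (PKx : forall n, (0 <= Kx n)%R).
  { intros n. unfold Kx. apply Rmult_le_pos; [|apply PE]. pose proof (pow2_ge_0 (Cmod (l n))). lra. }
  set (X := fun n => (Cmod (l n) * E n)%R).
  assert (PX : forall n, (0 <= X n)%R) by (intros n; apply Rmult_le_pos; [apply Cmod_ge_0|apply PE]).
  set (K := fun n => (Cmod (c n) * ((X n + Kx n * (2 * r)) ^ 2 / d ^ 3 + Kx n / d ^ 2))%R).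
  assert (HL : forall n, quad_diff p r (fun w => c n * Lx (x n w)) (fun w => c n * (x' n w / (1 - x n w) ^ 2)) (K n)).
  { intros n. apply quad_diff_scal. apply quad_diff_Lx; auto.
    - intros w Hw. unfold x', X. rewrite Cmod_mult. apply Rmult_le_compat_l; [apply Cmod_ge_0|].
      apply Hbound. lra.
    - intros w Hw. apply Hgap. lra.
    - apply cexp_quad_diff. intros w Hw. apply Hbound. lra. }
  (* Five powers of [n + 1]: the constant of the exponential grows like the square of the slope, it
     enters squared in [quad_diff_Lx], and the coefficient [c n] adds one more. *)
  destruct (poly_geom 5 Q HQ) as [B5 [y [PB5 [Hy H5]]]].
  assert (Pow : forall k n, (k <= 5)%nat -> (INR (S n) ^ k * Q ^ n <= B5 * y ^ n)%R).
  { intros k n Hk. eapply Rle_trans; [|apply H5]. apply Rmult_le_compat_r; [apply PQ|].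
    apply Rle_pow; auto. }
  assert (Id : (0 < / d)%R) by (now apply Rinv_0_lt_compat).
  assert (LxB : forall n w, (Cmod (w - p) < r)%R -> (Cmod (c n * Lx (x n w)) <= A * B * / d * B5 * y ^ n)%R).
  { intros n w Hw. unfold Lx, Cdiv. rewrite !Cmod_mult.
    assert (H1 := Hgap n w ltac:(lra)). fold (x n w) in H1.
    assert (N1 : 1 - x n w <> 0) by (apply Cmod_gt_0; lra). rewrite Cmod_inv by exact N1.
    assert (H2 : (Cmod (x n w) <= B * Q ^ n)%R) by (apply Hbound; lra).
    assert (H3 : (/ Cmod (1 - x n w) <= / d)%R) by (apply Rinv_le_contravar; lra).
    assert (0 <= / Cmod (1 - x n w))%R by (left; apply Rinv_0_lt_compat; lra).
    apply Rle_trans with ((A * INR (S n)) * ((B * Q ^ n) * / d))%R.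
    - apply Rmult_le_compat; auto using Cmod_ge_0.
      + apply Rmult_le_pos; auto using Cmod_ge_0.
      + apply Rmult_le_compat; auto using Cmod_ge_0.
    - pose proof (Pow 1%nat n ltac:(lia)) as H4. rewrite pow_1 in H4.
      replace (A * INR (S n) * (B * Q ^ n * / d))%R with (A * B * / d * (INR (S n) * Q ^ n))%R by ring.
      replace (A * B * / d * B5 * y ^ n)%R with (A * B * / d * (B5 * y ^ n))%R by ring.
      apply Rmult_le_compat_l; [|exact H4]. apply Rmult_le_pos; [apply Rmult_le_pos|]; lra. }
  assert (LxB' : forall n w, (Cmod (w - p) < r)%R ->
    (Cmod (c n * (x' n w / (1 - x n w) ^ 2)) <= A * A * B * / d * / d * B5 * y ^ n)%R).
  { intros n w Hw.
    assert (H1 := Hgap n w ltac:(lra)). fold (x n w) in H1.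
    assert (N1 : 1 - x n w <> 0) by (apply Cmod_gt_0; lra).
    replace (x' n w / (1 - x n w) ^ 2) with (l n * x n w * (/ (1 - x n w) * / (1 - x n w)))
      by (unfold x', x, Cdiv; field; exact N1).
    rewrite !Cmod_mult, Cmod_inv by exact N1.
    assert (H2 : (Cmod (x n w) <= B * Q ^ n)%R) by (apply Hbound; lra).
    assert (H3 : (/ Cmod (1 - x n w) <= / d)%R) by (apply Rinv_le_contravar; lra).
    assert (0 <= / Cmod (1 - x n w))%R by (left; apply Rinv_0_lt_compat; lra).
    apply Rle_trans with ((A * INR (S n)) * ((A * INR (S n)) * (B * Q ^ n) * (/ d * / d)))%R.
    - apply Rmult_le_compat; auto using Cmod_ge_0.
      + apply Rmult_le_pos; [apply Rmult_le_pos|apply Rmult_le_pos]; auto using Cmod_ge_0.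
      + apply Rmult_le_compat; [apply Rmult_le_pos; apply Cmod_ge_0|now apply Rmult_le_pos| |].
        * apply Rmult_le_compat; auto using Cmod_ge_0.
        * apply Rmult_le_compat; auto using Cmod_ge_0.
    - pose proof (Pow 2%nat n ltac:(lia)) as H4.
      replace (A * INR (S n) * (A * INR (S n) * (B * Q ^ n) * (/ d * / d)))%R with
        (A * A * B * / d * / d * (INR (S n) ^ 2 * Q ^ n))%R by ring.
      replace (A * A * B * / d * / d * B5 * y ^ n)%R with (A * A * B * / d * / d * (B5 * y ^ n))%R by ring.
      apply Rmult_le_compat_l; [|exact H4]. repeat apply Rmult_le_pos; lra. }
  assert (KB : exists CK, forall n, (0 <= K n <= CK * y ^ n)%R).
  { set (a := (A * B)%R). set (b := (4 * A ^ 2 * B)%R).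
    assert (Pa : (0 <= a)%R) by (apply Rmult_le_pos; lra).
    assert (Pb : (0 <= b)%R) by (apply Rmult_le_pos; [pose proof (pow2_ge_0 A); lra|lra]).
    exists (A * ((a + b * 2) ^ 2 / d ^ 3 + b / d ^ 2) * B5)%R. intros n.
    assert (D3 : (0 <= / d ^ 3)%R) by (left; apply Rinv_0_lt_compat, pow_lt; lra).
    assert (D2 : (0 <= / d ^ 2)%R) by (left; apply Rinv_0_lt_compat, pow_lt; lra).
    pose proof (PKx n) as PKn. pose proof (PX n) as PXn. pose proof (PN n) as PNn. pose proof (PQ n) as PQn.
    assert (K0 : (0 <= (X n + Kx n * (2 * r)) ^ 2 / d ^ 3 + Kx n / d ^ 2)%R).
    { apply Rplus_le_le_0_compat; apply Rmult_le_pos; auto. apply pow2_ge_0. }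
    set (N := INR (S n)) in *. set (q := (Q ^ n)%R) in *.
    assert (X1 : (X n <= a * (N * q))%R).
    { unfold X, E, a. fold q. replace (A * B * (N * q))%R with (A * N * (B * q))%R by ring.
      apply Rmult_le_compat_r; [apply Rmult_le_pos; lra|apply Hl]. }
    assert (K1 : (Kx n <= b * (N ^ 2 * q))%R).
    { unfold Kx, E, b. fold q. replace (4 * A ^ 2 * B * (N ^ 2 * q))%R with (4 * (A * N) ^ 2 * (B * q))%R by ring.
      apply Rmult_le_compat_r; [apply Rmult_le_pos; lra|].
      apply Rmult_le_compat_l; [lra|]. apply pow_incr. split; [apply Cmod_ge_0|apply Hl]. }
    assert (Nq : (N * q <= N ^ 2 * q)%R) by (apply Rmult_le_compat_r; [lra|nra]).
    assert (S1 : (X n + Kx n * (2 * r) <= (a + b * 2) * (N ^ 2 * q))%R).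
    { assert (Kx n * (2 * r) <= b * (N ^ 2 * q) * 2)%R by (apply Rmult_le_compat; lra).
      assert (a * (N * q) <= a * (N ^ 2 * q))%R by (apply Rmult_le_compat_l; lra). lra. }
    assert (S0 : (0 <= X n + Kx n * (2 * r))%R).
    { apply Rplus_le_le_0_compat; [lra|apply Rmult_le_pos; lra]. }
    assert (S2 : ((X n + Kx n * (2 * r)) ^ 2 <= (a + b * 2) ^ 2 * (N ^ 4 * q))%R).
    { apply Rle_trans with (((a + b * 2) * (N ^ 2 * q)) ^ 2)%R; [apply pow_incr; lra|].
      replace (((a + b * 2) * (N ^ 2 * q)) ^ 2)%R with ((a + b * 2) ^ 2 * (N ^ 4 * (q * q)))%R by ring.
      apply Rmult_le_compat_l; [apply pow2_ge_0|]. apply Rmult_le_compat_l; [apply pow_le; lra|nra]. }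
    assert (N24 : (N ^ 2 * q <= N ^ 4 * q)%R).
    { apply Rmult_le_compat_r; [lra|]. apply Rle_pow; [lra|lia]. }
    assert (S3 : ((X n + Kx n * (2 * r)) ^ 2 / d ^ 3 + Kx n / d ^ 2 <=
      ((a + b * 2) ^ 2 / d ^ 3 + b / d ^ 2) * (N ^ 4 * q))%R).
    { rewrite Rmult_plus_distr_r. apply Rplus_le_compat.
      - replace ((a + b * 2) ^ 2 / d ^ 3 * (N ^ 4 * q))%R with ((a + b * 2) ^ 2 * (N ^ 4 * q) / d ^ 3)%R
          by (unfold Rdiv; ring).
        apply Rmult_le_compat_r; auto.
      - replace (b / d ^ 2 * (N ^ 4 * q))%R with (b * (N ^ 4 * q) / d ^ 2)%R by (unfold Rdiv; ring).
        apply Rmult_le_compat_r; auto. eapply Rle_trans; [exact K1|]. apply Rmult_le_compat_l; auto. }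
    split; [apply Rmult_le_pos; [apply Cmod_ge_0|exact K0]|].
    unfold K. apply Rle_trans with (A * N * (((a + b * 2) ^ 2 / d ^ 3 + b / d ^ 2) * (N ^ 4 * q)))%R.
    - apply Rmult_le_compat; auto using Cmod_ge_0.
    - pose proof (Pow 5%nat n ltac:(lia)) as H. fold N in H. fold q in H.
      replace (A * N * (((a + b * 2) ^ 2 / d ^ 3 + b / d ^ 2) * (N ^ 4 * q)))%R with
        (A * ((a + b * 2) ^ 2 / d ^ 3 + b / d ^ 2) * (N ^ 5 * q))%R by ring.
      rewrite (Rmult_assoc _ B5). apply Rmult_le_compat_l; [|exact H].
      apply Rmult_le_pos; [lra|]. apply Rplus_le_le_0_compat; apply Rmult_le_pos; auto. apply pow2_ge_0. }
  destruct KB as [CK HK].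
  assert (EK : ex_series K).
  { eapply (@ex_series_le R_AbsRing R_CompleteNormedModule) with (b := fun n => (CK * y ^ n)%R).
    - intros n. destruct (HK n) as [k0 k1]. change (Rabs (K n) <= CK * y ^ n)%R. rewrite Rabs_pos_eq; lra.
    - eexists. apply is_series_geom_B. lra. }
  destruct EK as [s Hs].
  exists (fun w => CSeries (fun n => c n * (x' n w / (1 - x n w) ^ 2))), r, s.
  split; [exact Pr|].
  eapply quad_diff_series with (f := fun n w => c n * Lx (x n w)); [exact HL| | |exact Hs].
  - intros w Hw. eapply csum_geom_ex with (x := y); [lra|]. intros n. apply LxB. exact Hw.
  - intros w Hw. eapply csum_geom_ex with (x := y); [lra|]. intros n. apply LxB'. exact Hw.
Qed.

End Lambert.

Definition lambert (c : nat -> C) (z tau : C) : C :=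
  CSeries (fun n => c n * Lx (cexp (two_pi_i * (RtoC (INR n) * tau + z)))).

(* The closed forms of f^(3,0) and f^(2,1): q^n / zeta, n >= 1, is written
   e^(2 pi i ((n - 1) tau + (tau - z))). *)
Definition fzzz (z tau : C) : C :=
  RtoC (/ 2) + lambert (fun _ => 1) z tau - lambert (fun _ => 1) (tau - z) tau.

Definition fzzt (z tau : C) : C :=
  RtoC (- / 12) + lambert (fun n => RtoC (INR n)) z tau
  + lambert (fun n => RtoC (INR (S n))) (tau - z) tau.

Lemma Re_two_pi_i w : Re (two_pi_i * w) = (- (2 * PI) * Im w)%R.
Proof. unfold two_pi_i, Re, Im; simpl. ring. Qed.

Lemma Im_two_pi_i w : Im (two_pi_i * w) = (2 * PI * Re w)%R.
Proof. unfold two_pi_i, Re, Im; simpl. ring. Qed.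

Lemma Cmod_e w : Cmod (cexp (two_pi_i * w)) = exp (- (2 * PI) * Im w).
Proof. now rewrite Cmod_cexp, Re_two_pi_i. Qed.

Lemma cexp_eq_1 w : cexp (two_pi_i * w) = 1 -> exists k : Z, w = RtoC (IZR k).
Proof.
  intros H. assert (HI : Im w = 0%R).
  { pose proof (Cmod_e w) as E. rewrite H, Cmod_1, <- exp_0 in E.
    apply exp_inv in E. pose proof PI_RGT_0. nra. }
  assert (HR : cos (2 * PI * Re w) = 1%R).
  { apply (f_equal Re) in H. unfold cexp in H. rewrite Re_two_pi_i, Im_two_pi_i, HI in H.
    unfold Re in H at 1; simpl in H. rewrite Rmult_0_r, exp_0, Rmult_1_l in H. exact H. }
  replace (2 * PI * Re w)%R with (2 * (PI * Re w))%R in HR by ring. rewrite cos_2a_sin in HR.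
  assert (HS : sin (PI * Re w) = 0%R) by nra.
  destruct (sin_eq_0_0 _ HS) as [k Hk]. exists k. apply C_eq; simpl; [|exact HI].
  apply Rmult_eq_reg_l with PI; [|pose proof PI_RGT_0; lra]. lra.
Qed.

Lemma Im_le_sub w p r : (Cmod (w - p) < r)%R -> (Im p - r < Im w < Im p + r)%R.
Proof.
  intros H. pose proof (im_le_Cmod (w - p)) as H1.
  assert (E : Im (w - p) = (Im w - Im p)%R) by (unfold Im; simpl; ring).
  rewrite E in H1. apply Rabs_le_between in H1. lra.
Qed.

Lemma off_lattice_e z tau n : off_lattice z tau ->
  cexp (two_pi_i * (RtoC (INR n) * tau + z)) <> 1.
Proof.
  intros [_ H] E. apply cexp_eq_1 in E. destruct E as [k Hk].
  apply (H k (- Z.of_nat n)%Z). rewrite opp_IZR, <- INR_IZR_INZ, <- Hk, RtoC_opp. ring.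
Qed.

Lemma off_lattice_reflect z tau : off_lattice z tau -> off_lattice (tau - z) tau.
Proof.
  intros [H0 H]. split; [exact H0|]. intros m n E.
  apply (H (- m)%Z (1 - n)%Z). rewrite minus_IZR, opp_IZR, RtoC_minus, RtoC_opp.
  replace z with (tau - (tau - z)) by ring. rewrite E. ring.
Qed.

Lemma exp_INR_mult n x : exp (INR n * x) = (exp x ^ n)%R.
Proof.
  induction n as [|n IH]; [simpl; rewrite Rmult_0_l; apply exp_0|].
  rewrite S_INR, Rmult_plus_distr_r, exp_plus, IH, Rmult_1_l. simpl. ring.
Qed.

Lemma e_geom n tau z Q B :
  (0 <= Q)%R -> (exp (- (2 * PI) * Im tau) <= Q)%R -> (exp (- (2 * PI) * Im z) <= B)%R ->
  (Cmod (cexp (two_pi_i * (RtoC (INR n) * tau + z))) <= B * Q ^ n)%R.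
Proof.
  intros PQ HQ HB. rewrite Cmod_e.
  replace (- (2 * PI) * Im (RtoC (INR n) * tau + z))%R with
    (- (2 * PI) * Im z + INR n * (- (2 * PI) * Im tau))%R by (unfold Im; simpl; ring).
  rewrite exp_plus.
  rewrite exp_INR_mult. apply Rmult_le_compat; [left; apply exp_pos|apply pow_le; left; apply exp_pos|exact HB|].
  apply pow_incr. split; [left; apply exp_pos|exact HQ].
Qed.

Lemma q_lt_1 y : (0 < y)%R -> (0 <= exp (- (2 * PI) * y) < 1)%R.
Proof.
  intros Hy. split; [left; apply exp_pos|]. rewrite <- exp_0. apply exp_increasing.
  pose proof PI_RGT_0. nra.
Qed.

Lemma exp_le x y : (x <= y)%R -> (exp x <= exp y)%R.
Proof. intros [H|H]; [left; now apply exp_increasing|right; now rewrite H]. Qed.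

Lemma poly_bound_c (c : nat -> C) :
  (forall n, c n = 1) \/ (forall n, c n = RtoC (INR n)) \/ (forall n, c n = RtoC (INR (S n))) ->
  forall n, (Cmod (c n) <= INR (S n))%R.
Proof.
  intros H n. pose proof (pos_INR n).
  destruct H as [H|[H|H]]; rewrite H, ?Cmod_1, ?Cmod_R, ?Rabs_pos_eq; rewrite ?S_INR; lra.
Qed.

Section LambertZT.
Variables (c : nat -> C) (z tau : C).
Hypothesis Hoff : off_lattice z tau.
Hypothesis Hc : forall n, (Cmod (c n) <= INR (S n))%R.

Lemma INR_S_ge_1 n : (1 <= INR (S n))%R.
Proof. rewrite S_INR. pose proof (pos_INR n). lra. Qed.

Lemma lambert_loc_diff_z : loc_diff (fun w => lambert c w tau) z.
Proof.
  pose proof (proj1 Hoff) as Ht.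
  assert (PT : (0 <= Cmod two_pi_i)%R) by apply Cmod_ge_0.
  eapply loc_diff_ext;
    [|apply (lambert_loc_diff (fun _ => two_pi_i) (fun n => two_pi_i * (RtoC (INR n) * tau)) z 1
      (exp (- (2 * PI) * (Im z - 1))) (exp (- (2 * PI) * Im tau))) with (c := c) (A := (Cmod two_pi_i + 1)%R)].
  - intros w. unfold lambert. apply CSeries_ext. intros n. do 3 f_equal. ring.
  - lra.
  - now apply q_lt_1.
  - intros n w Hw.
    replace (two_pi_i * w + two_pi_i * (RtoC (INR n) * tau)) with (two_pi_i * (RtoC (INR n) * tau + w)) by ring.
    apply e_geom; [left; apply exp_pos|lra|]. apply exp_le.
    apply Im_le_sub in Hw. pose proof PI_RGT_0. nra.
  - intros n. replace (two_pi_i * z + two_pi_i * (RtoC (INR n) * tau)) with (two_pi_i * (RtoC (INR n) * tau + z)) by ring.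
    now apply off_lattice_e.
  - intros n. pose proof (INR_S_ge_1 n). nra.
  - intros n. specialize (Hc n). pose proof (INR_S_ge_1 n). nra.
Qed.

Lemma lambert_loc_diff_tau : loc_diff (fun t => lambert c z t) tau.
Proof.
  pose proof (proj1 Hoff) as Ht.
  assert (PT : (0 <= Cmod two_pi_i)%R) by apply Cmod_ge_0.
  eapply loc_diff_ext;
    [|apply (lambert_loc_diff (fun n => two_pi_i * RtoC (INR n)) (fun n => two_pi_i * z) tau (Im tau / 2)
      (exp (- (2 * PI) * Im z)) (exp (- (2 * PI) * (Im tau / 2)))) with (c := c) (A := (Cmod two_pi_i + 1)%R)].
  - intros w. unfold lambert. apply CSeries_ext. intros n. do 3 f_equal. ring.
  - lra.
  - apply q_lt_1; lra.
  - intros n w Hw.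
    replace (two_pi_i * RtoC (INR n) * w + two_pi_i * z) with (two_pi_i * (RtoC (INR n) * w + z)) by ring.
    apply e_geom; [left; apply exp_pos| |lra]. apply exp_le.
    apply Im_le_sub in Hw. pose proof PI_RGT_0. nra.
  - intros n. replace (two_pi_i * RtoC (INR n) * tau + two_pi_i * z) with (two_pi_i * (RtoC (INR n) * tau + z)) by ring.
    now apply off_lattice_e.
  - intros n. rewrite Cmod_mult, Cmod_R, Rabs_pos_eq by apply pos_INR. rewrite S_INR. pose proof (pos_INR n). nra.
  - intros n. specialize (Hc n). pose proof (INR_S_ge_1 n). nra.
Qed.

(** Here the argument [t - z] moves with [t] too, so the slope of the [n]-th exponent is
    [2 pi i (n + 1)]. *)
Lemma lambert_reflect_loc_diff_tau : loc_diff (fun t => lambert c (t - z) t) tau.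
Proof.
  pose proof (proj1 Hoff) as Ht.
  assert (PT : (0 <= Cmod two_pi_i)%R) by apply Cmod_ge_0.
  eapply loc_diff_ext;
    [|apply (lambert_loc_diff (fun n => two_pi_i * RtoC (INR (S n))) (fun n => - two_pi_i * z) tau (Im tau / 2)
      (exp (- (2 * PI) * (Im tau / 2 - Im z))) (exp (- (2 * PI) * (Im tau / 2)))) with (c := c) (A := (Cmod two_pi_i + 1)%R)].
  - intros w. unfold lambert. apply CSeries_ext. intros n. do 3 f_equal. rewrite S_INR, RtoC_plus. ring.
  - lra.
  - apply q_lt_1; lra.
  - intros n w Hw.
    replace (two_pi_i * RtoC (INR (S n)) * w + - two_pi_i * z) with (two_pi_i * (RtoC (INR n) * w + (w - z)))
      by (rewrite S_INR, RtoC_plus; ring).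
    apply Im_le_sub in Hw. pose proof PI_RGT_0.
    apply e_geom; [left; apply exp_pos|apply exp_le; nra|]. apply exp_le.
    replace (Im (w - z)) with (Im w - Im z)%R by (unfold Im; simpl; ring). nra.
  - intros n. replace (two_pi_i * RtoC (INR (S n)) * tau + - two_pi_i * z) with (two_pi_i * (RtoC (INR n) * tau + (tau - z)))
      by (rewrite S_INR, RtoC_plus; ring).
    apply off_lattice_e. now apply off_lattice_reflect.
  - intros n. rewrite Cmod_mult, Cmod_R, Rabs_pos_eq by apply pos_INR. pose proof (INR_S_ge_1 n). nra.
  - intros n. specialize (Hc n). pose proof (INR_S_ge_1 n). nra.
Qed.

End LambertZT.

Lemma fzzz_loc_diff z tau : off_lattice z tau ->
  loc_diff (fun w => fzzz w tau) z /\ loc_diff (fun t => fzzz z t) tau.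
Proof.
  intros H. assert (Hc : forall n : nat, (Cmod ((fun _ => 1) n) <= INR (S n))%R) by (apply poly_bound_c; auto).
  split.
  - eapply loc_diff_ext with (f := fun w => RtoC (/2) + lambert (fun _ => 1) w tau + RtoC (-1) * lambert (fun _ => 1) (tau - w) tau).
    { intros w. unfold fzzz. ring. }
    apply loc_diff_plus; [apply loc_diff_plus; [apply loc_diff_const|]|apply loc_diff_scal].
    + now apply lambert_loc_diff_z.
    + apply (loc_diff_reflect tau (fun w => lambert (fun _ => 1) w tau)), lambert_loc_diff_z; [now apply off_lattice_reflect|exact Hc].
  - eapply loc_diff_ext with (f := fun t => RtoC (/2) + lambert (fun _ => 1) z t + RtoC (-1) * lambert (fun _ => 1) (t - z) t).
    { intros w. unfold fzzz. ring. }
    apply loc_diff_plus; [apply loc_diff_plus; [apply loc_diff_const|]|apply loc_diff_scal].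
    + now apply lambert_loc_diff_tau.
    + now apply lambert_reflect_loc_diff_tau.
Qed.

Lemma fzzt_loc_diff z tau : off_lattice z tau ->
  loc_diff (fun w => fzzt w tau) z /\ loc_diff (fun t => fzzt z t) tau.
Proof.
  intros H.
  assert (Hc : forall n : nat, (Cmod ((fun n => RtoC (INR n)) n) <= INR (S n))%R) by (apply poly_bound_c; auto).
  assert (Hc' : forall n : nat, (Cmod ((fun n => RtoC (INR (S n))) n) <= INR (S n))%R) by (apply poly_bound_c; auto).
  split; unfold fzzt.
  - apply loc_diff_plus; [apply loc_diff_plus; [apply loc_diff_const|]|].
    + now apply (lambert_loc_diff_z (fun n => RtoC (INR n))).
    + apply (loc_diff_reflect tau (fun w => lambert (fun n => RtoC (INR (S n))) w tau)), lambert_loc_diff_z; [now apply off_lattice_reflect|exact Hc'].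
  - apply loc_diff_plus; [apply loc_diff_plus; [apply loc_diff_const|]|].
    + now apply (lambert_loc_diff_tau (fun n => RtoC (INR n))).
    + now apply (lambert_reflect_loc_diff_tau (fun n => RtoC (INR (S n)))).
Qed.

(** * Double power series *)

Lemma quad_diff_weaken p r f f' K L :
  quad_diff p r f f' K -> (K <= L)%R -> quad_diff p r f f' L.
Proof.
  intros H HKL w w' Hw Hw'. eapply Rle_trans; [now apply H|].
  apply Rmult_le_compat_r; [apply pow2_ge_0|exact HKL].
Qed.

Lemma quad_diff_Dsum p r (f f' : nat -> nat -> C -> C) B y :
  (0 <= y < 1)%R ->
  (forall j k, quad_diff p r (f j k) (f' j k) (B * y ^ j * y ^ k)) ->
  (forall w, (Cmod (w - p) < r)%R -> geom_dom B y (fun j k => f j k w)) ->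
  (forall w, (Cmod (w - p) < r)%R -> geom_dom B y (fun j k => f' j k w)) ->
  quad_diff p r (fun w => Dsum (fun j k => f j k w)) (fun w => Dsum (fun j k => f' j k w))
    (B * / (1 - y) * / (1 - y)).
Proof.
  intros Hy H Hf Hf'.
  apply quad_diff_series with (f := fun j w => CSeries (fun k => f j k w))
    (f' := fun j w => CSeries (fun k => f' j k w)) (K := fun j => (B * / (1 - y) * y ^ j)%R).
  - intros j. apply quad_diff_weaken with (K := (B * y ^ j * / (1 - y))%R); [|right; ring].
    apply quad_diff_series with (f := f j) (f' := f' j) (K := fun k => (B * y ^ j * y ^ k)%R).
    + apply H.
    + intros w Hw. apply (geom_dom_inner B y (fun j k => f j k w) j Hy (Hf w Hw)).
    + intros w Hw. apply (geom_dom_inner B y (fun j k => f' j k w) j Hy (Hf' w Hw)).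
    + now apply is_series_geom_B.
  - intros w Hw. apply (geom_dom_outer B y (fun j k => f j k w) Hy (Hf w Hw)).
  - intros w Hw. apply (geom_dom_outer B y (fun j k => f' j k w) Hy (Hf' w Hw)).
  - now apply is_series_geom_B.
Qed.

(** The Taylor bound [j (j - 1) / 2 * s^(j - 2)], weakened to [j^2 s^(j - 2)] and multiplied by
    [s^2] to keep the exponent a natural number for small [j]. *)
Lemma pow_quad (s : R) (u u' : C) (j : nat) :
  (0 < s)%R -> (Cmod u <= s)%R -> (Cmod u' <= s)%R ->
  (s ^ 2 * Cmod (u' ^ j - u ^ j - RtoC (INR j) * u ^ (pred j) * (u' - u)) <=
    INR j ^ 2 * s ^ j * Cmod (u' - u) ^ 2)%R.
Proof.
  intros Hs Hu Hu'. induction j as [|j IH].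
  - simpl. replace (1 - 1 - 0 * 1 * (u' - u)) with (RtoC 0) by ring. rewrite Cmod_0. lra.
  - set (d := u' - u) in *. pose proof (Cmod_ge_0 d) as Pd.
    assert (E : u' ^ S j - u ^ S j - RtoC (INR (S j)) * u ^ pred (S j) * d =
      u' * (u' ^ j - u ^ j - RtoC (INR j) * u ^ pred j * d) + RtoC (INR j) * u ^ pred j * (d * d)).
    { rewrite S_INR, RtoC_plus. unfold d. destruct j as [|j]; simpl; ring. }
    rewrite E. set (q := u' ^ j - u ^ j - RtoC (INR j) * u ^ pred j * d) in *.
    pose proof (Cmod_triangle (u' * q) (RtoC (INR j) * u ^ pred j * (d * d))) as T.
    rewrite !Cmod_mult, Cmod_R, Rabs_pos_eq, Cmod_pow in T by apply pos_INR.
    pose proof (Cmod_ge_0 q) as Pq. pose proof (pos_INR j) as Pj.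
    assert (Ps : (0 < s ^ 2)%R) by (apply pow_lt; lra).
    assert (Psj : (0 < s ^ j)%R) by (apply pow_lt; lra).
    assert (A1 : (s ^ 2 * (Cmod u' * Cmod q) <= s * (INR j ^ 2 * s ^ j * Cmod d ^ 2))%R).
    { replace (s ^ 2 * (Cmod u' * Cmod q))%R with (Cmod u' * (s ^ 2 * Cmod q))%R by ring.
      apply Rmult_le_compat; auto using Cmod_ge_0. apply Rmult_le_pos; lra. }
    assert (A2 : (INR j * (s * Cmod u ^ pred j) <= INR j * s ^ j)%R).
    { destruct j as [|j]; [simpl; lra|]. apply Rmult_le_compat_l; [exact Pj|].
      simpl pred. rewrite <- tech_pow_Rmult. apply Rmult_le_compat_l; [lra|].
      apply pow_incr. split; [apply Cmod_ge_0|exact Hu]. }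
    assert (A3 : (s ^ 2 * (INR j * Cmod u ^ pred j * (Cmod d * Cmod d)) <= s * (INR j * s ^ j * Cmod d ^ 2))%R).
    { replace (s ^ 2 * (INR j * Cmod u ^ pred j * (Cmod d * Cmod d)))%R with
        (INR j * (s * Cmod u ^ pred j) * (s * Cmod d ^ 2))%R by ring.
      replace (s * (INR j * s ^ j * Cmod d ^ 2))%R with (INR j * s ^ j * (s * Cmod d ^ 2))%R by ring.
      apply Rmult_le_compat_r; [|exact A2]. apply Rmult_le_pos; [lra|apply pow2_ge_0]. }
    apply Rle_trans with (s ^ 2 * (Cmod u' * Cmod q + INR j * Cmod u ^ pred j * (Cmod d * Cmod d)))%R.
    { apply Rmult_le_compat_l; lra. }
    rewrite S_INR. replace (s ^ S j)%R with (s * s ^ j)%R by reflexivity.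
    assert (A4 : (0 <= (INR j + 1) * (s * s ^ j * Cmod d ^ 2))%R).
    { apply Rmult_le_pos; [lra|]. apply Rmult_le_pos; [apply Rmult_le_pos; lra|apply pow2_ge_0]. }
    nra.
Qed.

(** Boundedness of the terms at all smaller radii is what remains of absolute convergence on the
    open polydisc. It involves only the coefficients and survives termwise differentiation. *)
Definition coef_bound (R1 R2 : R) (a : nat -> nat -> C) : Prop :=
  forall s1 s2, (0 < s1 < R1)%R -> (0 < s2 < R2)%R ->
  exists M, forall j k, (Cmod (a j k) * s1 ^ j * s2 ^ k <= M)%R.

Definition dpseries (a : nat -> nat -> C) (u v : C) : C :=
  Dsum (fun j k => a j k * u ^ j * v ^ k).

(** The working form of [analytic_on]: the sum is an iterated series instead of a limit of squares,
    and the class is closed under both partial derivatives. *)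
Definition ser_on (P : polydisc) (g : C -> C -> C) : Prop :=
  exists a, coef_bound (rad_z P) (rad_tau P) a /\
    forall z tau, in_polydisc P z tau -> g z tau = dpseries a (z - ctr_z P) (tau - ctr_tau P).

(** Bounded terms at the larger radii [s1] and [s2] decay geometrically at [t1] and [t2], with
    ratios [t1 / s1] and [t2 / s2]. *)
Lemma coef_geom R1 R2 a t1 t2 : coef_bound R1 R2 a ->
  (0 < t1 < R1)%R -> (0 < t2 < R2)%R ->
  exists M x, (0 <= M)%R /\ (0 <= x < 1)%R /\
    forall j k, (Cmod (a j k) * t1 ^ j * t2 ^ k <= M * x ^ j * x ^ k)%R.
Proof.
  intros H H1 H2.
  set (s1 := ((t1 + R1) / 2)%R). set (s2 := ((t2 + R2) / 2)%R).
  assert (Hs1 : (t1 < s1 < R1)%R) by (unfold s1; lra).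
  assert (Hs2 : (t2 < s2 < R2)%R) by (unfold s2; lra).
  destruct (H s1 s2 ltac:(lra) ltac:(lra)) as [M HM].
  assert (PM : (0 <= M)%R).
  { specialize (HM O O). simpl in HM. pose proof (Cmod_ge_0 (a O O)). lra. }
  set (x := Rmax (t1 / s1) (t2 / s2)).
  assert (X1 : (0 <= t1 / s1 < 1)%R).
  { split; [apply Rmult_le_pos; [lra|left; apply Rinv_0_lt_compat; lra]|apply Rlt_div_l; lra]. }
  assert (X2 : (0 <= t2 / s2 < 1)%R).
  { split; [apply Rmult_le_pos; [lra|left; apply Rinv_0_lt_compat; lra]|apply Rlt_div_l; lra]. }
  pose proof (Rmax_l (t1 / s1) (t2 / s2)) as L1. pose proof (Rmax_r (t1 / s1) (t2 / s2)) as L2.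
  fold x in L1, L2.
  exists M, x. split; [exact PM|]. split.
  { split; [lra|]. unfold x. apply Rmax_lub_lt; lra. }
  intros j k. specialize (HM j k).
  assert (E1 : (t1 ^ j = s1 ^ j * (t1 / s1) ^ j)%R) by (rewrite <- Rpow_mult_distr; f_equal; field; lra).
  assert (E2 : (t2 ^ k = s2 ^ k * (t2 / s2) ^ k)%R) by (rewrite <- Rpow_mult_distr; f_equal; field; lra).
  rewrite E1, E2.
  replace (Cmod (a j k) * (s1 ^ j * (t1 / s1) ^ j) * (s2 ^ k * (t2 / s2) ^ k))%R with
    ((Cmod (a j k) * s1 ^ j * s2 ^ k) * ((t1 / s1) ^ j * (t2 / s2) ^ k))%R by ring.
  rewrite (Rmult_assoc M).
  assert (0 <= (t1 / s1) ^ j)%R by (apply pow_le; lra).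
  assert (0 <= (t2 / s2) ^ k)%R by (apply pow_le; lra).
  apply Rmult_le_compat; [|now apply Rmult_le_pos|exact HM|].
  - repeat apply Rmult_le_pos; try apply Cmod_ge_0; apply pow_le; lra.
  - apply Rmult_le_compat; auto; apply pow_incr; lra.
Qed.

Lemma sum_n_term_le (b : nat -> R) (j N : nat) :
  (forall n, (0 <= b n)%R) -> (j <= N)%nat -> (b j <= sum_n b N)%R.
Proof.
  intros Hb. induction N as [|N IH]; intros Hj.
  - replace j with O by lia. rewrite sum_O. lra.
  - rewrite sum_Sn. unfold plus; simpl. destruct (Nat.eq_dec j (S N)) as [->|].
    + assert (0 <= sum_n b N)%R; [|lra]. clear -Hb. induction N as [|N IH].
      * now rewrite sum_O.
      * rewrite sum_Sn. unfold plus; simpl. specialize (Hb (S N)). lra.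
    + specialize (IH ltac:(lia)). specialize (Hb (S N)). lra.
Qed.

Lemma sum_n_nonneg (b : nat -> R) N : (forall n, (0 <= b n)%R) -> (0 <= sum_n b N)%R.
Proof.
  intros Hb. eapply Rle_trans; [apply (Hb O)|]. apply sum_n_term_le; [exact Hb|lia].
Qed.

Lemma filterlim_Clim (u : nat -> C) (l : C) :
  filterlim u eventually (locally (T := C_UniformSpace) l) -> Clim u l.
Proof.
  intros H. apply is_lim_seq_spec. intros eps.
  apply (H (fun y => (Rabs (Cmod (y - l) - 0) < eps)%R)).
  apply locally_C. exists eps. intros y Hy.
  rewrite Rminus_0_r, Rabs_pos_eq by apply Cmod_ge_0. exact Hy.
Qed.

Lemma Dsum_Clim B x t l : (0 <= x < 1)%R -> geom_dom B x t ->
  filterlim (fun N : nat => sum_n (fun j => sum_n (fun k => t j k) N) N)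
      eventually (locally (T := C_UniformSpace) l) -> l = Dsum t.
Proof.
  intros Hx H Hl. eapply Clim_unique; [apply filterlim_Clim; exact Hl|].
  now apply (Dsum_square B x t).
Qed.

Lemma coef_geom_dom a u v t1 t2 M x :
  (forall j k, (Cmod (a j k) * t1 ^ j * t2 ^ k <= M * x ^ j * x ^ k)%R) ->
  (Cmod u <= t1)%R -> (Cmod v <= t2)%R -> geom_dom M x (fun j k => a j k * u ^ j * v ^ k).
Proof.
  intros H Hu Hv j k. rewrite !Cmod_mult, !Cmod_pow.
  pose proof (Cmod_ge_0 u). pose proof (Cmod_ge_0 v). pose proof (Cmod_ge_0 (a j k)).
  eapply Rle_trans; [|apply H].
  apply Rmult_le_compat.
  - apply Rmult_le_pos; [assumption|now apply pow_le].
  - now apply pow_le.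
  - apply Rmult_le_compat_l; [assumption|]. apply pow_incr; auto.
  - apply pow_incr; auto.
Qed.

Lemma dpseries_geom_dom R1 R2 a u v : coef_bound R1 R2 a -> (Cmod u < R1)%R -> (Cmod v < R2)%R ->
  exists M x, (0 <= x < 1)%R /\ geom_dom M x (fun j k => a j k * u ^ j * v ^ k).
Proof.
  intros H Hu Hv. pose proof (Cmod_ge_0 u). pose proof (Cmod_ge_0 v).
  destruct (coef_geom _ _ a ((Cmod u + R1) / 2) ((Cmod v + R2) / 2) H) as [M [x [_ [Hx HM]]]]; [lra|lra|].
  exists M, x. split; [exact Hx|]. apply (coef_geom_dom _ _ _ _ _ _ _ HM); lra.
Qed.

Lemma analytic_ser_on P g : analytic_on P g -> ser_on P g.
Proof.
  intros [a Ha]. assert (HC : coef_bound (rad_z P) (rad_tau P) a).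
  { intros s1 s2 H1 H2.
    assert (E1 : Cmod (RtoC s1) = s1) by (rewrite Cmod_R, Rabs_pos_eq; lra).
    assert (E2 : Cmod (RtoC s2) = s2) by (rewrite Cmod_R, Rabs_pos_eq; lra).
    (* At this point the moduli of the terms are exactly [|a j k| s1^j s2^k], and each of them is at
       most a square sum of such moduli. *)
    destruct (Ha (ctr_z P + RtoC s1) (ctr_tau P + RtoC s2)) as [[M HM] _].
    - split.
      + replace (ctr_z P + RtoC s1 - ctr_z P) with (RtoC s1) by ring. rewrite E1. apply H1.
      + replace (ctr_tau P + RtoC s2 - ctr_tau P) with (RtoC s2) by ring. rewrite E2. apply H2.
    - exists M. intros j k. eapply Rle_trans; [|apply (HM (Nat.max j k))].
      replace (ctr_z P + RtoC s1 - ctr_z P) with (RtoC s1) by ring.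
      replace (ctr_tau P + RtoC s2 - ctr_tau P) with (RtoC s2) by ring.
      set (N := Nat.max j k). set (b := fun j k => Cmod (a j k * RtoC s1 ^ j * RtoC s2 ^ k)).
      apply Rle_trans with (b j k).
      + right. unfold b. now rewrite !Cmod_mult, !Cmod_pow, E1, E2.
      + eapply Rle_trans; [apply (sum_n_term_le (b j) k N)|].
        * intros n; apply Cmod_ge_0.
        * unfold N; lia.
        * apply (sum_n_term_le (fun j => sum_n (b j) N) j N).
          -- intros n; apply sum_n_nonneg. intros; apply Cmod_ge_0.
          -- unfold N; lia. }
  exists a. split; [exact HC|]. intros z tau Hin.
  destruct (Ha z tau Hin) as [_ Hl].
  destruct (dpseries_geom_dom _ _ a _ _ HC (proj1 Hin) (proj2 Hin)) as [M [x [Hx HM]]].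
  exact (Dsum_Clim M x _ _ Hx HM Hl).
Qed.

Definition swap_polydisc (P : polydisc) : polydisc :=
  Polydisc (ctr_tau P) (ctr_z P) (rad_tau P) (rad_z P).

Lemma coef_bound_swap R1 R2 a : coef_bound R1 R2 a -> coef_bound R2 R1 (fun j k => a k j).
Proof.
  intros H s1 s2 H1 H2. destruct (H s2 s1 H2 H1) as [M HM]. exists M. intros j k.
  eapply Rle_trans; [|apply (HM k j)]. right; ring.
Qed.

(** Exchanging the variables reduces differentiation in [tau] to differentiation in [z]. *)
Lemma ser_on_swap P g : ser_on P g -> ser_on (swap_polydisc P) (fun t z => g z t).
Proof.
  intros [a [HC Hg]]. exists (fun j k => a k j). split; [now apply coef_bound_swap|].
  intros tau z [Ht Hz]. simpl in *. rewrite Hg by (split; assumption).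
  destruct (dpseries_geom_dom _ _ a _ _ HC Hz Ht) as [M [x [Hx HM]]].
  unfold dpseries. rewrite (Dsum_swap M x _ Hx HM).
  apply CSeries_ext; intros j. apply CSeries_ext; intros k. ring.
Qed.

Definition dz_coef (a : nat -> nat -> C) (j k : nat) : C := RtoC (INR (S j)) * a (S j) k.

Lemma coef_bound_dz R1 R2 a : coef_bound R1 R2 a -> coef_bound R1 R2 (dz_coef a).
Proof.
  intros H s1 s2 H1 H2. destruct (coef_geom _ _ a s1 s2 H H1 H2) as [M [x [PM [Hx HM]]]].
  destruct (poly_geom 1 x Hx) as [B [y [PB [Hy HB]]]].
  exists (M * / s1 * B)%R. intros j k. unfold dz_coef.
  rewrite Cmod_mult, Cmod_R, Rabs_pos_eq by apply pos_INR.
  specialize (HM (S j) k). specialize (HB j).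
  assert (PN : (0 <= INR (S j))%R) by apply pos_INR.
  assert (Xj : (0 <= x ^ j)%R) by (apply pow_le; lra).
  assert (Xk : (0 <= x ^ k <= 1)%R) by (split; [apply pow_le; lra|rewrite <- (pow1 k); apply pow_incr; lra]).
  assert (Yj : (y ^ j <= 1)%R) by (rewrite <- (pow1 j); apply pow_incr; lra).
  replace (INR (S j) * Cmod (a (S j) k) * s1 ^ j * s2 ^ k)%R with
    (INR (S j) * / s1 * (Cmod (a (S j) k) * s1 ^ S j * s2 ^ k))%R by (simpl pow; field; lra).
  assert (Is : (0 <= / s1)%R) by (left; apply Rinv_0_lt_compat; lra).
  apply Rle_trans with (INR (S j) * / s1 * (M * x ^ S j * x ^ k))%R.
  { apply Rmult_le_compat_l; [now apply Rmult_le_pos|exact HM]. }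
  assert (A1 : (x ^ S j * x ^ k <= x ^ j)%R).
  { simpl. apply Rle_trans with (1 * x ^ j * 1)%R; [|lra].
    apply Rmult_le_compat; try lra; try (apply Rmult_le_pos; lra). apply Rmult_le_compat_r; lra. }
  apply Rle_trans with (M * / s1 * (INR (S j) ^ 1 * x ^ j))%R.
  { replace (INR (S j) * / s1 * (M * x ^ S j * x ^ k))%R with (M * / s1 * (INR (S j) * (x ^ S j * x ^ k)))%R by ring.
    rewrite pow_1. apply Rmult_le_compat_l; [now apply Rmult_le_pos|]. now apply Rmult_le_compat_l. }
  apply Rmult_le_compat_l; [now apply Rmult_le_pos|]. eapply Rle_trans; [exact HB|]. nra.
Qed.

Lemma dpseries_diff R1 R2 a c w v :
  coef_bound R1 R2 a -> (Cmod (w - c) < R1)%R -> (Cmod v < R2)%R ->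
  loc_quad (fun z => dpseries a (z - c) v) (fun z => dpseries (dz_coef a) (z - c) v) w.
Proof.
  intros HC Hw Hv. pose proof (Cmod_ge_0 (w - c)) as Pw. pose proof (Cmod_ge_0 v) as Pv.
  set (t1 := ((Cmod (w - c) + R1) / 2)%R). set (t2 := ((Cmod v + R2) / 2)%R).
  assert (Ht1 : (Cmod (w - c) < t1 < R1)%R) by (unfold t1; lra).
  assert (Ht2 : (Cmod v < t2 < R2)%R) by (unfold t2; lra).
  destruct (coef_geom _ _ a t1 t2 HC) as [M [x [PM [Hx HM]]]]; [lra|lra|].
  destruct (poly_geom 2 x Hx) as [B [y [PB [Hy HB]]]].
  set (r := (t1 - Cmod (w - c))%R). assert (Pr : (0 < r)%R) by (unfold r; lra).
  (* The terms of the series, of its derivative and of the error carry the factors 1, [/ t1] and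
     [/ t1 ^ 2]; [I] dominates all three. *)
  set (I := (/ t1 + / t1 ^ 2 + 1)%R).
  assert (I1 : (0 < / t1)%R) by (apply Rinv_0_lt_compat; lra).
  assert (I2 : (0 < / t1 ^ 2)%R) by (apply Rinv_0_lt_compat, pow_lt; lra).
  assert (PI1 : (1 <= I)%R) by (unfold I; lra).
  set (A := (M * B * I)%R).
  assert (Din : forall z, (Cmod (z - w) < r)%R -> (Cmod (z - c) <= t1)%R).
  { intros z Hz. replace (z - c) with ((z - w) + (w - c)) by ring.
    eapply Rle_trans; [apply Cmod_triangle|]. unfold r in Hz. lra. }
  set (f := fun (j k : nat) z => a j k * (z - c) ^ j * v ^ k).
  (* Indexed like [f], with a vanishing row [j = 0], so that the two series can be compared term by
     term; the row is dropped at the end to reach [dz_coef]. *)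
  set (f' := fun (j k : nat) z => a j k * (RtoC (INR j) * (z - c) ^ pred j) * v ^ k).
  assert (Bd : forall j k e i, (e <= 2)%nat -> (0 <= i <= I)%R ->
    (INR j ^ e * i * (Cmod (a j k) * t1 ^ j * Cmod v ^ k) <= A * y ^ j * y ^ k)%R).
  { intros j k e i He Hi. specialize (HM j k). specialize (HB j).
    pose proof (pos_INR j) as Pj. pose proof (Cmod_ge_0 (a j k)) as Pa.
    assert (Pt : (0 <= t1 ^ j)%R) by (apply pow_le; lra).
    assert (V1 : (Cmod v ^ k <= t2 ^ k)%R) by (apply pow_incr; lra).
    assert (V0 : (0 <= Cmod v ^ k)%R) by (now apply pow_le).
    assert (X0 : (0 <= x ^ j)%R) by (apply pow_le; lra).
    assert (X1 : (0 <= x ^ k)%R) by (apply pow_le; lra).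
    assert (X2 : (x ^ k <= y ^ k)%R) by (apply pow_incr; lra).
    assert (Y0 : (0 <= y ^ j)%R) by (apply pow_le; lra).
    assert (J : (INR j ^ e <= INR (S j) ^ 2)%R).
    { apply Rle_trans with (INR (S j) ^ e)%R.
      - apply pow_incr. rewrite S_INR. lra.
      - apply Rle_pow; [rewrite S_INR; lra|lia]. }
    assert (J0 : (0 <= INR j ^ e)%R) by (now apply pow_le).
    assert (C1 : (Cmod (a j k) * t1 ^ j * Cmod v ^ k <= M * x ^ j * x ^ k)%R).
    { eapply Rle_trans; [|exact HM]. apply Rmult_le_compat_l; [now apply Rmult_le_pos|exact V1]. }
    apply Rle_trans with (INR (S j) ^ 2 * I * (M * x ^ j * x ^ k))%R.
    - apply Rmult_le_compat; [apply Rmult_le_pos; lra|repeat apply Rmult_le_pos; auto| |exact C1].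
      apply Rmult_le_compat; lra.
    - replace (INR (S j) ^ 2 * I * (M * x ^ j * x ^ k))%R with (I * M * ((INR (S j) ^ 2 * x ^ j) * x ^ k))%R by ring.
      replace (A * y ^ j * y ^ k)%R with (I * M * ((B * y ^ j) * y ^ k))%R by (unfold A; ring).
      apply Rmult_le_compat_l; [apply Rmult_le_pos; lra|].
      apply Rmult_le_compat; auto. apply Rmult_le_pos; [apply pow2_ge_0|exact X0]. }
  assert (Gf : forall z, (Cmod (z - w) < r)%R -> geom_dom A y (fun j k => f j k z)).
  { intros z Hz j k. specialize (Bd j k O 1%R ltac:(lia) ltac:(lra)). unfold f.
    rewrite !Cmod_mult, !Cmod_pow. eapply Rle_trans; [|exact Bd]. simpl. rewrite !Rmult_1_l.
    apply Rmult_le_compat_r; [now apply pow_le|]. apply Rmult_le_compat_l; [apply Cmod_ge_0|].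
    apply pow_incr. split; [apply Cmod_ge_0|now apply Din]. }
  assert (Gf' : forall z, (Cmod (z - w) < r)%R -> geom_dom A y (fun j k => f' j k z)).
  { intros z Hz j k. specialize (Bd j k 1%nat (/ t1)%R ltac:(lia) ltac:(unfold I; lra)). unfold f'.
    rewrite !Cmod_mult, !Cmod_pow, Cmod_R, Rabs_pos_eq by apply pos_INR. eapply Rle_trans; [|exact Bd].
    rewrite pow_1.
    replace (INR j * / t1 * (Cmod (a j k) * t1 ^ j * Cmod v ^ k))%R with
      (Cmod (a j k) * (INR j * (/ t1 * t1 ^ j)) * Cmod v ^ k)%R by ring.
    apply Rmult_le_compat_r; [now apply pow_le|]. apply Rmult_le_compat_l; [apply Cmod_ge_0|].
    destruct j as [|j]; [simpl; lra|]. apply Rmult_le_compat_l; [apply pos_INR|].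
    replace (/ t1 * t1 ^ S j)%R with (t1 ^ j)%R by (simpl; field; lra).
    apply pow_incr. split; [apply Cmod_ge_0|now apply Din]. }
  assert (Q : quad_diff w r (fun z => Dsum (fun j k => f j k z)) (fun z => Dsum (fun j k => f' j k z))
    (A * / (1 - y) * / (1 - y))).
  { apply quad_diff_Dsum; [lra| |exact Gf|exact Gf'].
    intros j k z z' Hz Hz'.
    specialize (Bd j k 2%nat (/ t1 ^ 2)%R ltac:(lia) ltac:(unfold I; lra)).
    pose proof (pow_quad t1 (z - c) (z' - c) j ltac:(lra) (Din z Hz) (Din z' Hz')) as H.
    replace (z' - c - (z - c)) with (z' - z) in H by ring.
    set (q := (z' - c) ^ j - (z - c) ^ j - RtoC (INR j) * (z - c) ^ pred j * (z' - z)) in *.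
    replace (f j k z' - f j k z - f' j k z * (z' - z)) with (a j k * v ^ k * q) by (unfold f, f', q; ring).
    rewrite !Cmod_mult, Cmod_pow.
    assert (H' : (Cmod q <= INR j ^ 2 * / t1 ^ 2 * t1 ^ j * Cmod (z' - z) ^ 2)%R).
    { apply Rmult_le_reg_l with (t1 ^ 2)%R; [apply pow_lt; lra|].
      eapply Rle_trans; [exact H|]. right. field. lra. }
    apply Rle_trans with (Cmod (a j k) * Cmod v ^ k * (INR j ^ 2 * / t1 ^ 2 * t1 ^ j * Cmod (z' - z) ^ 2))%R.
    - apply Rmult_le_compat_l; [|exact H']. apply Rmult_le_pos; [apply Cmod_ge_0|now apply pow_le].
    - replace (Cmod (a j k) * Cmod v ^ k * (INR j ^ 2 * / t1 ^ 2 * t1 ^ j * Cmod (z' - z) ^ 2))%R with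
        (INR j ^ 2 * / t1 ^ 2 * (Cmod (a j k) * t1 ^ j * Cmod v ^ k) * Cmod (z' - z) ^ 2)%R by ring.
      apply Rmult_le_compat_r; [apply pow2_ge_0|exact Bd]. }
  exists r, (A * / (1 - y) * / (1 - y))%R. split; [exact Pr|].
  eapply quad_diff_ext; [| |exact Q].
  - reflexivity.
  - intros z Hz. symmetry. unfold dpseries, Dsum.
    pose proof (geom_dom_outer A y _ ltac:(lra) (Gf' z Hz)) as H.
    pose proof (csum_incr_1 _ _ H) as H0. simpl in H0.
    assert (Z0 : CSeries (fun k => f' O k z) = 0).
    { transitivity (CSeries (fun _ => 0)); [|apply csum_unique, csum_zero].
      apply CSeries_ext. intros k. unfold f'. simpl. ring. }
    rewrite Z0 in H0. apply csum_unique in H0.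
    replace (Dsum (fun j k => f' j k z) - 0) with (Dsum (fun j k => f' j k z)) in H0 by ring.
    unfold Dsum in H0. rewrite <- H0. apply CSeries_ext; intros j. apply CSeries_ext; intros k.
    unfold f', dz_coef. simpl pred. ring.
Qed.

(** [C_derive] is a total function built from limits along the horizontal line through [z], so local
    equality suffices and differentiability need not be known. Iterated derivatives can thus be
    rewritten on open sets. *)
Lemma C_derive_ext_loc (f g : C -> C) z r : (0 < r)%R ->
  (forall w, (Cmod (w - z) < r)%R -> f w = g w) -> C_derive f z = C_derive g z.
Proof.
  intros Hr E. unfold C_derive, C_lim.
  assert (Ez : f z = g z) by (apply E; replace (z - z) with (RtoC 0) by ring; rewrite Cmod_0; lra).
  assert (L : forall x : R, (Rabs (x - fst z) < r)%R -> f (x, snd z) = g (x, snd z)).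
  { intros x Hx. apply E. replace ((x, snd z) - z) with (RtoC (x - fst z)).
    - now rewrite Cmod_R.
    - apply C_eq; unfold Re, Im; simpl; ring. }
  f_equal; f_equal; apply Lim_ext_loc; exists (mkposreal r Hr); intros x Hx _;
    rewrite L, Ez by exact Hx; reflexivity.
Qed.

Lemma quad_diff_C_derive p r f f' K : (0 < r)%R -> quad_diff p r f f' K -> C_derive f p = f' p.
Proof.
  intros Hr H. apply is_C_derive_unique. eapply quad_diff_is_derive; [exact H|].
  replace (p - p) with (RtoC 0) by ring. rewrite Cmod_0. lra.
Qed.

Definition open2 (U : C -> C -> Prop) : Prop :=
  forall z tau, U z tau -> exists r, (0 < r)%R /\
    forall w t, (Cmod (w - z) < r)%R -> (Cmod (t - tau) < r)%R -> U w t.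

Lemma open2_C_derive_z U f g : open2 U -> (forall z tau, U z tau -> f z tau = g z tau) ->
  forall z tau, U z tau -> C_derive (fun w => f w tau) z = C_derive (fun w => g w tau) z.
Proof.
  intros HU E z tau H. destruct (HU z tau H) as [r [Hr Hb]].
  apply (C_derive_ext_loc _ _ _ r Hr). intros w Hw. apply E, Hb; [exact Hw|now apply Cmod_diag].
Qed.

Lemma open2_C_derive_tau U f g : open2 U -> (forall z tau, U z tau -> f z tau = g z tau) ->
  forall z tau, U z tau -> C_derive (f z) tau = C_derive (g z) tau.
Proof.
  intros HU E z tau H. destruct (HU z tau H) as [r [Hr Hb]].
  apply (C_derive_ext_loc _ _ _ r Hr). intros w Hw. apply E, Hb; [now apply Cmod_diag|exact Hw].
Qed.

Lemma open2_polydisc P : open2 (in_polydisc P).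
Proof.
  intros z tau [Hz Ht].
  exists (Rmin (rad_z P - Cmod (z - ctr_z P)) (rad_tau P - Cmod (tau - ctr_tau P))).
  split; [apply Rmin_pos; lra|]. intros w t Hw Htt.
  pose proof (Rmin_l (rad_z P - Cmod (z - ctr_z P)) (rad_tau P - Cmod (tau - ctr_tau P))).
  pose proof (Rmin_r (rad_z P - Cmod (z - ctr_z P)) (rad_tau P - Cmod (tau - ctr_tau P))).
  split.
  - replace (w - ctr_z P) with ((w - z) + (z - ctr_z P)) by ring.
    eapply Rle_lt_trans; [apply Cmod_triangle|lra].
  - replace (t - ctr_tau P) with ((t - tau) + (tau - ctr_tau P)) by ring.
    eapply Rle_lt_trans; [apply Cmod_triangle|lra].
Qed.

Lemma ser_on_dz P g : ser_on P g ->
  ser_on P (fun z tau => C_derive (fun w => g w tau) z) /\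
  forall z tau, in_polydisc P z tau -> loc_diff (fun w => g w tau) z.
Proof.
  intros [a [HC Hg]].
  assert (D : forall z tau, in_polydisc P z tau ->
    loc_quad (fun w => g w tau) (fun w => dpseries (dz_coef a) (w - ctr_z P) (tau - ctr_tau P)) z).
  { intros z tau Hin. destruct (dpseries_diff _ _ a (ctr_z P) z (tau - ctr_tau P) HC (proj1 Hin) (proj2 Hin))
      as [r [K [Hr HQ]]].
    destruct (open2_polydisc P _ _ Hin) as [r' [Hr' Hsl]].
    exists (Rmin r r'), K. split; [now apply Rmin_pos|].
    eapply quad_diff_ext; [| |eapply quad_diff_shrink; [exact HQ|apply Rmin_l]].
    - intros w Hw. symmetry. apply Hg, Hsl; [|now apply Cmod_diag].
      eapply Rlt_le_trans; [exact Hw|apply Rmin_r].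
    - reflexivity. }
  split.
  - exists (dz_coef a). split; [now apply coef_bound_dz|].
    intros z tau Hin. destruct (D z tau Hin) as [r [K [Hr HQ]]].
    apply (quad_diff_C_derive _ _ _ _ _ Hr HQ).
  - intros z tau Hin. destruct (D z tau Hin) as [r [K [Hr HQ]]]. eexists. exists r, K. split; [exact Hr|exact HQ].
Qed.

Lemma swap_polydisc_in P z tau : in_polydisc P z tau <-> in_polydisc (swap_polydisc P) tau z.
Proof. unfold in_polydisc; simpl; tauto. Qed.

Lemma ser_on_dtau P g : ser_on P g ->
  ser_on P (fun z tau => C_derive (g z) tau) /\
  forall z tau, in_polydisc P z tau -> loc_diff (g z) tau.
Proof.
  intros H. destruct (ser_on_dz _ _ (ser_on_swap _ _ H)) as [H1 H2]. split.
  - apply ser_on_swap in H1. destruct P as [c1 c2 r1 r2]. exact H1.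
  - intros z tau Hin. apply (H2 tau z). now apply swap_polydisc_in in Hin.
Qed.

Lemma ser_on_partial P g : ser_on P g -> ser_on P (partial 3 0 g) /\ ser_on P (partial 2 1 g).
Proof.
  intros H. split.
  - exact (proj1 (ser_on_dz _ _ (proj1 (ser_on_dz _ _ (proj1 (ser_on_dz _ _ H)))))).
  - exact (proj1 (ser_on_dz _ _ (proj1 (ser_on_dz _ _ (proj1 (ser_on_dtau _ _ H)))))).
Qed.

(** * The third derivatives in the strip *)

Lemma loc_quad_affine a b p : loc_quad (fun w => a * w + b) (fun _ => a) p.
Proof. exists 1%R, 0%R. split; [lra|apply quad_diff_affine]. Qed.

Lemma loc_quad_sqr p : loc_quad (fun w => w ^ 2) (fun w => 2 * w) p.
Proof.
  exists 1%R, 1%R. split; [lra|]. intros w w' _ _.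
  replace (w' ^ 2 - w ^ 2 - 2 * w * (w' - w)) with ((w' - w) ^ 2) by ring.
  rewrite Cmod_pow. lra.
Qed.

Lemma loc_quad_cube p : loc_quad (fun w => w ^ 3) (fun w => 3 * w ^ 2) p.
Proof.
  exists 1%R, (3 * (Cmod p + 1))%R. split; [lra|]. intros w w' Hw Hw'.
  replace (w' ^ 3 - w ^ 3 - 3 * w ^ 2 * (w' - w)) with ((w' + (w + w)) * (w' - w) ^ 2) by ring.
  rewrite Cmod_mult, Cmod_pow. apply Rmult_le_compat_r; [apply pow2_ge_0|].
  assert (B : forall v, (Cmod (v - p) < 1)%R -> (Cmod v <= Cmod p + 1)%R).
  { intros v Hv. replace v with ((v - p) + p) by ring. eapply Rle_trans; [apply Cmod_triangle|]. lra. }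
  pose proof (B w Hw). pose proof (B w' Hw').
  pose proof (Cmod_triangle w' (w + w)). pose proof (Cmod_triangle w w). lra.
Qed.

Lemma loc_quad_C_derive f f' p : loc_quad f f' p -> C_derive f p = f' p.
Proof. intros [r [K [Hr H]]]. eapply quad_diff_C_derive; eauto. Qed.

(** The derivative is obtained as a formula on all of [P], so it can be fed into the next stage of
    an iterated derivative. *)
Lemma C_derive_stage_z P f h h' :
  (forall z tau, in_polydisc P z tau -> f z tau = h z tau) ->
  (forall z tau, in_polydisc P z tau -> loc_quad (fun w => h w tau) (fun w => h' w tau) z) ->
  forall z tau, in_polydisc P z tau -> C_derive (fun w => f w tau) z = h' z tau.
Proof.
  intros E D z tau Hin. rewrite (open2_C_derive_z _ _ h (open2_polydisc P) E z tau Hin).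
  now apply (loc_quad_C_derive _ (fun w => h' w tau)), D.
Qed.

Lemma C_derive_stage_tau P f h h' :
  (forall z tau, in_polydisc P z tau -> f z tau = h z tau) ->
  (forall z tau, in_polydisc P z tau -> loc_quad (h z) (h' z) tau) ->
  forall z tau, in_polydisc P z tau -> C_derive (f z) tau = h' z tau.
Proof.
  intros E D z tau Hin. rewrite (open2_C_derive_tau _ _ h (open2_polydisc P) E z tau Hin).
  now apply loc_quad_C_derive, D.
Qed.

(** * Double series of exponentials with polynomially bounded coefficients *)

Definition poly_bounded (i j : nat) (c : nat -> nat -> C) : Prop :=
  exists A, (0 <= A)%R /\ forall n k, (Cmod (c n k) <= A * (INR (S n) ^ i * INR (S k) ^ j))%R.

Lemma poly_bounded_geom i j c x : poly_bounded i j c -> (0 <= x < 1)%R ->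
  exists B y, (0 <= y < 1)%R /\
    forall n k, (Cmod (c n k) * (x ^ n * x ^ k) <= B * y ^ n * y ^ k)%R.
Proof.
  intros [A [PA HA]] Hx.
  destruct (poly_geom i x Hx) as [B1 [y1 [PB1 [Hy1 H1]]]].
  destruct (poly_geom j x Hx) as [B2 [y2 [PB2 [Hy2 H2]]]].
  set (y := Rmax y1 y2). pose proof (Rmax_l y1 y2) as M1. pose proof (Rmax_r y1 y2) as M2.
  fold y in M1, M2. assert (Hy : (0 <= y < 1)%R).
  { split; [lra|]. unfold y. apply Rmax_lub_lt; lra. }
  exists (A * B1 * B2)%R, y. split; [exact Hy|]. intros n k.
  assert (Y1 : (y1 ^ n <= y ^ n)%R) by (apply pow_incr; lra).
  assert (Y2 : (y2 ^ k <= y ^ k)%R) by (apply pow_incr; lra).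
  assert (Q1 : (B1 * y1 ^ n <= B1 * y ^ n)%R) by (apply Rmult_le_compat_l; auto).
  assert (Q2 : (B2 * y2 ^ k <= B2 * y ^ k)%R) by (apply Rmult_le_compat_l; auto).
  specialize (H1 n). specialize (H2 k).
  apply Rle_trans with (A * (INR (S n) ^ i * INR (S k) ^ j) * (x ^ n * x ^ k))%R.
  - apply Rmult_le_compat_r; [apply Rmult_le_pos; apply pow_le; lra|apply HA].
  - replace (A * (INR (S n) ^ i * INR (S k) ^ j) * (x ^ n * x ^ k))%R with
      (A * ((INR (S n) ^ i * x ^ n) * (INR (S k) ^ j * x ^ k)))%R by ring.
    replace (A * B1 * B2 * y ^ n * y ^ k)%R with (A * ((B1 * y ^ n) * (B2 * y ^ k)))%R by ring.
    apply Rmult_le_compat_l; [exact PA|].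
    apply Rmult_le_compat; try lra; apply Rmult_le_pos; apply pow_le; auto using pos_INR; lra.
Qed.

Lemma exp_dsum_diff i j (c l m : nat -> nat -> C) p r x :
  poly_bounded i j c -> poly_bounded 1 1 l -> (0 < r)%R -> (0 <= x < 1)%R ->
  (forall n k w, (Cmod (w - p) < r)%R -> (Cmod (cexp (l n k * w + m n k)) <= x ^ n * x ^ k)%R) ->
  loc_quad (fun w => Dsum (fun n k => c n k * cexp (l n k * w + m n k)))
           (fun w => Dsum (fun n k => c n k * (l n k * cexp (l n k * w + m n k)))) p.
Proof.
  intros [A [PA HA]] [L [PL HL]] Hr Hx HE.
  (* One sequence dominating the coefficients of the series, of its derivative and of the error:
     [|c|], [|c| |l|] and [4 |c| |l|^2]. *)
  set (b := fun n k => RtoC (4 * (Cmod (c n k) * (1 + Cmod (l n k)) ^ 2))).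
  assert (NL : forall n k, (0 <= Cmod (l n k))%R) by (intros; apply Cmod_ge_0).
  assert (NC : forall n k, (0 <= Cmod (c n k) * (1 + Cmod (l n k)) ^ 2)%R).
  { intros. apply Rmult_le_pos; [apply Cmod_ge_0|apply pow2_ge_0]. }
  assert (Hb : poly_bounded (i + 2) (j + 2) b).
  { exists (4 * A * (1 + L) ^ 2)%R. split; [apply Rmult_le_pos; [lra|apply pow2_ge_0]|].
    intros n k. specialize (HA n k). specialize (HL n k). rewrite !pow_1 in HL.
    pose proof (INR_S_ge_1 n) as Nn. pose proof (INR_S_ge_1 k) as Nk.
    unfold b. rewrite Cmod_R, Rabs_pos_eq by (specialize (NC n k); lra).
    set (N := INR (S n)) in *. set (K := INR (S k)) in *.
    replace (4 * A * (1 + L) ^ 2 * (N ^ (i + 2) * K ^ (j + 2)))%R with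
      (4 * (A * (N ^ i * K ^ j) * ((1 + L) * (N * K)) ^ 2))%R by (rewrite !pow_add; ring).
    apply Rmult_le_compat_l; [lra|]. apply Rmult_le_compat; auto using Cmod_ge_0, pow2_ge_0.
    apply pow_incr. specialize (NL n k). split; [lra|]. nra. }
  destruct (poly_bounded_geom _ _ b x Hb Hx) as [D [y [Hy HD]]].
  assert (Key : forall n k e, (e <= 2)%nat ->
    (4 * (Cmod (c n k) * Cmod (l n k) ^ e * (x ^ n * x ^ k)) <= D * y ^ n * y ^ k)%R).
  { intros n k e He. eapply Rle_trans; [|apply HD]. unfold b.
    rewrite Cmod_R, Rabs_pos_eq by (specialize (NC n k); lra). rewrite <- Rmult_assoc.
    apply Rmult_le_compat_r; [apply Rmult_le_pos; apply pow_le; lra|].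
    apply Rmult_le_compat_l; [lra|]. apply Rmult_le_compat_l; [apply Cmod_ge_0|].
    specialize (NL n k). apply Rle_trans with ((1 + Cmod (l n k)) ^ e)%R.
    - apply pow_incr. lra.
    - apply Rle_pow; [lra|lia]. }
  assert (PX : forall n k, (0 <= x ^ n * x ^ k)%R) by (intros; apply Rmult_le_pos; apply pow_le; lra).
  exists r, (D * / (1 - y) * / (1 - y))%R. split; [exact Hr|].
  apply quad_diff_Dsum with (f := fun n k w => c n k * cexp (l n k * w + m n k))
    (f' := fun n k w => c n k * (l n k * cexp (l n k * w + m n k))); [exact Hy| | |].
  - intros n k. eapply quad_diff_weaken; [apply quad_diff_scal, cexp_quad_diff; intros w Hw; apply (HE n k w Hw)|].
    eapply Rle_trans; [|apply (Key n k 2%nat); lia]. right; ring.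
  - intros w Hw n k. pose proof (Key n k O ltac:(lia)) as H. simpl pow in H at 1. rewrite Rmult_1_r in H.
    rewrite Cmod_mult. pose proof (HE n k w Hw) as H3. pose proof (Cmod_ge_0 (c n k)).
    assert (Cmod (c n k) * Cmod (cexp (l n k * w + m n k)) <= Cmod (c n k) * (x ^ n * x ^ k))%R
      by (now apply Rmult_le_compat_l).
    assert (0 <= Cmod (c n k) * (x ^ n * x ^ k))%R by (apply Rmult_le_pos; auto). lra.
  - intros w Hw n k. pose proof (Key n k 1%nat ltac:(lia)) as H. rewrite pow_1 in H.
    rewrite Cmult_assoc, !Cmod_mult. pose proof (HE n k w Hw) as H3.
    assert (P1 : (0 <= Cmod (c n k) * Cmod (l n k))%R) by (apply Rmult_le_pos; apply Cmod_ge_0).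
    assert (Cmod (c n k) * Cmod (l n k) * Cmod (cexp (l n k * w + m n k)) <= Cmod (c n k) * Cmod (l n k) * (x ^ n * x ^ k))%R
      by (now apply Rmult_le_compat_l).
    assert (0 <= Cmod (c n k) * Cmod (l n k) * (x ^ n * x ^ k))%R by (apply Rmult_le_pos; auto). lra.
Qed.

(* With [c n k = 1 / (k + 1)^3] this is the first series of Li_3(zeta, q); the
   second one is obtained at [tau - z]. *)
Definition expsum (c : nat -> nat -> C) (z tau : C) : C :=
  Dsum (fun n k => c n k * cexp (two_pi_i * (RtoC (INR (S k)) * (RtoC (INR n) * tau + z)))).

(** The exponent grows like [(k + 1) (n + 1) d]; it is weakened to [(n + k) d] in order to fit the
    product form of [geom_dom]. *)
Lemma expsum_term_bound d z tau n k : (0 < d)%R -> (d <= Im z)%R -> (d <= Im tau)%R ->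
  (Cmod (cexp (two_pi_i * (RtoC (INR (S k)) * (RtoC (INR n) * tau + z)))) <=
    exp (- (2 * PI) * d) ^ n * exp (- (2 * PI) * d) ^ k)%R.
Proof.
  intros Hd Hz Ht. rewrite Cmod_e.
  rewrite <- !exp_INR_mult, <- exp_plus. apply exp_le.
  replace (Im (RtoC (INR (S k)) * (RtoC (INR n) * tau + z))) with (INR (S k) * (INR n * Im tau + Im z))%R
    by (unfold Im; simpl; ring).
  rewrite S_INR. pose proof (pos_INR n). pose proof (pos_INR k). pose proof PI_RGT_0.
  assert (A1 : (INR n * d + d <= INR n * Im tau + Im z)%R) by nra.
  assert (A2 : (INR n * d + INR k * d <= (INR k + 1) * (INR n * Im tau + Im z))%R).
  { apply Rle_trans with ((INR k + 1) * (INR n * d + d))%R; [|apply Rmult_le_compat_l; lra].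
    assert (0 <= INR k * INR n * d)%R by (repeat apply Rmult_le_pos; lra). nra. }
  nra.
Qed.

(** The factors produced by differentiating a term of [expsum]: [mulk] in [z], [muln] in [tau], and
    [mulSn] in [tau] when the argument is [tau - z]. *)
Definition mulk (c : nat -> nat -> C) (n k : nat) : C := c n k * (two_pi_i * RtoC (INR (S k))).
Definition muln (c : nat -> nat -> C) (n k : nat) : C :=
  c n k * (two_pi_i * RtoC (INR (S k)) * RtoC (INR n)).
Definition mulSn (c : nat -> nat -> C) (n k : nat) : C :=
  c n k * (two_pi_i * RtoC (INR (S k)) * RtoC (INR (S n))).

Lemma poly_bounded_lin (l : nat -> nat -> C) (a : C) (i j : nat) c :
  poly_bounded i j c ->
  (forall n k, (Cmod (l n k) <= Cmod a * (INR (S n) * INR (S k)))%R) ->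
  poly_bounded (S i) (S j) (fun n k => c n k * l n k).
Proof.
  intros [A [PA H]] Hl. exists (A * Cmod a)%R. split; [apply Rmult_le_pos; [lra|apply Cmod_ge_0]|].
  intros n k. rewrite Cmod_mult.
  replace (A * Cmod a * (INR (S n) ^ S i * INR (S k) ^ S j))%R with
    (A * (INR (S n) ^ i * INR (S k) ^ j) * (Cmod a * (INR (S n) * INR (S k))))%R
    by (rewrite <- !tech_pow_Rmult; ring).
  apply Rmult_le_compat; auto using Cmod_ge_0.
Qed.

Lemma two_pi_i_k_bound n k :
  (Cmod (two_pi_i * RtoC (INR (S k))) <= Cmod two_pi_i * (INR (S n) * INR (S k)))%R.
Proof.
  rewrite Cmod_mult, Cmod_R, Rabs_pos_eq by apply pos_INR.
  apply Rmult_le_compat_l; [apply Cmod_ge_0|]. pose proof (INR_S_ge_1 n). pose proof (INR_S_ge_1 k). nra.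
Qed.

Lemma two_pi_i_kn_bound n k i : (i <= S n)%nat ->
  (Cmod (two_pi_i * RtoC (INR (S k)) * RtoC (INR i)) <= Cmod two_pi_i * (INR (S n) * INR (S k)))%R.
Proof.
  intros Hi. apply le_INR in Hi.
  rewrite !Cmod_mult, !Cmod_R, !Rabs_pos_eq by apply pos_INR. rewrite Rmult_assoc.
  apply Rmult_le_compat_l; [apply Cmod_ge_0|]. rewrite Rmult_comm.
  apply Rmult_le_compat_r; [apply pos_INR|exact Hi].
Qed.

Lemma poly_bounded_mulk i j c : poly_bounded i j c -> poly_bounded (S i) (S j) (mulk c).
Proof. intros H. apply (poly_bounded_lin _ two_pi_i _ _ _ H). intros; apply two_pi_i_k_bound. Qed.

Lemma poly_bounded_muln i j c : poly_bounded i j c -> poly_bounded (S i) (S j) (muln c).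
Proof. intros H. apply (poly_bounded_lin _ two_pi_i _ _ _ H). intros; apply two_pi_i_kn_bound; lia. Qed.

Lemma poly_bounded_mulSn i j c : poly_bounded i j c -> poly_bounded (S i) (S j) (mulSn c).
Proof. intros H. apply (poly_bounded_lin _ two_pi_i _ _ _ H). intros; apply two_pi_i_kn_bound; lia. Qed.

Lemma poly_bounded_11 (l : nat -> nat -> C) :
  (forall n k, (Cmod (l n k) <= Cmod two_pi_i * (INR (S n) * INR (S k)))%R) -> poly_bounded 1 1 l.
Proof.
  intros H. exists (Cmod two_pi_i). split; [apply Cmod_ge_0|]. intros n k. rewrite !pow_1. apply H.
Qed.

Lemma Dsum_ext t u : (forall n k, t n k = u n k) -> Dsum t = Dsum u.
Proof. intros E. apply CSeries_ext; intros n. apply CSeries_ext; intros k. apply E. Qed.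

Section ExpsumDiff.
Variables (i j : nat) (c : nat -> nat -> C).
Hypothesis Hc : poly_bounded i j c.

Lemma expsum_diff_z z tau : (0 < Im z)%R -> (0 < Im tau)%R ->
  loc_quad (fun w => expsum c w tau) (fun w => expsum (mulk c) w tau) z.
Proof.
  intros Hz Ht. set (d := Rmin (Im z / 2) (Im tau)).
  assert (Hd1 : (d <= Im z / 2)%R) by apply Rmin_l. assert (Hd2 : (d <= Im tau)%R) by apply Rmin_r.
  assert (Pd : (0 < d)%R) by (apply Rmin_pos; lra).
  eapply loc_quad_ext; [| |apply (exp_dsum_diff i j c (fun n k => two_pi_i * RtoC (INR (S k)))
    (fun n k => two_pi_i * RtoC (INR (S k)) * (RtoC (INR n) * tau)) z (Im z / 2) (exp (- (2 * PI) * d)) Hc)].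
  - intros w. apply Dsum_ext; intros n k. do 2 f_equal. ring.
  - intros w. apply Dsum_ext; intros n k. unfold mulk. rewrite Cmult_assoc. do 2 f_equal. ring.
  - apply poly_bounded_11. apply two_pi_i_k_bound.
  - lra.
  - now apply q_lt_1.
  - intros n k w Hw. apply Im_le_sub in Hw.
    replace (two_pi_i * RtoC (INR (S k)) * w + two_pi_i * RtoC (INR (S k)) * (RtoC (INR n) * tau)) with
      (two_pi_i * (RtoC (INR (S k)) * (RtoC (INR n) * tau + w))) by ring.
    apply expsum_term_bound; lra.
Qed.

Lemma expsum_reflect_diff_z z tau : (0 < Im (tau - z))%R -> (0 < Im tau)%R ->
  loc_quad (fun w => expsum c (tau - w) tau) (fun w => - expsum (mulk c) (tau - w) tau) z.
Proof.
  intros Hz Ht. apply (loc_quad_reflect tau (fun w => expsum c w tau) (fun w => expsum (mulk c) w tau)).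
  now apply expsum_diff_z.
Qed.

Lemma expsum_diff_tau z tau : (0 < Im z)%R -> (0 < Im tau)%R ->
  loc_quad (fun t => expsum c z t) (fun t => expsum (muln c) z t) tau.
Proof.
  intros Hz Ht. set (d := Rmin (Im z) (Im tau / 2)).
  assert (Hd1 : (d <= Im z)%R) by apply Rmin_l. assert (Hd2 : (d <= Im tau / 2)%R) by apply Rmin_r.
  assert (Pd : (0 < d)%R) by (apply Rmin_pos; lra).
  eapply loc_quad_ext; [| |apply (exp_dsum_diff i j c (fun n k => two_pi_i * RtoC (INR (S k)) * RtoC (INR n))
    (fun n k => two_pi_i * RtoC (INR (S k)) * z) tau (Im tau / 2) (exp (- (2 * PI) * d)) Hc)].
  - intros w. apply Dsum_ext; intros n k. do 2 f_equal. ring.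
  - intros w. apply Dsum_ext; intros n k. unfold muln. rewrite Cmult_assoc. do 2 f_equal. ring.
  - apply poly_bounded_11. intros; apply two_pi_i_kn_bound; lia.
  - lra.
  - now apply q_lt_1.
  - intros n k w Hw. apply Im_le_sub in Hw.
    replace (two_pi_i * RtoC (INR (S k)) * RtoC (INR n) * w + two_pi_i * RtoC (INR (S k)) * z) with
      (two_pi_i * (RtoC (INR (S k)) * (RtoC (INR n) * w + z))) by ring.
    apply expsum_term_bound; lra.
Qed.

Lemma expsum_reflect_diff_tau z tau : (0 < Im (tau - z))%R -> (0 < Im tau)%R ->
  loc_quad (fun t => expsum c (t - z) t) (fun t => expsum (mulSn c) (t - z) t) tau.
Proof.
  intros Hz Ht. set (r := (Rmin (Im (tau - z)) (Im tau) / 2)%R).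
  assert (Hd1 : (2 * r <= Im (tau - z))%R) by (unfold r; pose proof (Rmin_l (Im (tau - z)) (Im tau)); lra).
  assert (Hd2 : (2 * r <= Im tau)%R) by (unfold r; pose proof (Rmin_r (Im (tau - z)) (Im tau)); lra).
  assert (Pd : (0 < r)%R) by (pose proof (Rmin_pos _ _ Hz Ht); unfold r; lra).
  eapply loc_quad_ext; [| |apply (exp_dsum_diff i j c (fun n k => two_pi_i * RtoC (INR (S k)) * RtoC (INR (S n)))
    (fun n k => - (two_pi_i * RtoC (INR (S k)) * z)) tau r (exp (- (2 * PI) * r)) Hc)].
  - intros w. apply Dsum_ext; intros n k. do 2 f_equal. rewrite (S_INR n), RtoC_plus. ring.
  - intros w. apply Dsum_ext; intros n k. unfold mulSn. rewrite Cmult_assoc. do 2 f_equal.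
    rewrite (S_INR n), RtoC_plus. ring.
  - apply poly_bounded_11. intros; apply two_pi_i_kn_bound; lia.
  - lra.
  - now apply q_lt_1.
  - intros n k w Hw. apply Im_le_sub in Hw.
    replace (two_pi_i * RtoC (INR (S k)) * RtoC (INR (S n)) * w + - (two_pi_i * RtoC (INR (S k)) * z)) with
      (two_pi_i * (RtoC (INR (S k)) * (RtoC (INR n) * w + (w - z)))) by (rewrite (S_INR n), RtoC_plus; ring).
    assert (E1 : Im (tau - z) = (Im tau - Im z)%R) by (unfold Im; simpl; ring).
    assert (E2 : Im (w - z) = (Im w - Im z)%R) by (unfold Im; simpl; ring).
    apply expsum_term_bound; lra.
Qed.

End ExpsumDiff.

Lemma expsum_geom_dom i j c z tau : poly_bounded i j c -> (0 < Im z)%R -> (0 < Im tau)%R ->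
  exists B y, (0 <= y < 1)%R /\
    geom_dom B y (fun n k => c n k * cexp (two_pi_i * (RtoC (INR (S k)) * (RtoC (INR n) * tau + z)))).
Proof.
  intros Hc Hz Ht. pose proof (Rmin_pos _ _ Hz Ht) as Pd.
  destruct (poly_bounded_geom i j c _ Hc (q_lt_1 _ Pd)) as [B [y [Hy H]]].
  exists B, y. split; [exact Hy|]. intros n k. rewrite Cmod_mult.
  eapply Rle_trans; [|apply H]. apply Rmult_le_compat_l; [apply Cmod_ge_0|].
  apply expsum_term_bound; [exact Pd|apply Rmin_l|apply Rmin_r].
Qed.

(** Once convergence is known, the sum follows from the functional equation [s - x = x s]. *)
Lemma csum_geom_series x : (Cmod x < 1)%R -> is_csum (fun k => x ^ S k) (Lx x).
Proof.
  intros Hx. pose proof (Cmod_ge_0 x) as Px.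
  assert (H : is_csum (fun k => x ^ S k) (CSeries (fun k => x ^ S k))).
  { apply csum_geom_ex with (B := Cmod x) (x := Cmod x); [lra|].
    intros n. rewrite Cmod_pow. simpl. lra. }
  set (s := CSeries (fun k => x ^ S k)) in *.
  assert (E : s - x ^ 1 = x * s).
  { pose proof (csum_unique _ _ (csum_incr_1 _ _ H)) as E1.
    pose proof (csum_unique _ _ (csum_scal x _ _ H)) as E2.
    rewrite <- E1, <- E2. apply CSeries_ext. intros n. simpl. ring. }
  assert (N : 1 - x <> 0).
  { apply Cmod_gt_0. pose proof (Cmod_triangle (1 - x) x) as T.
    replace (1 - x + x) with (RtoC 1) in T by ring. rewrite Cmod_1 in T. lra. }
  assert (E' : s = Lx x).
  { unfold Lx. transitivity (((s - x ^ 1) - x * s + x) / (1 - x)).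
    - field. exact N.
    - rewrite E. field. exact N. }
  now rewrite <- E'.
Qed.

Lemma cexp_mult_S k w : cexp (two_pi_i * (RtoC (INR (S k)) * w)) = cexp (two_pi_i * w) ^ S k.
Proof. rewrite <- cexp_INR. f_equal. ring. Qed.

Lemma e_lt_1 w : (0 < Im w)%R -> (Cmod (cexp (two_pi_i * w)) < 1)%R.
Proof.
  intros H. rewrite Cmod_e. apply (q_lt_1 _ H).
Qed.

Lemma Im_shift_pos n z tau : (0 < Im z)%R -> (0 < Im tau)%R -> (0 < Im (RtoC (INR n) * tau + z))%R.
Proof.
  intros Hz Ht. replace (Im (RtoC (INR n) * tau + z)) with (INR n * Im tau + Im z)%R by (unfold Im; simpl; ring).
  pose proof (pos_INR n). nra.
Qed.

(** For [0 < Im z] the double series of exponentials converges absolutely; its rows are geometric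
    series and sum to the Lambert summands. *)
Lemma lambert_csum (c : nat -> C) z tau :
  (forall n, (Cmod (c n) <= INR (S n))%R) -> (0 < Im z)%R -> (0 < Im tau)%R ->
  is_csum (fun n => c n * Lx (cexp (two_pi_i * (RtoC (INR n) * tau + z)))) (lambert c z tau).
Proof.
  intros Hc Hz Ht.
  assert (Pc : poly_bounded 1 0 (fun n _ => c n)).
  { exists 1%R. split; [lra|]. intros n k. specialize (Hc n). rewrite pow_1, pow_O. lra. }
  destruct (expsum_geom_dom _ _ _ z tau Pc Hz Ht) as [B [y [Hy G]]].
  assert (E : forall n, CSeries (fun k => c n * cexp (two_pi_i * (RtoC (INR (S k)) * (RtoC (INR n) * tau + z)))) =
    c n * Lx (cexp (two_pi_i * (RtoC (INR n) * tau + z)))).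
  { intros n. apply csum_unique. apply csum_scal.
    eapply csum_ext; [|apply csum_geom_series, e_lt_1, Im_shift_pos; eassumption].
    intros k. simpl. symmetry. apply cexp_mult_S. }
  pose proof (geom_dom_outer B y _ Hy G) as H.
  replace (lambert c z tau) with (Dsum (fun n k => c n * cexp (two_pi_i * (RtoC (INR (S k)) * (RtoC (INR n) * tau + z))))).
  - eapply csum_ext; [|exact H]. exact E.
  - apply CSeries_ext. exact E.
Qed.

(** Three derivatives bring out the cube of [k + 1], which cancels [c3]. The remaining coefficients
    are free of [k], and the inner sum is geometric. *)
Lemma expsum_lambert a (c : nat -> C) z tau :
  (forall n, (Cmod (c n) <= INR (S n))%R) -> (0 < Im z)%R -> (0 < Im tau)%R ->
  expsum (fun n _ => a * c n) z tau = a * lambert c z tau.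
Proof.
  intros Hc Hz Ht. symmetry. unfold expsum, Dsum.
  rewrite <- (csum_unique _ _ (csum_scal a _ _ (lambert_csum c z tau Hc Hz Ht))).
  apply CSeries_ext. intros n. symmetry. rewrite Cmult_assoc. apply csum_unique. apply csum_scal.
  eapply csum_ext; [|apply csum_geom_series, e_lt_1, Im_shift_pos; eassumption].
  intros k. simpl. symmetry. apply cexp_mult_S.
Qed.

Definition c3 (n k : nat) : C := / RtoC (INR (S k)) ^ 3.

Lemma RtoC_INR_S_neq_0 k : RtoC (INR (S k)) <> 0.
Proof.
  intros E. injection E as E. pose proof (INR_S_ge_1 k) as H. rewrite S_INR in H. simpl in E.
  change (INR (S k) = 0%R) in E. rewrite S_INR in E. lra.
Qed.

Lemma c3_bounded : poly_bounded 0 0 c3.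
Proof.
  exists 1%R. split; [lra|]. intros n k. unfold c3.
  rewrite Cmod_inv by (apply Cpow_nz, RtoC_INR_S_neq_0).
  rewrite Cmod_pow, Cmod_R, Rabs_pos_eq by apply pos_INR. simpl (_ ^ 0)%R.
  rewrite !Rmult_1_l. rewrite <- Rinv_1. apply Rinv_le_contravar; [lra|].
  rewrite <- (pow1 3). apply pow_incr. pose proof (INR_S_ge_1 k). lra.
Qed.

Lemma Li3_sum_expsum z tau :
  CSeries (fun n => Li3 (cexp (two_pi_i * tau) ^ n * cexp (two_pi_i * z))) = expsum c3 z tau.
Proof.
  apply CSeries_ext. intros n. apply CSeries_ext. intros k.
  rewrite cexp_mult_S. unfold c3.
  replace (cexp (two_pi_i * (RtoC (INR n) * tau + z))) with (cexp (two_pi_i * tau) ^ n * cexp (two_pi_i * z)).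
  - unfold Cdiv. ring.
  - rewrite <- cexp_INR, <- cexp_add. f_equal. ring.
Qed.

Lemma Li3_sum_reflect_expsum z tau :
  CSeries (fun n => Li3 (cexp (two_pi_i * tau) ^ S n * / cexp (two_pi_i * z))) = expsum c3 (tau - z) tau.
Proof.
  rewrite <- Li3_sum_expsum. apply CSeries_ext. intros n. f_equal.
  rewrite <- cexp_opp. replace (two_pi_i * (tau - z)) with (two_pi_i * tau + - (two_pi_i * z)) by ring.
  rewrite cexp_add. simpl. ring.
Qed.

Lemma bernoulli_1 : bernoulli 1 = (- / 2)%R.
Proof. unfold bernoulli. simpl. field. Qed.
Lemma bernoulli_2 : bernoulli 2 = (/ 6)%R.
Proof. unfold bernoulli. simpl. field. Qed.
Lemma bernoulli_3 : bernoulli 3 = 0%R.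
Proof. unfold bernoulli. simpl. field. Qed.

Lemma two_pi_i_neq_0 : two_pi_i <> 0.
Proof.
  unfold two_pi_i. intros E. apply (f_equal Im) in E. unfold Im in E; simpl in E.
  pose proof PI_RGT_0. lra.
Qed.

(** At [z = 0] the row [n = 0] has no geometric decay in [k]. It is split off as the constant
    [Li3 1], which differentiation removes; the other rows form [expsum] at [tau]. *)
Lemma Li3_q0 tau : (0 < Im tau)%R ->
  CSeries (fun n => Li3 (cexp (two_pi_i * tau) ^ n * cexp (two_pi_i * 0))) =
    Li3 1 + expsum c3 tau tau.
Proof.
  intros Ht. replace (two_pi_i * 0) with (RtoC 0) by ring. rewrite cexp_0.
  apply csum_unique. replace (Li3 1) with (Li3 (cexp (two_pi_i * tau) ^ 0 * 1)) by (f_equal; simpl; ring).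
  apply (csum_decr_1 (fun n => Li3 (cexp (two_pi_i * tau) ^ n * 1))).
  destruct (expsum_geom_dom _ _ _ tau tau c3_bounded Ht Ht) as [B [y [Hy G]]].
  eapply csum_ext; [|apply (geom_dom_outer B y _ Hy G)].
  intros n. cbv beta. apply CSeries_ext. intros k. rewrite cexp_mult_S. unfold c3.
  replace (cexp (two_pi_i * (RtoC (INR n) * tau + tau))) with (cexp (two_pi_i * tau) * cexp (two_pi_i * tau) ^ n * 1).
  - replace (cexp (two_pi_i * tau) ^ S n * 1) with (cexp (two_pi_i * tau) * cexp (two_pi_i * tau) ^ n * 1) by (simpl; ring).
    unfold Cdiv. ring.
  - replace (two_pi_i * (RtoC (INR n) * tau + tau)) with (RtoC (INR n) * (two_pi_i * tau) + two_pi_i * tau) by ring.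
    rewrite cexp_add, cexp_INR. ring.
Qed.

(** The Bernoulli terms with [j = 0, 1] give [z^3 / 12 - z^2 tau / 24], the source of the constants
    1/2 and -1/12 in the closed forms; the term with [j = 2] vanishes. At [z = 0] the two series
    agree up to [Li3 1], whence the factor [- 2]; [tau - 0] is kept so that the derivative of the
    reflected series applies with [z = 0]. *)
Lemma f_strip_expsum z tau : (0 < Im tau)%R ->
  f_strip z tau = / two_pi_i ^ 3 * (expsum c3 z tau + expsum c3 (tau - z) tau
    + (- 2) * expsum c3 (tau - 0) tau - Li3 1) + (/ 12 * z ^ 3 + - (/ 24) * z ^ 2 * tau).
Proof.
  intros Ht. unfold f_strip, elliptic_Li3. rewrite Li3_sum_expsum, !Li3_sum_reflect_expsum, Li3_q0 by exact Ht.
  rewrite !sum_Sn, !sum_O. unfold plus; simpl (_ + _)%nat; simpl (_ - _)%nat.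
  change (@plus C_AbelianGroup) with Cplus. simpl AbelianMonoid.plus.
  replace (expsum c3 tau tau) with (expsum c3 (tau - 0) tau) by (f_equal; ring).
  rewrite bernoulli_1, bernoulli_2, bernoulli_3.
  (* The term with [j = 3] is independent of [z] and cancels against the one at [z = 0], whatever
     its coefficient. *)
  match goal with |- context [RtoC (bernoulli 4 / ?d)%R] => generalize (RtoC (bernoulli 4 / d)%R) end.
  intros b4.
  replace (- / 2 / ((1 + 1 + 1 + 1 + 1 + 1) * 1))%R with (- (1 / 12))%R by field.
  replace (/ 6 / ((1 + 1) * (1 + 1)))%R with (1 / 24)%R by field.
  replace (0 / (1 * (1 + 1 + 1 + 1 + 1 + 1)))%R with 0%R by field.
  rewrite RtoC_opp, !RtoC_div by lra.
  field. repeat split; try exact two_pi_i_neq_0; intros E; injection E; lra.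
Qed.

(** * Analytic continuation of the third derivatives *)

Lemma loc_quad_expsum_z i j c d a b p p' z tau :
  poly_bounded i j c -> poly_bounded i j d -> in_strip z tau -> loc_quad p p' z ->
  loc_quad (fun w => a * expsum c w tau + b * expsum d (tau - w) tau + p w)
    (fun w => a * expsum (mulk c) w tau + - b * expsum (mulk d) (tau - w) tau + p' w) z.
Proof.
  intros Hc Hd [Hz Ht] Hp.
  assert (Hz' : (0 < Im (tau - z))%R) by (replace (Im (tau - z)) with (Im tau - Im z)%R by (unfold Im; simpl; ring); lra).
  assert (Ht' : (0 < Im tau)%R) by lra.
  apply loc_quad_plus; [|exact Hp]. apply loc_quad_plus.
  - apply loc_quad_scal. now apply (expsum_diff_z i j).
  - eapply loc_quad_ext; [| |apply loc_quad_scal, (expsum_reflect_diff_z i j d Hd z tau Hz' Ht')];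
      intros w; cbv beta; [reflexivity|ring].
Qed.

Lemma expsum_ext c d z tau : (forall n k, c n k = d n k) -> expsum c z tau = expsum d z tau.
Proof. intros E. apply Dsum_ext. intros n k. now rewrite E. Qed.

Section StripBranch.
Variables (P : polydisc) (g : C -> C -> C).
Hypothesis HP : forall z tau, in_polydisc P z tau -> in_strip z tau.
Hypothesis Hg : forall z tau, in_polydisc P z tau -> g z tau = f_strip z tau.

Let k0 := / two_pi_i ^ 3.

Lemma strip_Im z tau : in_polydisc P z tau -> (0 < Im z)%R /\ (0 < Im tau)%R /\ (0 < Im (tau - z))%R.
Proof.
  intros H. destruct (HP _ _ H) as [H1 H2].
  replace (Im (tau - z)) with (Im tau - Im z)%R by (unfold Im; simpl; ring). lra.
Qed.

Lemma g_expsum z tau : in_polydisc P z tau ->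
  g z tau = k0 * expsum c3 z tau + k0 * expsum c3 (tau - z) tau
    + (k0 * ((- 2) * expsum c3 (tau - 0) tau - Li3 1) + (/ 12 * z ^ 3 + - (/ 24) * z ^ 2 * tau)).
Proof.
  intros H. rewrite Hg, f_strip_expsum by (auto; apply (strip_Im z tau H)). fold k0. ring.
Qed.

Lemma strip_partial_30 z tau : in_polydisc P z tau -> partial 3 0 g z tau = fzzz z tau.
Proof.
  pose proof (poly_bounded_mulk _ _ _ c3_bounded) as B1. pose proof (poly_bounded_mulk _ _ _ B1) as B2.
  unshelve epose proof (C_derive_stage_z P g _ (fun z tau => k0 * expsum (mulk c3) z tau + - k0 * expsum (mulk c3) (tau - z) tau
     + (/ 4 * z ^ 2 + - (/ 12) * tau * z)) g_expsum _) as D1.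
  { intros u t Hu. apply (loc_quad_expsum_z _ _ _ _ _ _ (fun w => k0 * ((- 2) * expsum c3 (t - 0) t - Li3 1) + (/ 12 * w ^ 3 + - (/ 24) * w ^ 2 * t)) (fun w => / 4 * w ^ 2 + - (/ 12) * t * w) _ _ c3_bounded c3_bounded (HP _ _ Hu)).
    eapply loc_quad_ext; [| |apply loc_quad_plus; [apply (loc_quad_const (k0 * ((- 2) * expsum c3 (t - 0) t - Li3 1)))|
      apply loc_quad_plus; [apply (loc_quad_scal (/ 12)), loc_quad_cube|apply (loc_quad_scal (- (/ 24) * t)), loc_quad_sqr]]];
      intros w; cbv beta; [ring|field; repeat split; intros E; injection E; lra]. }
  unshelve epose proof (C_derive_stage_z P (fun z tau => C_derive (fun w => g w tau) z) _
    (fun z tau => k0 * expsum (mulk (mulk c3)) z tau + - - k0 * expsum (mulk (mulk c3)) (tau - z) tau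
     + (/ 2 * z + - (/ 12) * tau)) D1 _) as D2.
  { intros u t Hu. apply (loc_quad_expsum_z _ _ _ _ _ _ (fun w => / 4 * w ^ 2 + - (/ 12) * t * w) (fun w => / 2 * w + - (/ 12) * t) _ _ B1 B1 (HP _ _ Hu)).
    eapply loc_quad_ext; [| |apply loc_quad_plus; [apply (loc_quad_scal (/ 4)), loc_quad_sqr|apply (loc_quad_affine (- (/ 12) * t) 0)]];
      intros w; cbv beta; field; intros E; injection E; lra. }
  unshelve epose proof (C_derive_stage_z P (fun z tau => C_derive (fun v => C_derive (fun w => g w tau) v) z) _
    (fun z tau => k0 * expsum (mulk (mulk (mulk c3))) z tau + - - - k0 * expsum (mulk (mulk (mulk c3))) (tau - z) tau
     + / 2) D2 _) as D3.
  { intros u t Hu. apply (loc_quad_expsum_z _ _ _ _ _ _ (fun w => / 2 * w + - (/ 12) * t) (fun _ => / 2) _ _ B2 B2 (HP _ _ Hu)).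
    apply loc_quad_affine. }
  intros H.
  transitivity (C_derive (fun u => C_derive (fun v => C_derive (fun w => g w tau) v) u) z); [reflexivity|].
  rewrite (D3 _ _ H).
  destruct (strip_Im _ _ H) as [I1 [I2 I3]].
  rewrite (expsum_ext (mulk (mulk (mulk c3))) (fun n k => two_pi_i ^ 3 * (fun _ => 1) n) z tau).
  2:{ intros n k. unfold mulk, c3. field. apply RtoC_INR_S_neq_0. }
  rewrite (expsum_ext (mulk (mulk (mulk c3))) (fun n k => two_pi_i ^ 3 * (fun _ => 1) n) (tau - z) tau).
  2:{ intros n k. unfold mulk, c3. field. apply RtoC_INR_S_neq_0. }
  assert (Hc : forall n : nat, (Cmod ((fun _ => 1) n) <= INR (S n))%R) by (apply poly_bound_c; auto).
  rewrite !(expsum_lambert (two_pi_i ^ 3) (fun _ => 1)) by assumption.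
  unfold fzzz, k0. rewrite RtoC_inv by lra. field.
  repeat split; try apply two_pi_i_neq_0; intros E; injection E; lra.
Qed.

Lemma strip_partial_21 z tau : in_polydisc P z tau -> partial 2 1 g z tau = fzzt z tau.
Proof.
  pose proof (poly_bounded_muln _ _ _ c3_bounded) as B1. pose proof (poly_bounded_mulSn _ _ _ c3_bounded) as B1'.
  pose proof (poly_bounded_mulk _ _ _ B1) as B2. pose proof (poly_bounded_mulk _ _ _ B1') as B2'.
  (* The subtracted value at [z = 0] depends on [tau] and survives this derivative; it disappears
     with the first derivative in [z]. *)
  unshelve epose proof (C_derive_stage_tau P g _ (fun z tau => k0 * expsum (muln c3) z tau + k0 * expsum (mulSn c3) (tau - z) tau
     + ((- 2) * k0 * expsum (mulSn c3) (tau - 0) tau + - (/ 24) * z ^ 2)) g_expsum _) as D1.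
  { intros u t Hu. destruct (strip_Im _ _ Hu) as [I1 [I2 I3]].
    assert (I0 : (0 < Im (t - 0))%R) by (replace (t - 0) with t by ring; exact I2).
    eapply loc_quad_ext; [| |apply loc_quad_plus; [apply loc_quad_plus;
      [apply (loc_quad_scal k0), (expsum_diff_tau _ _ _ c3_bounded u t I1 I2)
      |apply (loc_quad_scal k0), (expsum_reflect_diff_tau _ _ _ c3_bounded u t I3 I2)]
      |apply loc_quad_plus; [apply (loc_quad_scal ((- 2) * k0)), (expsum_reflect_diff_tau _ _ _ c3_bounded 0 t I0 I2)
        |apply (loc_quad_affine (- (/ 24) * u ^ 2) (/ 12 * u ^ 3 - k0 * Li3 1))]]];
      intros w; cbv beta; ring. }
  unshelve epose proof (C_derive_stage_z P (fun z tau => C_derive (g z) tau) _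
    (fun z tau => k0 * expsum (mulk (muln c3)) z tau + - k0 * expsum (mulk (mulSn c3)) (tau - z) tau
     + (- (/ 12) * z + 0)) D1 _) as D2.
  { intros u t Hu. apply (loc_quad_expsum_z _ _ _ _ _ _ (fun w => (- 2) * k0 * expsum (mulSn c3) (t - 0) t + - (/ 24) * w ^ 2) (fun w => - (/ 12) * w + 0) _ _ B1 B1' (HP _ _ Hu)).
    eapply loc_quad_ext; [| |apply loc_quad_plus; [apply (loc_quad_const ((- 2) * k0 * expsum (mulSn c3) (t - 0) t))|
      apply (loc_quad_scal (- (/ 24))), loc_quad_sqr]];
      intros w; cbv beta; [ring|field; repeat split; intros E; injection E; lra]. }
  unshelve epose proof (C_derive_stage_z P (fun z tau => C_derive (fun w => C_derive (g w) tau) z) _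
    (fun z tau => k0 * expsum (mulk (mulk (muln c3))) z tau + - - k0 * expsum (mulk (mulk (mulSn c3))) (tau - z) tau
     + - (/ 12)) D2 _) as D3.
  { intros u t Hu. apply (loc_quad_expsum_z _ _ _ _ _ _ (fun w => - (/ 12) * w + 0) (fun _ => - / 12) _ _ B2 B2' (HP _ _ Hu)).
    apply loc_quad_affine. }
  intros H.
  transitivity (C_derive (fun u => C_derive (fun v => C_derive (g v) tau) u) z); [reflexivity|].
  rewrite (D3 _ _ H).
  destruct (strip_Im _ _ H) as [I1 [I2 I3]].
  rewrite (expsum_ext (mulk (mulk (muln c3))) (fun n k => two_pi_i ^ 3 * (fun n => RtoC (INR n)) n) z tau).
  2:{ intros n k. unfold mulk, muln, c3. field. apply RtoC_INR_S_neq_0. }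
  rewrite (expsum_ext (mulk (mulk (mulSn c3))) (fun n k => two_pi_i ^ 3 * (fun n => RtoC (INR (S n))) n) (tau - z) tau).
  2:{ intros n k. unfold mulk, mulSn, c3. field. apply RtoC_INR_S_neq_0. }
  rewrite (expsum_lambert (two_pi_i ^ 3) (fun n => RtoC (INR n))) by (auto; apply poly_bound_c; auto).
  rewrite (expsum_lambert (two_pi_i ^ 3) (fun n => RtoC (INR (S n)))) by (auto; apply poly_bound_c; auto).
  unfold fzzt, k0. rewrite RtoC_opp, RtoC_inv by lra. field.
  repeat split; try apply two_pi_i_neq_0; intros E; injection E; lra.
Qed.

End StripBranch.

Lemma segment_in_disc z0 z1 c r t : (0 <= t <= 1)%R ->
  (Cmod (z0 - c) < r)%R -> (Cmod (z1 - c) < r)%R -> (Cmod (z0 + RtoC t * (z1 - z0) - c) < r)%R.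
Proof.
  intros Ht H0 H1.
  replace (z0 + RtoC t * (z1 - z0) - c) with (RtoC (1 - t) * (z0 - c) + RtoC t * (z1 - c)) by (rewrite RtoC_minus; ring).
  eapply Rle_lt_trans; [apply Cmod_triangle|].
  rewrite !Cmod_mult, !Cmod_R, !Rabs_pos_eq by lra.
  pose proof (Rmax_l (Cmod (z0 - c)) (Cmod (z1 - c))) as M0.
  pose proof (Rmax_r (Cmod (z0 - c)) (Cmod (z1 - c))) as M1.
  assert (M : (Rmax (Cmod (z0 - c)) (Cmod (z1 - c)) < r)%R) by (now apply Rmax_lub_lt).
  set (m := Rmax (Cmod (z0 - c)) (Cmod (z1 - c))) in *.
  assert ((1 - t) * Cmod (z0 - c) <= (1 - t) * m)%R by (apply Rmult_le_compat_l; lra).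
  assert (t * Cmod (z1 - c) <= t * m)%R by (apply Rmult_le_compat_l; lra).
  lra.
Qed.

Lemma loc_diff_zero_segment f c r z0 z1 e :
  (forall z, (Cmod (z - c) < r)%R -> loc_diff f z) ->
  (Cmod (z0 - c) < r)%R -> (Cmod (z1 - c) < r)%R -> (0 < e)%R ->
  (forall w, (Cmod (w - z0) < e)%R -> f w = 0) -> f z1 = 0.
Proof.
  intros Hf H0 H1 He Z. apply (quad_diff_zero_segment f z0 z1); [|now exists e].
  intros t Ht. apply Hf. now apply segment_in_disc.
Qed.

(** The one-variable theorem is applied on slices: along [z] for every [tau] near [tau0], and then
    along [tau] for each fixed [z], where the agreement just obtained provides the initial disc. *)
Lemma polydisc_identity Q (h F : C -> C -> C) z0 tau0 e :
  (forall z tau, in_polydisc Q z tau -> loc_diff (fun w => h w tau) z /\ loc_diff (h z) tau) ->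
  (forall z tau, in_polydisc Q z tau -> loc_diff (fun w => F w tau) z /\ loc_diff (F z) tau) ->
  in_polydisc Q z0 tau0 -> (0 < e)%R ->
  (forall z tau, (Cmod (z - z0) < e)%R -> (Cmod (tau - tau0) < e)%R -> h z tau = F z tau) ->
  forall z tau, in_polydisc Q z tau -> h z tau = F z tau.
Proof.
  intros Hh HF Hin0 He E.
  assert (Df : forall f g p, loc_diff f p -> loc_diff g p -> loc_diff (fun w => f w + RtoC (-1) * g w) p).
  { intros f g p Hf Hg. apply loc_diff_plus; [exact Hf|now apply loc_diff_scal]. }
  assert (Z : forall a b : C, a + RtoC (-1) * b = 0 <-> a = b).
  { intros a b. split; intros H.
    - replace a with ((a + RtoC (-1) * b) + b) by ring. rewrite H. ring.
    - rewrite H. ring. }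
  destruct (open2_polydisc Q _ _ Hin0) as [r [Hr Hsl]].
  assert (S1 : forall z tau, in_polydisc Q z tau -> (Cmod (tau - tau0) < e)%R -> h z tau = F z tau).
  { intros z tau [Hz Ht] Hte. apply Z.
    apply (loc_diff_zero_segment (fun w => h w tau + RtoC (-1) * F w tau) (ctr_z Q) (rad_z Q) z0 z e); auto.
    - intros w Hw. apply Df; [apply Hh|apply HF]; split; assumption.
    - apply Hin0.
    - intros w Hw. apply Z. now apply E. }
  intros z tau [Hz Ht]. apply Z.
  apply (loc_diff_zero_segment (fun t => h z t + RtoC (-1) * F z t) (ctr_tau Q) (rad_tau Q) tau0 tau (Rmin e r)); auto.
  - intros t Ht'. apply Df; [apply Hh|apply HF]; split; assumption.
  - apply Hin0.
  - now apply Rmin_pos.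
  - intros t Ht'. apply Z. apply S1.
    + split; [exact Hz|]. apply (Hsl z0 t); [now apply Cmod_diag|]. eapply Rlt_le_trans; [exact Ht'|apply Rmin_r].
    + eapply Rlt_le_trans; [exact Ht'|apply Rmin_l].
Qed.

Lemma open2_partial U g h : open2 U -> (forall z tau, U z tau -> g z tau = h z tau) ->
  forall z tau, U z tau -> partial 3 0 g z tau = partial 3 0 h z tau /\ partial 2 1 g z tau = partial 2 1 h z tau.
Proof.
  intros HU E z tau H. split.
  - revert z tau H. refine (open2_C_derive_z U _ _ HU _). refine (open2_C_derive_z U _ _ HU _).
    exact (open2_C_derive_z U _ _ HU E).
  - revert z tau H. refine (open2_C_derive_z U _ _ HU _). refine (open2_C_derive_z U _ _ HU _).
    exact (open2_C_derive_tau U _ _ HU E).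
Qed.

Lemma open2_inter U V : open2 U -> open2 V -> open2 (fun z tau => U z tau /\ V z tau).
Proof.
  intros HU HV z tau [H1 H2]. destruct (HU _ _ H1) as [r [Hr A]]. destruct (HV _ _ H2) as [s [Hs B]].
  exists (Rmin r s). split; [now apply Rmin_pos|]. intros w t Hw Ht.
  pose proof (Rmin_l r s). pose proof (Rmin_r r s). split; [apply A|apply B]; lra.
Qed.

(** The closed forms are holomorphic off the lattice, so agreement on the overlap with the previous
    polydisc spreads over the new one, whatever determination is carried along. *)
Lemma f_branch_partials P g : f_branch P g -> forall z tau, in_polydisc P z tau ->
  partial 3 0 g z tau = fzzz z tau /\ partial 2 1 g z tau = fzzt z tau.
Proof.
  induction 1 as [P g HP Hg|P Q g h Hb IH HQ Han [z0 [tau0 [H0P H0Q]]] Egh].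
  - intros z tau H. split; [now apply (strip_partial_30 P g HP Hg)|now apply (strip_partial_21 P g HP Hg)].
  - set (U := fun z tau => in_polydisc P z tau /\ in_polydisc Q z tau).
    assert (HU : open2 U) by (apply open2_inter; apply open2_polydisc).
    assert (Ep := open2_partial U g h HU (fun z tau H => Egh z tau (proj1 H) (proj2 H))).
    destruct (HU z0 tau0 (conj H0P H0Q)) as [e [He Hbox]].
    destruct (ser_on_partial Q h (analytic_ser_on Q h Han)) as [S1 S2].
    assert (L : forall k, ser_on Q k -> forall z tau, in_polydisc Q z tau ->
      loc_diff (fun w => k w tau) z /\ loc_diff (k z) tau).
    { intros k Hk z tau H. split; [now apply (ser_on_dz Q k Hk)|now apply (ser_on_dtau Q k Hk)]. }
    intros z tau Hin. split.
    + apply (polydisc_identity Q _ fzzz z0 tau0 e (L _ S1)); auto.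
      * intros w t H. apply fzzz_loc_diff. now apply HQ.
      * intros w t Hw Ht. pose proof (Hbox w t Hw Ht) as HUw.
        destruct (Ep w t HUw) as [E1 _]. rewrite <- E1. apply (IH w t (proj1 HUw)).
    + apply (polydisc_identity Q _ fzzt z0 tau0 e (L _ S2)); auto.
      * intros w t H. apply fzzt_loc_diff. now apply HQ.
      * intros w t Hw Ht. pose proof (Hbox w t Hw Ht) as HUw.
        destruct (Ep w t HUw) as [_ E1]. rewrite <- E1. apply (IH w t (proj1 HUw)).
Qed.

(** * The addition formula *)

Lemma Dsum_plus B x t B' x' u : (0 <= x < 1)%R -> (0 <= x' < 1)%R -> geom_dom B x t -> geom_dom B' x' u ->
  Dsum (fun m n => t m n + u m n) = Dsum t + Dsum u.
Proof.
  intros Hx Hx' Ht Hu.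
  pose proof (csum_plus _ _ _ _ (geom_dom_outer _ _ _ Hx Ht) (geom_dom_outer _ _ _ Hx' Hu)) as H.
  rewrite <- (csum_unique _ _ H). apply CSeries_ext. intros m.
  apply csum_unique, csum_plus; [apply (geom_dom_inner B x t m Hx Ht)|apply (geom_dom_inner B' x' u m Hx' Hu)].
Qed.

Lemma Dsum_minus B x t B' x' u : (0 <= x < 1)%R -> (0 <= x' < 1)%R -> geom_dom B x t -> geom_dom B' x' u ->
  Dsum (fun m n => t m n - u m n) = Dsum t - Dsum u.
Proof.
  intros Hx Hx' Ht Hu.
  pose proof (csum_minus _ _ _ _ (geom_dom_outer _ _ _ Hx Ht) (geom_dom_outer _ _ _ Hx' Hu)) as H.
  rewrite <- (csum_unique _ _ H). apply CSeries_ext. intros m.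
  apply csum_unique, csum_minus; [apply (geom_dom_inner B x t m Hx Ht)|apply (geom_dom_inner B' x' u m Hx' Hu)].
Qed.

(** After the substitution [k = m + n] the majorant depends on [k] alone. Half of its decay is
    traded for decay in [m], which restores the product form of [geom_dom] with ratio [sqrt x]. *)
Lemma pow_sqrt_split x m k : (0 <= x < 1)%R -> (m <= k)%nat -> (x ^ k <= sqrt x ^ m * sqrt x ^ k)%R.
Proof.
  intros Hx Hmk. pose proof (sqrt_pos x) as P.
  assert (S1 : (sqrt x <= 1)%R) by (rewrite <- sqrt_1; apply sqrt_le_1; lra).
  rewrite <- (sqrt_sqrt x) at 1 by lra. rewrite Rpow_mult_distr.
  apply Rmult_le_compat_r; [now apply pow_le|].
  replace k with (m + (k - m))%nat by lia. rewrite pow_add.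
  rewrite <- (Rmult_1_r (sqrt x ^ m)) at 2. apply Rmult_le_compat_l; [now apply pow_le|].
  rewrite <- (pow1 (k - m)). apply pow_incr. lra.
Qed.

Lemma sqrt_range x : (0 <= x < 1)%R -> (0 <= sqrt x < 1)%R.
Proof. intros H. split; [apply sqrt_pos|]. rewrite <- sqrt_1. apply sqrt_lt_1; lra. Qed.

(** Row [m] is shifted by [m] places and padded with zeros; the columns of the new array are the
    antidiagonals of the old one. *)
Lemma Dsum_antidiagonal B x t : (0 <= x < 1)%R -> geom_dom B x t ->
  is_csum (fun k => sum_n (fun m => t m (k - m)%nat) k) (Dsum t).
Proof.
  intros Hx H. pose proof (geom_dom_pos _ _ _ H) as PB.
  set (s := fun m k => if (m <=? k)%nat then t m (k - m)%nat else 0).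
  assert (Gs : geom_dom B (sqrt x) s).
  { intros m k. unfold s. pose proof (sqrt_pos x) as P. destruct (Nat.leb_spec m k).
    - eapply Rle_trans; [apply H|]. rewrite !Rmult_assoc, <- pow_add.
      replace (m + (k - m))%nat with k by lia. apply Rmult_le_compat_l; [exact PB|now apply pow_sqrt_split].
    - rewrite Cmod_0. repeat apply Rmult_le_pos; auto using pow_le. }
  assert (E : Dsum t = Dsum s).
  { apply CSeries_ext. intros m. symmetry. apply csum_unique.
    apply (csum_shift m (t m)). eapply geom_dom_inner; eauto. }
  rewrite E, (Dsum_swap B (sqrt x) s (sqrt_range x Hx) Gs).
  assert (Gs' : geom_dom B (sqrt x) (fun k m => s m k)).
  { intros m k. eapply Rle_trans; [apply Gs|right; ring]. }
  eapply csum_ext; [|apply (geom_dom_outer B (sqrt x) _ (sqrt_range x Hx) Gs')].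
  intros k. apply csum_unique.
  replace (sum_n (fun m => t m (k - m)%nat) k) with (sum_n (fun m => s m k) k).
  - apply (csum_finite (fun m => s m k)). intros n Hn. unfold s. destruct (Nat.leb_spec n k); [lia|reflexivity].
  - apply sum_n_ext_loc. intros n Hn. unfold s. destruct (Nat.leb_spec n k); [reflexivity|lia].
Qed.

(** The part [m > n] is summed by columns and the part [m <= n] by rows, each indexed by the
    distance [k] from its edge. The diagonal goes to the second part because the relevant exponent
    is [m - n - 1]. *)
Lemma Dsum_diagonal_split B x t : (0 <= x < 1)%R -> geom_dom B x t ->
  Dsum t = Dsum (fun n k => t (S (n + k)) n) + Dsum (fun m k => t m (m + k)%nat).
Proof.
  intros Hx H. pose proof (geom_dom_pos _ _ _ H) as PB.
  assert (P0 : forall m n, (0 <= B * x ^ m * x ^ n)%R).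
  { intros. repeat apply Rmult_le_pos; auto; apply pow_le; lra. }
  set (tR := fun m n => if (m <=? n)%nat then t m n else 0).
  set (tL := fun m n => if (S n <=? m)%nat then t m n else 0).
  assert (GR : geom_dom B x tR).
  { intros m n. unfold tR. destruct (m <=? n)%nat; [apply H|rewrite Cmod_0; apply P0]. }
  assert (GL : geom_dom B x tL).
  { intros m n. unfold tL. destruct (S n <=? m)%nat; [apply H|rewrite Cmod_0; apply P0]. }
  assert (x1 : forall n, (x ^ n <= 1)%R) by (intros; rewrite <- (pow1 n); apply pow_incr; lra).
  assert (x0 : forall n, (0 <= x ^ n)%R) by (intros; apply pow_le; lra).
  transitivity (Dsum (fun m n => tL m n + tR m n)).
  { apply Dsum_ext. intros m n. unfold tL, tR.
    destruct (Nat.leb_spec (S n) m); destruct (Nat.leb_spec m n); try lia; ring. }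
  rewrite (Dsum_plus B x tL B x tR Hx Hx GL GR). f_equal.
  - rewrite (Dsum_swap B x tL Hx GL). apply CSeries_ext. intros n. apply csum_unique.
    eapply csum_ext; [|apply (csum_shift (S n) (fun k => t (S (n + k)) n))].
    + intros m. cbv beta. unfold tL. destruct (Nat.leb_spec (S n) m); [|reflexivity].
      f_equal. lia.
    + apply csum_geom_ex with (B := B) (x := x); [exact Hx|]. intros k. eapply Rle_trans; [apply H|].
      replace (S (n + k)) with (k + S n)%nat by lia. rewrite pow_add.
      replace (B * (x ^ k * x ^ S n) * x ^ n)%R with (B * x ^ k * (x ^ S n * x ^ n))%R by ring.
      rewrite <- (Rmult_1_r (B * x ^ k)) at 2. apply Rmult_le_compat_l; [now apply Rmult_le_pos|].
      rewrite <- pow_add. apply x1.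
  - apply CSeries_ext. intros m. apply csum_unique.
    eapply csum_ext; [|apply (csum_shift m (fun k => t m (m + k)%nat))].
    + intros n. cbv beta. unfold tR. destruct (Nat.leb_spec m n); [|reflexivity].
      f_equal. lia.
    + apply csum_geom_ex with (B := B) (x := x); [exact Hx|]. intros k. eapply Rle_trans; [apply H|].
      rewrite pow_add.
      replace (B * x ^ m * (x ^ m * x ^ k))%R with (B * x ^ k * (x ^ m * x ^ m))%R by ring.
      rewrite <- (Rmult_1_r (B * x ^ k)) at 2. apply Rmult_le_compat_l; [now apply Rmult_le_pos|].
      rewrite <- pow_add. apply x1.
Qed.

(** * Products of series with geometric decay *)

Section GeomSeq.
Variables (B Q : R).
Hypothesis HB : (0 <= B)%R.
Hypothesis HQ : (0 <= Q < 1)%R.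

Definition geom_seq (u : nat -> C) : Prop := forall n, (Cmod (u n) <= B * Q ^ n)%R.

Let Q0 n : (0 <= Q ^ n)%R. Proof. apply pow_le; lra. Qed.
Let Q1 n : (Q ^ n <= 1)%R. Proof. rewrite <- (pow1 n). apply pow_incr; lra. Qed.

Lemma geom_seq_csum u : geom_seq u -> is_csum u (CSeries u).
Proof. intros H. eapply csum_geom_ex; eauto. Qed.

Lemma geom_seq_S u : geom_seq u -> geom_seq (fun n => u (S n)).
Proof.
  intros H n. eapply Rle_trans; [apply H|]. apply Rmult_le_compat_l; [exact HB|].
  simpl. pose proof (Q0 n). nra.
Qed.

Lemma geom_dom_add u : geom_seq u -> geom_dom B Q (fun m n => u (m + n)%nat).
Proof. intros H m n. eapply Rle_trans; [apply H|]. rewrite pow_add. right; ring. Qed.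

Lemma geom_dom_mult u v : geom_seq u -> geom_seq v -> geom_dom (B * B) Q (fun m n => u m * v n).
Proof.
  intros Hu Hv m n. rewrite Cmod_mult.
  eapply Rle_trans; [apply Rmult_le_compat; auto using Cmod_ge_0|]. right; ring.
Qed.

Lemma geom_dom_add_mult w (f : nat -> nat -> C) : geom_seq w -> (forall m n, (Cmod (f m n) <= B)%R) ->
  geom_dom (B * B) Q (fun m n => w (m + n)%nat * f m n).
Proof.
  intros Hw Hf m n. rewrite Cmod_mult.
  eapply Rle_trans; [apply Rmult_le_compat; auto using Cmod_ge_0|]. rewrite pow_add. right; ring.
Qed.

Lemma geom_seq_le u n : geom_seq u -> (Cmod (u n) <= B)%R.
Proof.
  intros H. eapply Rle_trans; [apply H|]. rewrite <- (Rmult_1_r B) at 2. now apply Rmult_le_compat_l.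
Qed.

Lemma CSeries_mult u v : geom_seq u -> geom_seq v -> CSeries u * CSeries v = Dsum (fun m n => u m * v n).
Proof.
  intros Hu Hv. unfold Dsum.
  transitivity (CSeries (fun m => CSeries v * u m)).
  - rewrite (csum_unique _ _ (csum_scal (CSeries v) _ _ (geom_seq_csum u Hu))). ring.
  - apply CSeries_ext. intros m. symmetry. rewrite Cmult_comm. apply csum_unique, csum_scal, geom_seq_csum, Hv.
Qed.

Lemma sum_n_const_C (c : C) k : sum_n (fun _ => c) k = RtoC (INR (S k)) * c.
Proof.
  induction k as [|k IH]; [rewrite sum_O; simpl; ring|].
  rewrite sum_Sn, IH, (S_INR (S k)), RtoC_plus.
  change (RtoC (INR (S k)) * c + c = (RtoC (INR (S k)) + 1) * c). ring.
Qed.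

Lemma sum_n_scal_C (c : C) u k : sum_n (fun m => c * u m) k = c * sum_n u k.
Proof.
  induction k as [|k IH]; [now rewrite !sum_O|]. rewrite !sum_Sn, IH.
  change (c * sum_n u k + c * u (S k) = c * (sum_n u k + u (S k))). ring.
Qed.

(* [wsum w u] is the sum over k of [w k * (u 0 + ... + u k)]. *)
Definition wsum (w u : nat -> C) : C := Dsum (fun m n => w (m + n)%nat * u m).

(** There are [k + 1] pairs with [m + n = k]. This count is the origin of the weights in the closed
    form of [f^(2,1)]. *)
Lemma add_sum w : geom_seq w ->
  is_csum (fun k => RtoC (INR (S k)) * w k) (Dsum (fun m n => w (m + n)%nat)).
Proof.
  intros H. eapply csum_ext; [|apply (Dsum_antidiagonal _ _ _ HQ (geom_dom_add w H))].
  intros k. cbv beta. rewrite <- sum_n_const_C. apply sum_n_ext_loc. intros n Hn. f_equal. lia.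
Qed.

Lemma wsum_csum w u : geom_seq w -> geom_seq u -> is_csum (fun k => w k * sum_n u k) (wsum w u).
Proof.
  intros Hw Hu.
  eapply csum_ext; [|apply (Dsum_antidiagonal _ _ _ HQ (geom_dom_add_mult w (fun m _ => u m) Hw (fun m _ => geom_seq_le u m Hu)))].
  intros k. cbv beta. rewrite <- sum_n_scal_C. apply sum_n_ext_loc. intros n Hn. f_equal. f_equal. lia.
Qed.

Lemma wsum_swap w v : geom_seq w -> geom_seq v -> Dsum (fun m n => w (m + n)%nat * v n) = wsum w v.
Proof.
  intros Hw Hv.
  rewrite (Dsum_swap _ _ _ HQ (geom_dom_add_mult w (fun _ n => v n) Hw (fun _ n => geom_seq_le v n Hv))).
  apply Dsum_ext. intros m n. now rewrite Nat.add_comm.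
Qed.

(** The factor [w (m + n)] decays in both indices, so the three parts of the product may be summed
    separately. The two [wsum] terms cancel later against those of the products of opposite sign. *)
Lemma product_same_sign u v w : geom_seq u -> geom_seq v -> geom_seq w ->
  (forall m n, u m * v n = w (m + n)%nat * (1 + u m + v n)) ->
  CSeries u * CSeries v = Dsum (fun m n => w (m + n)%nat) + wsum w u + wsum w v.
Proof.
  intros Hu Hv Hw E. rewrite CSeries_mult by assumption. rewrite <- (wsum_swap w v Hw Hv).
  assert (G1 := geom_dom_add w Hw).
  assert (G2 := geom_dom_add_mult w (fun m _ => u m) Hw (fun m _ => geom_seq_le u m Hu)).
  assert (G3 := geom_dom_add_mult w (fun _ n => v n) Hw (fun _ n => geom_seq_le v n Hv)).
  unfold wsum. rewrite <- (Dsum_plus _ _ _ _ _ _ HQ HQ G1 G2).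
  rewrite <- (Dsum_plus (B + B * B) Q _ _ _ _ HQ HQ) with (2 := G3).
  - apply Dsum_ext. intros m n. rewrite E. ring.
  - intros m n. eapply Rle_trans; [apply Cmod_triangle|]. specialize (G1 m n). specialize (G2 m n).
    simpl in *. lra.
Qed.

Lemma tail_sum u k : geom_seq u -> is_csum (fun n => u (S (n + k))) (CSeries u - sum_n u k).
Proof.
  intros H. induction k as [|k IH].
  - rewrite sum_O. eapply csum_ext; [|apply csum_incr_1, geom_seq_csum, H].
    intros n. cbv beta. now rewrite Nat.add_0_r.
  - rewrite sum_Sn. apply csum_incr_1 in IH.
    replace (CSeries u - plus (sum_n u k) (u (S k))) with (CSeries u - sum_n u k - u (S (0 + k))).
    + eapply csum_ext; [|exact IH]. intros n. cbv beta. f_equal. lia.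
    + change (CSeries u - sum_n u k - u (S k) = CSeries u - (sum_n u k + u (S k))). ring.
Qed.

Lemma geom_dom_difference w v (f : nat -> nat -> C) : geom_seq w -> geom_seq v -> geom_dom B Q f ->
  geom_dom (B * (2 * B)) Q (fun n k => w k * (v n - f n k)).
Proof.
  intros Hw Hv Hf n k. rewrite Cmod_mult.
  assert (H2 : (Cmod (v n - f n k) <= 2 * B * Q ^ n)%R).
  { eapply Rle_trans; [apply Cmod_triangle|]. rewrite Cmod_opp. pose proof (Hv n). pose proof (Hf n k).
    assert (B * Q ^ n * Q ^ k <= B * Q ^ n)%R; [|lra].
    rewrite <- (Rmult_1_r (B * Q ^ n)) at 2. apply Rmult_le_compat_l; [now apply Rmult_le_pos|apply Q1]. }
  eapply Rle_trans; [apply Rmult_le_compat; [apply Cmod_ge_0|apply Cmod_ge_0|apply Hw|exact H2]|]. right; ring.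
Qed.

(* Here the product involves q to the powers m - n - 1 of both signs: on either
   side of the diagonal one uses the relation that keeps the sum absolutely
   convergent. *)
Lemma product_opposite_sign u v w w' :
  geom_seq u -> geom_seq v -> geom_seq w -> geom_seq w' ->
  (forall n k, u (S (n + k)) * v n = w k * (v n - u (S (n + k))) - u (S (n + k))) ->
  (forall m k, u m * v (m + k)%nat = w' k * (u m - v (m + k)%nat) - v (m + k)%nat) ->
  CSeries u * CSeries v =
    (CSeries v - CSeries u) * CSeries w + wsum w u - Dsum (fun n k => u (S (n + k)))
    + ((CSeries u - CSeries v) * CSeries w' + wsum (fun k => w' (S k)) v - Dsum (fun m k => v (m + k)%nat)).
Proof.
  intros Hu Hv Hw Hw' E1 E2. rewrite CSeries_mult by assumption.
  rewrite (Dsum_diagonal_split _ _ _ HQ (geom_dom_mult u v Hu Hv)).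
  f_equal.
  - assert (Gu : geom_dom B Q (fun n k => u (S (n + k)))) by (apply (geom_dom_add (fun n => u (S n))), geom_seq_S, Hu).
    assert (G1 : geom_dom (B * (2 * B)) Q (fun n k => w k * (v n - u (S (n + k))))).
    { intros n k. now apply (geom_dom_difference w v (fun n k => u (S (n + k)))). }
    transitivity (Dsum (fun n k => w k * (v n - u (S (n + k))) - u (S (n + k)))).
    { apply Dsum_ext. intros n k. apply E1. }
    rewrite (Dsum_minus _ _ _ _ _ _ HQ HQ G1 Gu). f_equal.
    rewrite (Dsum_swap _ _ _ HQ G1). unfold Dsum.
    (* For fixed [k] the sum over [n] is [w k] times the full sum of [v] minus the tail of [u] after
       index [k]; writing the tail as total minus partial sum produces the two terms. *)
    assert (S1 := csum_plus _ _ _ _ (csum_scal (CSeries v - CSeries u) _ _ (geom_seq_csum w Hw)) (wsum_csum w u Hw Hu)).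
    rewrite <- (csum_unique _ _ S1). apply CSeries_ext. intros k. apply csum_unique.
    replace ((CSeries v - CSeries u) * w k + w k * sum_n u k) with (w k * (CSeries v - (CSeries u - sum_n u k))) by ring.
    apply csum_scal, csum_minus; [now apply geom_seq_csum|now apply tail_sum].
  - assert (Gv : geom_dom B Q (fun n k => v (n + k)%nat)) by (apply (geom_dom_add v), Hv).
    assert (G1 : geom_dom (B * (2 * B)) Q (fun m k => w' k * (u m - v (m + k)%nat))).
    { intros n k. now apply (geom_dom_difference w' u (fun n k => v (n + k)%nat)). }
    transitivity (Dsum (fun m k => w' k * (u m - v (m + k)%nat) - v (m + k)%nat)).
    { apply Dsum_ext. intros n k. apply E2. }
    rewrite (Dsum_minus _ _ _ _ _ _ HQ HQ G1 Gv). f_equal.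
    rewrite (Dsum_swap _ _ _ HQ G1). unfold Dsum. apply csum_unique.
    assert (Wv := wsum_csum (fun k => w' (S k)) v (geom_seq_S _ Hw') Hv).
    (* In this half the tail of [v] starts at index [k] itself, so the missing partial sum has [k]
       terms and is empty for [k = 0]; hence the shifted weight [w' (S k)]. *)
    assert (S0 : is_csum (fun k => w' k * match k with O => 0 | S j => sum_n v j end) (wsum (fun k => w' (S k)) v)).
    { replace (wsum (fun k => w' (S k)) v) with (w' O * 0 + wsum (fun k => w' (S k)) v) by ring.
      apply (csum_decr_1 (fun k => w' k * match k with O => 0 | S j => sum_n v j end)). exact Wv. }
    assert (S1 := csum_plus _ _ _ _ (csum_scal (CSeries u - CSeries v) _ _ (geom_seq_csum w' Hw')) S0).
    eapply csum_ext; [|exact S1]. intros k. cbv beta. symmetry. apply csum_unique.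
    replace ((CSeries u - CSeries v) * w' k + w' k * match k with O => 0 | S j => sum_n v j end) with
      (w' k * (CSeries u - (CSeries v - match k with O => 0 | S j => sum_n v j end))) by ring.
    apply csum_scal, csum_minus; [now apply geom_seq_csum|].
    destruct k as [|j].
    + replace (CSeries v - 0) with (CSeries v) by ring.
      eapply csum_ext; [|apply geom_seq_csum, Hv]. intros n. cbv beta. now rewrite Nat.add_0_r.
    + eapply csum_ext; [|apply tail_sum, Hv]. intros n. cbv beta. f_equal. lia.
Qed.

Lemma weighted_sum_S u : geom_seq u ->
  is_csum (fun n => RtoC (INR n) * u n) (Dsum (fun n k => u (S (n + k)))).
Proof.
  intros H. replace (Dsum (fun n k => u (S (n + k)))) with (RtoC (INR 0) * u O + Dsum (fun n k => u (S (n + k))))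
    by (simpl; ring).
  apply (csum_decr_1 (fun n => RtoC (INR n) * u n)). apply (add_sum (fun n => u (S n))), geom_seq_S, H.
Qed.

Lemma weighted_sum_shift u : geom_seq u ->
  Dsum (fun m n => u (m + n)%nat) = Dsum (fun n k => u (S (n + k))) + CSeries u.
Proof.
  intros H. rewrite <- (csum_unique _ _ (add_sum u H)).
  apply csum_unique. eapply csum_ext; [|apply csum_plus; [apply weighted_sum_S, H|apply geom_seq_csum, H]].
  intros n. cbv beta. rewrite S_INR, RtoC_plus. ring.
Qed.

End GeomSeq.

(** The decay of [q^n] passes to the Lambert summands because [lambert_gap] keeps the denominators
    away from 0, also outside the strip. *)
Lemma lattice_geom_seq z tau : off_lattice z tau ->
  exists B, (0 <= B)%R /\
    geom_seq B (exp (- (2 * PI) * Im tau)) (fun n => Lx (cexp (two_pi_i * (RtoC (INR n) * tau + z)))).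
Proof.
  intros H. pose proof (proj1 H) as Ht.
  set (B := exp (- (2 * PI) * (Im z - 1))). set (Q := exp (- (2 * PI) * Im tau)).
  assert (PB : (0 < B)%R) by apply exp_pos.
  assert (HQ : (0 <= Q < 1)%R) by (now apply q_lt_1).
  assert (F : forall n w, two_pi_i * w + two_pi_i * (RtoC (INR n) * tau) = two_pi_i * (RtoC (INR n) * tau + w)) by (intros; ring).
  assert (Hb : forall n w, (Cmod (w - z) < 1)%R -> (Cmod (cexp (two_pi_i * w + two_pi_i * (RtoC (INR n) * tau))) <= B * Q ^ n)%R).
  { intros n w Hw. rewrite F. apply e_geom; [lra|apply Rle_refl|]. apply exp_le.
    apply Im_le_sub in Hw. pose proof PI_RGT_0. nra. }
  destruct (lambert_gap (fun _ => two_pi_i) (fun n => two_pi_i * (RtoC (INR n) * tau)) z 1 B Q ltac:(lra) HQ Hb) as [d [r [Pd [Pr Hgap]]]].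
  { intros n. rewrite F. now apply off_lattice_e. }
  exists (B * / d)%R. assert (Id : (0 < / d)%R) by (now apply Rinv_0_lt_compat).
  split; [apply Rmult_le_pos; lra|]. intros n.
  assert (Hz0 : (Cmod (z - z) < r)%R) by (apply Cmod_diag; lra).
  assert (Hz1 : (Cmod (z - z) < 1)%R) by (apply Cmod_diag; lra).
  specialize (Hgap n z Hz0). specialize (Hb n z Hz1). rewrite F in Hgap, Hb.
  set (x := cexp (two_pi_i * (RtoC (INR n) * tau + z))) in *.
  assert (N1 : 1 - x <> 0) by (apply Cmod_gt_0; lra).
  unfold Lx, Cdiv. rewrite Cmod_mult, Cmod_inv by exact N1.
  replace (B * / d * Q ^ n)%R with (B * Q ^ n * / d)%R by ring.
  apply Rmult_le_compat; [apply Cmod_ge_0|left; apply Rinv_0_lt_compat; lra|exact Hb|apply Rinv_le_contravar; lra].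
Qed.

Lemma one_minus_neq_0 (t : C) : t <> 1 -> 1 - t <> 0.
Proof. intros Ht E. apply Ht. replace t with (1 - (1 - t)) by ring. rewrite E. ring. Qed.

Lemma Lx_mult (x y : C) : x <> 1 -> y <> 1 -> x * y <> 1 -> Lx x * Lx y = Lx (x * y) * (1 + Lx x + Lx y).
Proof.
  intros Hx Hy Hxy.
  unfold Lx. field. repeat split; apply one_minus_neq_0; assumption.
Qed.

(** [Lx_mult] for the pair [t], [y], solved for the product [L(t y) L(y)]: it expresses a product
    through the quotient of the arguments. *)
Lemma Lx_mult_quotient (x y t : C) : x <> 1 -> y <> 1 -> t <> 1 -> x = t * y ->
  Lx x * Lx y = Lx t * (Lx y - Lx x) - Lx x.
Proof.
  intros Hx Hy Ht E.
  subst x. unfold Lx. field. repeat split; apply one_minus_neq_0; assumption.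
Qed.

Lemma geom_seq_weaken B B' Q u : (0 <= Q)%R -> (B <= B')%R -> geom_seq B Q u -> geom_seq B' Q u.
Proof.
  intros HQ HB H n. eapply Rle_trans; [apply H|]. apply Rmult_le_compat_r; [now apply pow_le|exact HB].
Qed.

Lemma fzzz_addition a b tau :
  off_lattice a tau -> off_lattice b tau -> off_lattice (a + b) tau ->
  fzzz a tau * fzzz b tau - fzzz (a + b) tau * (fzzz a tau + fzzz b tau) =
  fzzt a tau + fzzt b tau + fzzt (a + b) tau.
Proof.
  intros Ha Hb Hc.
  pose proof (off_lattice_reflect _ _ Ha) as Ha'. pose proof (off_lattice_reflect _ _ Hb) as Hb'.
  pose proof (off_lattice_reflect _ _ Hc) as Hc'.
  set (Q := exp (- (2 * PI) * Im tau)).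
  assert (HQ : (0 <= Q < 1)%R) by (apply q_lt_1, Ha).
  set (e := fun (n : nat) z => cexp (two_pi_i * (RtoC (INR n) * tau + z))).
  set (u := fun n => Lx (e n a)). set (u' := fun n => Lx (e n (tau - a))).
  set (v := fun n => Lx (e n b)). set (v' := fun n => Lx (e n (tau - b))).
  set (w := fun n => Lx (e n (a + b))). set (w' := fun n => Lx (e n (tau - (a + b)))).
  destruct (lattice_geom_seq _ _ Ha) as [B1 [P1 G1]]. destruct (lattice_geom_seq _ _ Ha') as [B2 [P2 G2]].
  destruct (lattice_geom_seq _ _ Hb) as [B3 [P3 G3]]. destruct (lattice_geom_seq _ _ Hb') as [B4 [P4 G4]].
  destruct (lattice_geom_seq _ _ Hc) as [B5 [P5 G5]]. destruct (lattice_geom_seq _ _ Hc') as [B6 [P6 G6]].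
  set (B := (B1 + B2 + B3 + B4 + B5 + B6)%R).
  assert (PB : (0 <= B)%R) by (unfold B; lra).
  assert (Gu : geom_seq B Q u) by (apply geom_seq_weaken with B1; [lra|unfold B; lra|exact G1]).
  assert (Gu' : geom_seq B Q u') by (apply geom_seq_weaken with B2; [lra|unfold B; lra|exact G2]).
  assert (Gv : geom_seq B Q v) by (apply geom_seq_weaken with B3; [lra|unfold B; lra|exact G3]).
  assert (Gv' : geom_seq B Q v') by (apply geom_seq_weaken with B4; [lra|unfold B; lra|exact G4]).
  assert (Gw : geom_seq B Q w) by (apply geom_seq_weaken with B5; [lra|unfold B; lra|exact G5]).
  assert (Gw' : geom_seq B Q w') by (apply geom_seq_weaken with B6; [lra|unfold B; lra|exact G6]).
  assert (N : forall n z, off_lattice z tau -> e n z <> 1) by (intros; now apply off_lattice_e).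
  assert (Em : forall m n k x y z, RtoC (INR m) * tau + x + (RtoC (INR n) * tau + y) = RtoC (INR k) * tau + z ->
    e m x * e n y = e k z).
  { intros m n k x y z E. unfold e. rewrite <- cexp_add. f_equal. rewrite <- E. ring. }
  assert (R1 := product_same_sign B Q PB HQ u v w Gu Gv Gw).
  (* The reflected sequences start at [q^1], so their products start at [q^2], which is index 1 of
     [w']. *)
  assert (R2 := product_same_sign B Q PB HQ u' v' (fun k => w' (S k)) Gu' Gv' (geom_seq_S B Q PB HQ _ Gw')).
  assert (R3 := product_opposite_sign B Q PB HQ u v' w w' Gu Gv' Gw Gw').
  assert (R4 := product_opposite_sign B Q PB HQ v u' w w' Gv Gu' Gw Gw').
  assert (A1 : forall m n, e m a * e n b = e (m + n)%nat (a + b)).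
  { intros. apply Em. rewrite plus_INR, RtoC_plus. ring. }
  assert (A2 : forall m n, e m (tau - a) * e n (tau - b) = e (S (m + n))%nat (tau - (a + b))).
  { intros. apply Em. rewrite S_INR, plus_INR, !RtoC_plus. ring. }
  assert (A3 : forall n k, e (S (n + k)) a = e k (a + b) * e n (tau - b)).
  { intros. symmetry. apply Em. rewrite S_INR, plus_INR, !RtoC_plus. ring. }
  assert (A4 : forall m k, e (m + k)%nat (tau - b) = e k (tau - (a + b)) * e m a).
  { intros. symmetry. apply Em. rewrite plus_INR, !RtoC_plus. ring. }
  assert (A5 : forall n k, e (S (n + k)) b = e k (a + b) * e n (tau - a)).
  { intros. symmetry. apply Em. rewrite S_INR, plus_INR, !RtoC_plus. ring. }
  assert (A6 : forall m k, e (m + k)%nat (tau - a) = e k (tau - (a + b)) * e m b).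
  { intros. symmetry. apply Em. rewrite plus_INR, !RtoC_plus. ring. }
  specialize (R1 ltac:(intros m n; unfold u, v, w; rewrite <- A1; apply Lx_mult; auto; rewrite A1; auto)).
  specialize (R2 ltac:(intros m n; unfold u', v', w'; rewrite <- A2; apply Lx_mult; auto; rewrite A2; auto)).
  specialize (R3 ltac:(intros n k; apply Lx_mult_quotient; auto)
    ltac:(intros m k; rewrite Cmult_comm; apply Lx_mult_quotient; auto)).
  specialize (R4 ltac:(intros n k; apply Lx_mult_quotient; auto)
    ltac:(intros m k; rewrite Cmult_comm; apply Lx_mult_quotient; auto)).
  assert (L0 : forall z, lambert (fun _ => 1) z tau = CSeries (fun n => Lx (e n z))).
  { intros z. apply CSeries_ext. intros n. unfold e. ring. }
  assert (L1 : forall z, geom_seq B Q (fun n => Lx (e n z)) ->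
    lambert (fun n => RtoC (INR n)) z tau = Dsum (fun n k => Lx (e (S (n + k)) z))).
  { intros z Hz. apply csum_unique. apply (weighted_sum_S B Q PB HQ (fun n => Lx (e n z)) Hz). }
  assert (L2 : forall z, geom_seq B Q (fun n => Lx (e n z)) ->
    lambert (fun n => RtoC (INR (S n))) z tau = Dsum (fun n k => Lx (e (n + k)%nat z))).
  { intros z Hz. apply csum_unique. apply (add_sum B Q HQ (fun n => Lx (e n z)) Hz). }
  unfold fzzz, fzzt. rewrite !L0, !L1, !L2 by assumption.
  fold u u' v v' w w'.
  assert (W1 := weighted_sum_shift B Q PB HQ w Gw). assert (W2 := weighted_sum_shift B Q PB HQ w' Gw').
  unfold u, u', v, v', w, w' in *.
  rewrite W1 in R1. rewrite W2.
  set (U := CSeries (fun n => Lx (e n a))) in *. set (U' := CSeries (fun n => Lx (e n (tau - a)))) in *.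
  set (V := CSeries (fun n => Lx (e n b))) in *. set (V' := CSeries (fun n => Lx (e n (tau - b)))) in *.
  set (W := CSeries (fun n => Lx (e n (a + b)))) in *. set (W' := CSeries (fun n => Lx (e n (tau - (a + b))))) in *.
  (* In this combination of [R1] to [R4] every [wsum] occurs twice with opposite signs, and the
     products containing [W] or [W'] cancel as well. The constant [1/4 - 1/2] agrees with
     [3 * (- 1/12)], and the terms [W] and [W'] are the differences between the weights [n] and
     [n + 1]. *)
  transitivity ((U * V + U' * V' - U * V' - V * U') - (W - W') * (U - U' + V - V') - (W - W') - RtoC (/ 4)).
  { rewrite !RtoC_inv by lra. field. }
  rewrite R1, R2, R3, R4. rewrite !RtoC_opp, !RtoC_inv by lra. field.
Qed.

(** * Root systems *)

Lemma is_f_deriv_30 z tau w : is_f_deriv 3 0 z tau w -> w = fzzz z tau.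
Proof. intros [P [g [Hb [Hin ->]]]]. apply (f_branch_partials P g Hb z tau Hin). Qed.

Lemma is_f_deriv_21 z tau w : is_f_deriv 2 1 z tau w -> w = fzzt z tau.
Proof. intros [P [g [Hb [Hin ->]]]]. apply (f_branch_partials P g Hb z tau Hin). Qed.

Lemma formC_add T (u v : Z * Z) z :
  formC T (vecC u) z + formC T (vecC v) z = formC T (vecC (fst u + fst v, snd u + snd v)%Z) z.
Proof. destruct T; unfold formC, vecC; simpl; rewrite !plus_IZR, !RtoC_plus; ring. Qed.

Lemma root_triple T tau z (f30 f21 : Z * Z -> C) (u v : Z * Z) :
  (forall u, pos_root T u -> off_lattice (formC T (vecC u) z) tau) ->
  (forall u, pos_root T u -> is_f_deriv 3 0 (formC T (vecC u) z) tau (f30 u)) ->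
  (forall u, pos_root T u -> is_f_deriv 2 1 (formC T (vecC u) z) tau (f21 u)) ->
  let w := (fst u + fst v, snd u + snd v)%Z in
  In u (pos_roots T) /\ In v (pos_roots T) /\ In w (pos_roots T) ->
  f30 u * f30 v - f30 w * (f30 u + f30 v) - (f21 u + f21 v + f21 w) = 0.
Proof.
  intros Hz H30 H21 w [Hu [Hv Hw]]. apply pos_rootsP in Hu, Hv, Hw.
  rewrite (is_f_deriv_30 _ _ _ (H30 u Hu)), (is_f_deriv_30 _ _ _ (H30 v Hv)), (is_f_deriv_30 _ _ _ (H30 w Hw)).
  rewrite (is_f_deriv_21 _ _ _ (H21 u Hu)), (is_f_deriv_21 _ _ _ (H21 v Hv)), (is_f_deriv_21 _ _ _ (H21 w Hw)).
  assert (A := fzzz_addition (formC T (vecC u) z) (formC T (vecC v) z) tau (Hz u Hu) (Hz v Hv)).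
  rewrite formC_add in A. fold w in A. rewrite (A (Hz w Hw)). ring.
Qed.

Theorem lemma22 (T : rank2_type) (tau : C) (z : C * C)
    (f30 f21 : Z * Z -> C)
    (Htau : (0 < Im tau)%R)
    (Hz : forall u, pos_root T u -> off_lattice (formC T (vecC u) z) tau)
    (H30 : forall u, pos_root T u ->
       is_f_deriv 3 0 (formC T (vecC u) z) tau (f30 u))
    (H21 : forall u, pos_root T u ->
       is_f_deriv 2 1 (formC T (vecC u) z) tau (f21 u)) :
  Csum (unordered_pairs (pos_roots T))
    (fun p => RtoC (IZR (form T (fst p) (snd p))) * f30 (fst p) * f30 (snd p))
  + Csum (pos_roots T) (fun u => RtoC (IZR (k_coef T u)) * f21 u) = 0.
Proof.
  assert (R := fun u v => root_triple T tau z f30 f21 u v Hz H30 H21).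
  destruct T.
  - assert (E1 := R (1, 0)%Z (0, 1)%Z ltac:(simpl; tauto)).
    (* The relation has coefficient 1 at the two summands and -1 at the pairs containing their sum;
       the scalar products in A2 are the opposites, hence the sign. *)
    cbn in *. match type of E1 with ?a = _ => transitivity (- a) end; [ring|].
    rewrite E1. ring.
  (* The pair [(0, 1)], [(1, 1)] occurs in both relations with opposite signs, in accordance with
     its orthogonality. Each short root lies in two of the triples and each long root in one, which
     gives the coefficients 2 and 1. *)
  - assert (E1 := R (1, 0)%Z (0, 1)%Z ltac:(simpl; tauto)).
    assert (E2 := R (0, 1)%Z (1, 1)%Z ltac:(simpl; tauto)).
    cbn in *.
    match type of E1 with ?a = _ => match type of E2 with ?b = _ => transitivity (- (a + b)) end end; [ring|].
    rewrite E1, E2. ring.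
  (* [E1] is the triple of long roots, [E2] that of short roots, and [E3] to [E5] contain one long
     and two short roots each. With weights 3, 4 and 3, a long root gets [3 + 3 = 6] and a short one
     [4 + 3 + 3 = 10]; two short roots get [3 - 4] or [4 - 3], their scalar product. *)
  - assert (E1 := R (1, 0)%Z (1, 3)%Z ltac:(simpl; tauto)).
    assert (E2 := R (0, 1)%Z (1, 1)%Z ltac:(simpl; tauto)).
    assert (E3 := R (1, 0)%Z (0, 1)%Z ltac:(simpl; tauto)).
    assert (E4 := R (0, 1)%Z (1, 2)%Z ltac:(simpl; tauto)).
    assert (E5 := R (1, 1)%Z (1, 2)%Z ltac:(simpl; tauto)).
    cbn in *.
    match type of E1 with ?a = _ => match type of E2 with ?b = _ => match type of E3 with ?c = _ =>
    match type of E4 with ?d = _ => match type of E5 with ?e = _ =>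
      transitivity (- (3 * a + 4 * b + 3 * (c + d + e))) end end end end end; [ring|].
    rewrite E1, E2, E3, E4, E5. ring.
Qed.
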